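(* Let $M$ be a connected smooth $2$-manifold and let $\boldsymbol{x}\colon M\to\mathbb{R}^3$ be a smooth immersion with Gaussian curvature function $K$, such that $M$ has no (nonempty) open subset on which $\operatorname{grad}K=0$. Suppose that $\boldsymbol{x}$ has semi-rotational Gauss map. Then $\boldsymbol{x}$ is a helicoidal surface or $\boldsymbol{x}$ is locally congruent to a surface $\boldsymbol{x}_{m,c}$ for some $m\in\mathbb{R}\setminus\{0,1\}$ and some $c\in\mathbb{R}\setminus\{0\}$.
   Context: Semi-rotational Gauss map: let $\boldsymbol{n}$ denote the Gauss map (unit normal field) of $\boldsymbol{x}$. The surface $\boldsymbol{x}\colon M\to\mathbb{R}^3$ is said to have semi-rotational Gauss map if there exist a straight line $l\subset\mathbb{R}^3$, a plane $P\subset\mathbb{R}^3$, and a $1$-parameter group $\{\phi_t\}$ of diffeomorphisms of $M$ such that, with a suitable choice of orientations of $l$ and $P$, (1) $l$ is orthogonal to $P$; (2) $\pi\circ\boldsymbol{x}\circ\phi_t=R_t\circ\pi\circ\boldsymbol{x}$; (3) $\boldsymbol{n}\circ\phi_t=\mathcal{R}_{kt}\circ\boldsymbol{n}$ for some constant $k$. Here $\pi\colon\mathbb{R}^3\to P$ is the orthogonal projection, $R_t$ is the rotation of $P$ by angle $t$ with center $P\cap l$, and $\mathcal{R}_{kt}$ is the rotation of $\mathbb{R}^3$ by angle $kt$ with respect to the axis $l$ (acting on unit normal vectors through its linear part). Helicoidal surface: a surface in $\mathbb{R}^3$ that is invariant under a one-parameter group of rigid screw motions (this includes surfaces of revolution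 and right helicoids). The surface $\boldsymbol{x}_{m,c}$: for $m\in\mathbb{R}\setminus\{0,1\}$ and $c\in\mathbb{R}\setminus\{0\}$, $$\boldsymbol{x}_{m,c}(r,\theta)=\left(r\cos\theta,\ r\sin\theta,\ c\,r^m\cos m\theta\right),\qquad r>0,$$ with $\theta\in\mathbb{R}$; for non-integer $m$ it is a multi-valued graph over $\mathbb{R}^2\setminus\{(0,0)\}$ (a surface defined on the universal cover), for integer $m$ it is the graph of $c\operatorname{Re}(z^m)$, $z=re^{i\theta}$, which for positive integer $m$ is also defined at the origin. Locally congruent means: locally equal, up to reparametrization and a rigid motion of $\mathbb{R}^3$, to a piece of the indicated surface. *)

(* Defs.v *)
From HB Require Import structures.
From mathcomp Require Import all_boot all_order all_algebra.
From mathcomp Require Import all_classical all_reals all_analysis.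
From mathcomp Require Import complex.

Set Implicit Arguments.
Unset Strict Implicit.
Unset Printing Implicit Defensive.

Import Order.TTheory GRing.Theory Num.Theory.
Import numFieldNormedType.Exports.

Local Open Scope classical_set_scope.
Local Open Scope ring_scope.

(* C^k and C^oo on an open set [U] of a finite-dimensional space, through
   iterated directional derivatives; [U] is meant to be open. *)
Fixpoint Ck_on (R : realType) (V W : normedModType R) (k : nat)
    (U : set V) (f : V -> W) : Prop :=
  (forall x, U x -> {for x, continuous f}) /\
  (if k is k'.+1 then
     (forall x v, U x -> derivable f x v) /\
     (forall v, Ck_on k' U (fun x => 'D_v f x))
   else True).

Definition smooth_on (R : realType) (V W : normedModType R)
    (U : set V) (f : V -> W) : Prop := forall k, Ck_on k U f.

(* A chart is a homeomorphism from the open set [cdom] onto the open set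
   [cim c] of R^2; [cmap] and [cinv] are junk outside these sets. *)
Record chart (R : realType) (T : topologicalType) := Chart {
  cdom : set T;
  cmap : T -> 'rV[R]_2;
  cinv : 'rV[R]_2 -> T;
  cdom_open : open cdom;
  cim_open : open (cmap @` cdom);
  cmapK : forall p, cdom p -> cinv (cmap p) = p;
  cmap_continuous : forall p, cdom p -> {for p, continuous cmap};
  cinv_continuous : forall u, (cmap @` cdom) u -> {for u, continuous cinv} }.

Definition cim (R : realType) (T : topologicalType) (c : chart R T) :
  set 'rV[R]_2 := cmap c @` cdom c.

Definition smooth_transition (R : realType) (T : topologicalType)
    (c d : chart R T) : Prop :=
  smooth_on (cmap c @` (cdom c `&` cdom d)) (cmap d \o cinv c).

Record manifold2 (R : realType) := Manifold2 {
  mcarrier :> topologicalType;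
  m_hausdorff : hausdorff_space mcarrier;
  m_second_countable : @second_countable mcarrier;
  atlas : set (chart R mcarrier);
  atlas_cover : forall p : mcarrier, exists2 c, atlas c & cdom c p;
  atlas_smooth : forall c d, atlas c -> atlas d -> smooth_transition c d }.

(* Members of the maximal atlas, i.e. diffeomorphisms from an open subset of
   [M] onto an open subset of R^2. *)
Definition smooth_chart (R : realType) (M : manifold2 R) (e : chart R M) :
    Prop :=
  forall c, atlas c -> smooth_transition e c /\ smooth_transition c e.

(* A chosen chart of the atlas around [p]. *)
Definition chart_at (R : realType) (M : manifold2 R) (p : M) : chart R M :=
  s2val (cid2 (atlas_cover p)).

Definition smooth_map (R : realType) (M : manifold2 R) (V : normedModType R)
    (f : M -> V) : Prop :=
  forall c, atlas c -> smooth_on (cim c) (f \o cinv c).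

(* The differential of [f] at [p], applied to the tangent vector whose
   coordinates in the chart [chart_at p] are [v]. *)
Definition dmap (R : realType) (M : manifold2 R) (V : normedModType R)
    (f : M -> V) (p : M) (v : 'rV[R]_2) : V :=
  'D_v (f \o cinv (chart_at p)) (cmap (chart_at p) p).

Definition smooth_immersion (R : realType) (M : manifold2 R)
    (x : M -> 'rV[R]_3) : Prop :=
  smooth_map x /\ forall p, injective (dmap x p).

Definition dot (R : realType) (u v : 'rV[R]_3) : R := (u *m v^T) 0 0.

(* Indices in 'I_3 are added modulo 3. *)
Definition cross (R : realType) (u v : 'rV[R]_3) : 'rV[R]_3 :=
  \row_(i < 3) (u 0 (i + 1) * v 0 (i + 2%:R) - u 0 (i + 2%:R) * v 0 (i + 1)).

Definition unit_vec (R : realType) (a : 'rV[R]_3) : Prop := dot a a = 1.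

Definition gauss_map (R : realType) (M : manifold2 R)
    (x n : M -> 'rV[R]_3) : Prop :=
  [/\ smooth_map n, forall p, unit_vec (n p)
    & forall p v, dot (n p) (dmap x p v) = 0].

(* Matrices of the two fundamental forms in the chart [chart_at p]. *)
Definition first_form (R : realType) (M : manifold2 R)
    (x : M -> 'rV[R]_3) (p : M) : 'M[R]_2 :=
  \matrix_(i, j) dot (dmap x p (delta_mx 0 i)) (dmap x p (delta_mx 0 j)).

Definition second_form (R : realType) (M : manifold2 R)
    (x n : M -> 'rV[R]_3) (p : M) : 'M[R]_2 :=
  \matrix_(i, j) dot (n p)
    ('D_(delta_mx 0 j) ('D_(delta_mx 0 i) (x \o cinv (chart_at p)))
      (cmap (chart_at p) p)).

Definition gauss_curvature (R : realType) (M : manifold2 R)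
    (x n : M -> 'rV[R]_3) (p : M) : R :=
  \det (second_form x n p) / \det (first_form x p).

(* [w] is the gradient of [f] at [p] for the metric induced by [x], tangent
   vectors of [M] being identified with their images under the differential
   of [x]. *)
Definition is_gradient (R : realType) (M : manifold2 R)
    (x : M -> 'rV[R]_3) (f : M -> R) (p : M) (w : 'rV[R]_3) : Prop :=
  (exists v, w = dmap x p v) /\
  (forall v, dot w (dmap x p v) = dmap (f : M -> R^o) p v).

(* Rodrigues' formula: the rotation by the angle [t] about the oriented axis
   through the origin spanned by the unit vector [a]. *)
Definition rotation (R : realType) (a : 'rV[R]_3) (t : R) (v : 'rV[R]_3) :
    'rV[R]_3 :=
  cos t *: v + sin t *: cross a v + ((1 - cos t) * dot a v) *: a.

Definition rotation_about (R : realType) (o a : 'rV[R]_3) (t : R)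
    (y : 'rV[R]_3) : 'rV[R]_3 := o + rotation a t (y - o).

Definition line (R : realType) (q a : 'rV[R]_3) : set 'rV[R]_3 :=
  [set y | exists s, y = q + s *: a].

Definition plane (R : realType) (p b : 'rV[R]_3) : set 'rV[R]_3 :=
  [set y | dot (y - p) b = 0].

Definition proj_plane (R : realType) (p b y : 'rV[R]_3) : 'rV[R]_3 :=
  y - dot (y - p) b *: b.

Definition one_parameter_group (R : realType) (M : manifold2 R)
    (phi : R -> M -> M) : Prop :=
  [/\ forall p, phi 0 p = p,
      forall s t p, phi (s + t) p = phi s (phi t p),
      continuous (fun tp : R * M => phi tp.1 tp.2)
    & forall c d, atlas c -> atlas d ->
        smooth_on
          [set tu : (R^o * 'rV[R]_2)%type |
             cim c tu.2 /\ cdom d (phi tu.1 (cinv c tu.2))]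
          (fun tu => cmap d (phi tu.1 (cinv c tu.2)))].

(* The line [line q a] is oriented by [a], and the plane [plane r b] is
   oriented by its unit normal [b]; the rotation by [t] of the oriented plane
   about [o] is the restriction to it of [rotation_about o b t]. *)
Definition semi_rotational_gauss_map (R : realType) (M : manifold2 R)
    (x n : M -> 'rV[R]_3) : Prop :=
  exists (q a r b o : 'rV[R]_3) (phi : R -> M -> M),
    [/\ unit_vec a /\ unit_vec b,
        (forall v, dot v b = 0 -> dot v a = 0) /\
          line q a `&` plane r b = [set o],
        one_parameter_group phi,
        (forall t p, proj_plane r b (x (phi t p)) =
                     rotation_about o b t (proj_plane r b (x p)))
      & exists k : R, forall t p, n (phi t p) = rotation a (k * t) (n p)].

(* The screw motions with axis [line q a] and pitch [h]; surfaces of revolution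
   are the case [h = 0]. *)
Definition screw (R : realType) (q a : 'rV[R]_3) (h t : R) (y : 'rV[R]_3) :
    'rV[R]_3 := rotation_about q a t y + (h * t) *: a.

Definition helicoidal (R : realType) (M : manifold2 R)
    (x : M -> 'rV[R]_3) : Prop :=
  exists (q a : 'rV[R]_3) (h : R) (psi : R -> M -> M),
    [/\ unit_vec a, one_parameter_group psi
      & forall t p, x (psi t p) = screw q a h t (x p)].

Definition vec3 (R : realType) (a b c : R) : 'rV[R]_3 :=
  \row_(i < 3) [:: a; b; c]`_i.

(* The parameter [u] is (r, theta). *)
Definition xmc (R : realType) (m c : R) (u : 'rV[R]_2) : 'rV[R]_3 :=
  let r := u 0 0 in let th := u 0 1 in
  vec3 (r * cos th) (r * sin th) (c * r `^ m * cos (m * th)).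

Definition xmc_dom (R : realType) : set 'rV[R]_2 := [set u | 0 < u 0 0].

(* The graph of c Re(z^k), which is x_{k,c} together with the origin. *)
Definition xmc_graph (R : realType) (k : nat) (c : R) (u : 'rV[R]_2) :
    'rV[R]_3 :=
  vec3 (u 0 0) (u 0 1) (c * complex.Re ((u 0 0 +i* u 0 1)%C ^+ k)).

(* Around [p], up to a rigid motion, [x] is a reparametrization of a piece of
   the surface parametrized by [y] on [D]. *)
Definition locally_congruent_at (R : realType) (M : manifold2 R)
    (x : M -> 'rV[R]_3) (p : M) (D : set 'rV[R]_2) (y : 'rV[R]_2 -> 'rV[R]_3) :
    Prop :=
  exists (e : chart R M) (Q : 'M[R]_3) (w : 'rV[R]_3),
    [/\ smooth_chart e /\ cdom e p, cim e `<=` D,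
        Q *m Q^T = 1%:M /\ \det Q = 1
      & forall p', cdom e p' -> x p' *m Q + w = y (cmap e p')].

Definition locally_congruent_xmc (R : realType) (M : manifold2 R)
    (x : M -> 'rV[R]_3) (m c : R) : Prop :=
  forall p,
    locally_congruent_at x p (@xmc_dom R) (xmc m c) \/
    exists k : nat, [/\ (0 < k)%N, m = k%:R
      & locally_congruent_at x p setT (xmc_graph k c)].

(* Main.v *)
(* Choose coordinates so that [l] is the third axis, and write the surface as
   (z, h) and its normal as (nu, n3), with z and nu complex. Along the flow z is
   multiplied by e^{it}, nu by e^{ikt}, and n3 is constant; orthogonality of the
   normal to the velocity of the flow then gives
     n3 d/dt h(phi_t p) = Im (w e^{i(1-k)t}),   w = conj(nu) z.
   If k = 1, the height grows linearly in t, at a rate that turns out to be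
   constant on the surface: the flow is a screw motion.
   If k <> 1, put m = 1 - k and zeta = conj(nu) / n3. Integrating the equation
   above and differentiating the tangency condition at phi_t p for several t
   gives d(zeta z) = m zeta dz and dh = - Re(zeta dz), so locally
   zeta z = C z^m and h = h0 - Re(C z^m) / m. Near a zero of z, single-valuedness
   and continuity force m to be a positive integer. Finally |C| does not depend on
   the point because the surface is connected. *)

Require Import Defs.
From HB Require Import structures.
From mathcomp Require Import all_boot all_order all_algebra.
From mathcomp Require Import all_classical all_reals all_analysis.
From mathcomp Require Import complex ring lra.

Set Implicit Arguments.
Unset Strict Implicit.
Unset Printing Implicit Defensive.

Import Order.TTheory GRing.Theory Num.Theory.
Import numFieldNormedType.Exports.

Local Open Scope classical_set_scope.
Local Open Scope ring_scope.


(** * Calculus of C^k functions *)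

Section Ck.
Variable R : realType.
Implicit Types V W : normedModType R.

(** The quotient zeta requires n3 <> 0, and the curvature hypothesis gives this directly only on a
    dense set. For k = 1 density suffices, since what has to be proved are equalities of continuous
    functions. For k <> 1 a zero of n3 has to be excluded outright, by an argument on the orbit
    through it. Once n3 vanishes nowhere, tangency determines dh from dz, so z is a local coordinate
    of the surface, and the inverse function theorem replaces the given charts by z. The curvature
    hypothesis enters twice more: k = 0, that is m = 1, would make the normal locally constant up to
    scaling, and C = 0 would make it parallel to l on an open set. Only the modulus of C is compared
    between points: its argument depends on the branch of the angle and is absorbed by a rotation
    about l. All complex identities are carried out in real and imaginary parts, with real
    directional derivatives. *)

Lemma Ck_continuous V W k (U : set V) (f : V -> W) x :
  Ck_on k U f -> U x -> {for x, continuous f}.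
Proof. by case: k => [|k] [+ _]; exact. Qed.

Lemma Ck_derivable V W k (U : set V) (f : V -> W) x v :
  Ck_on k.+1 U f -> U x -> derivable f x v.
Proof. by move=> [_ [+ _]]; exact. Qed.

Lemma Ck_derive V W k (U : set V) (f : V -> W) v :
  Ck_on k.+1 U f -> Ck_on k U (fun x => 'D_v f x).
Proof. by move=> [_ [_]]; exact. Qed.

Lemma Ck_subset V W k (U U' : set V) (f : V -> W) :
  U' `<=` U -> Ck_on k U f -> Ck_on k U' f.
Proof.
move=> UU; elim: k f => [|k IH] f [cf df]; split=> //.
- by move=> x /UU; exact: cf.
- by move=> x /UU; exact: cf.
- by case: df => d1 d2; split=> [x v /UU ?|v]; [exact: d1|exact: (IH _ (d2 v))].
Qed.

Lemma near_eq_continuous (T : topologicalType) W (f g : T -> W) x :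
  (\near x, f x = g x) -> {for x, continuous f} -> {for x, continuous g}.
Proof.
move=> fg cf; rewrite /prop_for /continuous_at -(nbhs_singleton fg).
apply: cvg_trans cf; exact: near_eq_cvg.
Unshelve. all: by end_near. Qed.

Lemma eq_Ck_on V W k (U : set V) (f g : V -> W) : open U ->
  (forall x, U x -> f x = g x) -> Ck_on k U f -> Ck_on k U g.
Proof.
move=> oU; elim: k f g => [|k IH] f g fg [cf df];
  have nfg x : U x -> \near x, f x = g x.
- by move=> Ux; near=> y; apply: fg; near: y; exact: open_nbhs_nbhs.
- by split=> // x Ux; apply: near_eq_continuous (cf _ Ux); exact: nfg.
- by move=> Ux; near=> y; apply: fg; near: y; exact: open_nbhs_nbhs.
- split=> [x Ux|]; first by apply: near_eq_continuous (cf _ Ux); exact: nfg.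
  case: df => d1 d2; split=> [x v Ux|v].
    by apply: near_eq_derivable (d1 _ _ Ux); exact: nfg.
  by apply: IH (d2 v) => x Ux; apply: near_eq_derive; exact: nfg.
Unshelve. all: by end_near. Qed.

Lemma Ck_pred V W k (U : set V) (f : V -> W) : Ck_on k.+1 U f -> Ck_on k U f.
Proof.
elim: k f => [|k IH] f [cf [d1 d2]]; first by split.
by split=> //; split=> // v; exact: IH.
Qed.

(** The closure properties below are inductions on k through this rule: it suffices to give a
    formula for the directional derivatives on U and to recognise that formula as C^k. *)
Lemma Ck_of_derive V W k (U : set V) (f : V -> W) (df : V -> V -> W) : open U ->
  (forall x, U x -> {for x, continuous f}) ->
  (forall x v, U x -> is_derive x v f (df v x)) ->
  (forall v, Ck_on k U (df v)) -> Ck_on k.+1 U f.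
Proof.
move=> oU cf dfP kdf; split=> //; split=> [x v Ux|v].
  by have [] := dfP x v Ux.
by apply: eq_Ck_on (kdf v) => // x Ux; have [_ ->] := dfP x v Ux.
Qed.

Lemma Ck_cst V W k (U : set V) (c : W) : open U -> Ck_on k U (fun=> c).
Proof.
move=> oU; elim: k c => [|k IH] c.
  by split=> // x _; exact: cst_continuous.
apply: (@Ck_of_derive _ _ _ _ _ (fun _ _ => 0)) => //.
by move=> x _; exact: cst_continuous.
Qed.

Lemma Ck_add V W k (U : set V) (f g : V -> W) : open U ->
  Ck_on k U f -> Ck_on k U g -> Ck_on k U (fun x => f x + g x).
Proof.
move=> oU; elim: k f g => [|k IH] f g [cf df] [cg dg].
  by split=> // x Ux; apply: continuousD; [exact: cf|exact: cg].
apply: (@Ck_of_derive _ _ _ _ _ (fun v x => 'D_v f x + 'D_v g x)) => //.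
- by move=> x Ux; apply: continuousD; [exact: cf|exact: cg].
- move=> x v Ux; apply: is_deriveD; apply: derivableP; [exact: df.1|exact: dg.1].
- by move=> v; apply: IH; [exact: df.2|exact: dg.2].
Qed.

Lemma Ck_mul V k (U : set V) (f g : V -> R) : open U ->
  Ck_on k U f -> Ck_on k U g -> Ck_on k U (fun x => f x * g x).
Proof.
move=> oU; elim: k f g => [|k IH] f g kf kg; have [cf df] := kf; have [cg dg] := kg;
  have cfg x : U x -> {for x, continuous (fun x => f x * g x)}.
- by move=> Ux; apply: continuousM; [exact: cf|exact: cg].
- by split.
- by move=> Ux; apply: continuousM; [exact: cf|exact: cg].
- apply: (@Ck_of_derive _ _ _ _ _ (fun v x => f x * 'D_v g x + g x * 'D_v f x)) => //.
  + move=> x v Ux; apply: is_deriveM; apply: derivableP; [exact: df.1|exact: dg.1].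
  + move=> v; apply: Ck_add => //; apply: IH.
    * exact: Ck_pred.
    * exact: dg.2.
    * exact: Ck_pred.
    * exact: df.2.
Qed.

Lemma Ck_opp V k (U : set V) (f : V -> R) : open U ->
  Ck_on k U f -> Ck_on k U (fun x => - f x).
Proof.
move=> oU kf; apply: (@eq_Ck_on _ _ _ _ (fun x => (-1) * f x)) => //.
  by move=> x _; rewrite mulN1r.
by apply: Ck_mul => //; exact: Ck_cst.
Qed.

Lemma Ck_inv V k (U : set V) (f : V -> R) : open U ->
  (forall x, U x -> f x != 0) -> Ck_on k U f -> Ck_on k U (fun x => (f x)^-1).
Proof.
move=> oU f0; elim: k f f0 => [|k IH] f f0 kf; have [cf df] := kf;
  have cfg x : U x -> {for x, continuous (fun x => (f x)^-1)}.
- by move=> Ux; apply: continuousV; [exact: f0|exact: cf].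
- by split.
- by move=> Ux; apply: continuousV; [exact: f0|exact: cf].
- apply: (@Ck_of_derive _ _ _ _ _ (fun v x => - (((f x)^-1 * (f x)^-1) * 'D_v f x))) => //.
  + move=> x v Ux; split; first by apply: derivableV; [exact: f0|exact: df.1].
    rewrite deriveV; [|exact: f0|exact: df.1].
    by rewrite scaleNr [_ *: _]/(_ * _) expr2 invfM.
  + move=> v; apply: Ck_opp => //; apply: Ck_mul => //; last exact: df.2.
    by apply: Ck_mul => //; apply: IH => //; exact: Ck_pred.
Qed.

Lemma is_derive_line V W (f : V -> W) (x w : V) (t : R) :
  derivable f (x + t *: w) w ->
  is_derive (t : R) (1 : R) (fun t : R => f (x + t *: w)) ('D_w f (x + t *: w)).
Proof.
rewrite /derivable /derive => df.
have E : (fun h : R => h^-1 *: (((fun t : R => f (x + t *: w)) \o shift t) (h *: 1) -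
    f (x + t *: w))) = (fun h => h^-1 *: ((f \o shift (x + t *: w)) (h *: w) - f (x + t *: w))).
  apply/funext => h /=; rewrite [h *: 1]mulr1 scalerDl; congr (_ *: (f _ - _)).
  by rewrite addrCA.
by split; rewrite /derivable /derive E.
Qed.

(** Both difference quotients are the same function of h. Chain rules along a vector of a normed
    space thus reduce to the chain rule in one variable. *)
Lemma is_derive_line0 V W (g : V -> W) (x v : V) (l : W) :
  is_derive x v g l <-> is_derive (0 : R) (1 : R) (fun h : R => g (x + h *: v)) l.
Proof.
pose G (h : R) := g (x + h *: v).
have e2 : (fun h : R => h^-1 *: ((G \o shift 0) (h *: 1) - G 0)) =
    (fun h => h^-1 *: ((g \o shift x) (h *: v) - g x)).
  apply/funext => h /=; rewrite /G scale0r !addr0 [h *: 1]mulr1.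
  by rewrite (addrC x).
rewrite -/G; split=> -[d1 d2]; split.
- by rewrite /derivable e2.
- by rewrite /derive e2.
- by move: d1; rewrite /derivable e2.
- by move: d2; rewrite /derive e2.
Qed.

Lemma is_derive_comp1 V (f : V -> R) (g : R -> R) x v a b :
  is_derive x v f b -> is_derive (f x) 1 g a ->
  is_derive x v (fun x => g (f x)) (a * b).
Proof.
move=> /is_derive_line0 df dg; apply/is_derive_line0.
pose F (h : R) := f (x + h *: v).
have F0 : F 0 = f x by rewrite /F scale0r addr0.
rewrite -F0 in dg.
exact: (@is_derive1_comp R g F).
Qed.

Lemma Ck_cos_sin V k (U : set V) (f : V -> R) : open U -> Ck_on k U f ->
  Ck_on k U (fun x => cos (f x)) /\ Ck_on k U (fun x => sin (f x)).
Proof.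
move=> oU; elim: k f => [|k IH] f kf; have [cf df] := kf.
  by split; split=> // x Ux; apply: continuous_comp; [exact: cf|exact: continuous_cos
     |exact: cf|exact: continuous_sin].
have [kc ks] := IH _ (Ck_pred kf).
have chain (g : R -> R) x v a : is_derive (f x) 1 g a -> U x ->
    is_derive x v (fun x => g (f x)) (a * 'D_v f x).
  by move=> dg Ux; apply: is_derive_comp1 dg; apply: derivableP; exact: df.1.
split.
- apply: (@Ck_of_derive _ _ _ _ _ (fun v x => (- sin (f x)) * 'D_v f x)) => //.
  + by move=> x Ux; apply: continuous_comp; [exact: cf|exact: continuous_cos].
  + by move=> v; exact: (Ck_mul oU (Ck_opp oU ks) (df.2 v)).
- apply: (@Ck_of_derive _ _ _ _ _ (fun v x => (cos (f x)) * 'D_v f x)) => //.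
  + by move=> x Ux; apply: continuous_comp; [exact: cf|exact: continuous_sin].
  + by move=> v; exact: (Ck_mul oU kc (df.2 v)).
Qed.

End Ck.

(** * Differentiability of C^1 functions on the plane *)

Section Plane.
Variable R : realType.
Implicit Types (u v x y : 'rV[R]_2).

Definition vec2 (a b : R) : 'rV[R]_2 := \row_(i < 2) [:: a; b]`_i.

Lemma vec20 a b : vec2 a b 0 0 = a. Proof. by rewrite mxE. Qed.
Lemma vec21 a b : vec2 a b 0 1 = b. Proof. by rewrite mxE. Qed.
Definition vec2E := (vec20, vec21).

Lemma rV2P u v : u 0 0 = v 0 0 -> u 0 1 = v 0 1 -> u = v.
Proof.
move=> e0 e1; apply/rowP => -[[|[|//]] lti].
- by rewrite (_ : Ordinal lti = 0) //; exact: val_inj.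
- by rewrite (_ : Ordinal lti = 1) //; exact: val_inj.
Qed.

Lemma vec2_eta u : vec2 (u 0 0) (u 0 1) = u.
Proof. by apply: rV2P; rewrite !vec2E. Qed.

Lemma norm_rV2_lt u e : (`|u| < e) = (`|u 0 0| < e) && (`|u 0 1| < e).
Proof.
rewrite [`|u|]/Num.Def.normr/= mx_normrE; apply/bigmax_ltP/andP => /=.
  by move=> [_ H]; split; [exact: (H (0, 0))|exact: (H (0, 1))].
move=> [h0 h1]; split; first exact: le_lt_trans h0.
move=> [i j] _ /=; rewrite (ord1 i); move: j => [[|[|//]] ltj].
- by rewrite (_ : Ordinal ltj = 0) //; exact: val_inj.
- by rewrite (_ : Ordinal ltj = 1) //; exact: val_inj.
Qed.

Lemma coord_le_norm u i : `|u 0 i| <= `|u|.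
Proof.
rewrite leNgt; apply/negP; rewrite norm_rV2_lt; move: i => [[|[|//]] lti].
- by rewrite (_ : Ordinal lti = 0) ?ltxx //; exact: val_inj.
- by rewrite (_ : Ordinal lti = 1) ?ltxx ?andbF //; exact: val_inj.
Qed.

Lemma norm_rV2_le u e : (`|u| <= e) = (`|u 0 0| <= e) && (`|u 0 1| <= e).
Proof.
apply/idP/andP => [ue|[u0 u1]].
  by split; apply: le_trans ue; exact: coord_le_norm.
rewrite leNgt; apply/negP => eu; have := ltxx (`|u|); rewrite norm_rV2_lt.
by rewrite (le_lt_trans u0 eu) (le_lt_trans u1 eu).
Qed.

Definition e_ (i : 'I_2) : 'rV[R]_2 := delta_mx 0 i.

Lemma MVT_line (V : normedModType R) (f : V -> R) (x w : V) (s : R) :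
  (forall t, 0 <= t <= 1 -> derivable f (x + (t * s) *: w) w) ->
  exists2 t, 0 <= t <= 1 & f (x + s *: w) - f x = s * 'D_w f (x + (t * s) *: w).
Proof.
move=> df; pose g (t : R) := f (x + (t * s) *: w).
have dg (t : R) : 0 <= t <= 1 -> is_derive t 1 g (s * 'D_w f (x + (t * s) *: w)).
  move=> /df dft; rewrite mulrC.
  have h1 : is_derive (t * s) 1 (fun t => f (x + t *: w)) ('D_w f (x + (t * s) *: w)).
    exact: is_derive_line.
  have h2 : is_derive t 1 (fun t : R => t * s) s.
    rewrite (_ : (fun t => t * s) = s *: id); last by apply/funext => y; rewrite mulrC.
    by apply: is_derive_eq; rewrite [_ *: 1]mulr1.
  exact: (@is_derive1_comp R _ (fun t => t * s)).
have [||t t01 gt] := @MVT_segment R g (fun t => s * 'D_w f (x + (t * s) *: w)) 0 1 ler01.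
- by move=> y; rewrite in_itv /= => /andP[y0 y1]; apply: dg; rewrite !ltW.
- apply: derivable_within_continuous => y; rewrite in_itv /= => y01.
  by have [] := dg _ y01.
exists t; first by move: t01; rewrite in_itv.
by move: gt; rewrite /g mul1r mul0r scale0r addr0 subr0 mulr1.
Qed.

Lemma ball_segment (V : normedModType R) (c x w : V) d (t : R) :
  0 <= t <= 1 -> `|x - c| < d -> `|x + w - c| < d -> `|x + t *: w - c| < d.
Proof.
move=> /andP[t0 t1] xd wd.
have -> : x + t *: w - c = (1 - t) *: (x - c) + t *: (x + w - c).
  rewrite [x + w - c]addrAC [x + t *: w - c]addrAC; set y := x - c.
  by rewrite scalerBl scale1r [t *: (y + w)]scalerDr addrA subrK.
have [->|tn1] := eqVneq t 1.
  by rewrite subrr scale0r add0r scale1r.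
apply: le_lt_trans (ler_normD _ _) _; rewrite !normrZ (ger0_norm t0).
rewrite ger0_norm ?subr_ge0 //.
have lt1 : t < 1 by rewrite lt_neqAle tn1.
rewrite (_ : d = (1 - t) * d + t * d); last by ring.
by apply: ltr_leD; [rewrite ltr_pM2l ?subr_gt0|rewrite ler_wpM2l // ltW].
Qed.

Lemma nbhs_ballR (V : normedModType R) (U : set V) (x : V) :
  nbhs x U -> exists2 d : R, 0 < d & forall y : V, `|y - x| < d -> U y.
Proof.
move=> /nbhs_normP[d d0 dU]; exists d => // y xy; apply: dU.
by rewrite /= distrC.
Qed.

Lemma norm_lincomb_le (a b p q N e : R) : `|a| <= N -> `|b| <= N ->
  `|p| <= e / 2 -> `|q| <= e / 2 -> `|a * p + b * q| <= e * N.
Proof.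
move=> aN bN pe qe; apply: le_trans (ler_normD _ _) _; rewrite !normrM.
have -> : e * N = N * (e / 2) + N * (e / 2) by rewrite -mulrDr -splitr mulrC.
by apply: lerD; apply: ler_pM.
Qed.

(** The way from x to y is split into a horizontal and a vertical leg, with the mean value theorem
    on each; the corner stays in the ball because the norm is the sup norm. Uniformity in both x and
    y (strict differentiability) is what the inverse function theorem needs. *)
Lemma C1_strict (U : set 'rV[R]_2) (f : 'rV[R]_2 -> R) x0 : open U -> U x0 ->
  Ck_on 1 U f -> forall e, 0 < e -> exists d, [/\ 0 < d,
   forall x, `|x - x0| < d -> U x & forall x y, `|x - x0| < d -> `|y - x0| < d ->
   `|f y - f x - ((y - x) 0 0 * 'D_(e_ 0) f x0 + (y - x) 0 1 * 'D_(e_ 1) f x0)|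
     <= e * `|y - x| ].
Proof.
move=> oU Ux0 [_ [df cdf]] e e0.
have nD i : nbhs x0 (fun x => `|'D_(e_ i) f x - 'D_(e_ i) f x0| < e / 2).
  have [c _] := cdf (e_ i).
  have /cvgrPdist_lt /(_ (e / 2)) := c _ Ux0.
  rewrite divr_gt0 // => /(_ isT); apply: filterS => y; by rewrite distrC.
have nU : nbhs x0 U by exact: open_nbhs_nbhs.
have [d d0 dP] := nbhs_ballR (filterI nU (filterI (nD 0) (nD 1))).
exists d; split=> // [x /dP[]//|x y xd yd].
set a := (y - x) 0 0; set b := (y - x) 0 1.
have yE : y = (x + a *: e_ 0) + b *: e_ 1.
  by apply: rV2P; rewrite /a /b !mxE /=; ring.
have md : `|x + a *: e_ 0 - x0| < d.
  move: xd yd; rewrite !norm_rV2_lt /a !mxE /= !mulr1 !mulr0 addr0.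
  move=> /andP[_ ->] /andP[yd _]; rewrite andbT.
  by rewrite (_ : x 0 0 + _ - _ = y 0 0 - x0 0 0) //; ring.
have [|t1 t1P E1] := @MVT_line _ f x (e_ 0) a.
- move=> t t01; apply: df; apply: (dP _ _).1; rewrite -scalerA; exact: ball_segment.
have [|t2 t2P E2] := @MVT_line _ f (x + a *: e_ 0) (e_ 1) b.
- move=> t t01; apply: df; apply: (dP _ _).1; rewrite -scalerA.
  by apply: ball_segment => //; rewrite -yE.
rewrite -yE in E2.
have b1 : `|x + (t1 * a) *: e_ 0 - x0| < d by rewrite -scalerA; exact: ball_segment.
have b2 : `|x + a *: e_ 0 + (t2 * b) *: e_ 1 - x0| < d.
  by rewrite -scalerA; apply: ball_segment => //; rewrite -yE.
have [_ [D1 _]] := dP _ b1; have [_ [_ D2]] := dP _ b2.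
rewrite (_ : f y - f x = (f y - f (x + a *: e_ 0)) + (f (x + a *: e_ 0) - f x)); last by ring.
rewrite E1 E2; set p := 'D__ f _ in D1 *; set q := 'D__ f _ in D1 *.
set r := 'D__ f _ in D2 *; set s := 'D__ f _ in D2 *.
rewrite (_ : b * _ + a * _ - _ = a * (p - q) + b * (r - s)); last first.
  by move: (p : R) (q : R) (r : R) (s : R) => *; ring.
exact: (@norm_lincomb_le a b (p - q) (r - s) `|y - x| e
  (coord_le_norm _ _) (coord_le_norm _ _) (ltW D1) (ltW D2)).
Qed.

Definition lin2 (a b : R) v : R := v 0 0 * a + v 0 1 * b.

Lemma lin2_is_linear a b : linear (lin2 a b : 'rV[R]_2 -> R^o).
Proof. by move=> c u v; rewrite /lin2 !mxE /GRing.scale /=; ring. Qed.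

HB.instance Definition _ a b := GRing.isLinear.Build R 'rV[R]_2 R^o _ (lin2 a b)
  (lin2_is_linear a b).

Lemma lin2_continuous a b : continuous (lin2 a b).
Proof.
move=> v; apply: (@continuousD _ _ _ (fun v => v 0 0 * _) (fun v => v 0 1 * _)).
  by apply: continuousM; [exact: coord_continuous|exact: cst_continuous].
by apply: continuousM; [exact: coord_continuous|exact: cst_continuous].
Qed.

Lemma linear_approx_diff (V W : normedModType R) (f : V -> W) (L : {linear V -> W}) (x : V) :
  continuous L ->
  (forall e : R, 0 < e -> \forall h \near (0 : V), `|f (h + x) - f x - L h| <= e * `|h|) ->
  differentiable f x /\ forall w, 'D_w f x = L w.
Proof.
move=> cL fL; have H : f \o shift x = cst (f x) + L +o_ 0 id.
  by apply/eqaddoP => e /fL; apply: filterS => h; rewrite opprD addrA.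
have dE := diff_unique cL H.
have df : differentiable f x by apply/diff_locallyP; rewrite dE.
by split=> // w; rewrite deriveE // dE.
Qed.

Lemma C1_diff (U : set 'rV[R]_2) (f : 'rV[R]_2 -> R) x0 : open U -> U x0 ->
  Ck_on 1 U f -> differentiable f x0 /\
  forall v, 'D_v f x0 = lin2 ('D_(e_ 0) f x0) ('D_(e_ 1) f x0) v.
Proof.
move=> oU Ux0 f1.
apply: (@linear_approx_diff _ _ f (lin2 ('D_(e_ 0) f x0) ('D_(e_ 1) f x0))).
  exact: lin2_continuous.
move=> e e0; have [d [d0 dU dP]] := C1_strict oU Ux0 f1 e0.
apply/nbhs_normP; exists d => //= h; rewrite /= sub0r normrN => hd.
have := dP x0 (h + x0); rewrite subrr normr0 addrK; exact.
Qed.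

(** The inner map is only derivable along v. Restricted to the line through x it becomes a curve,
    for which derivable and differentiable agree, so the chain rule for differentials applies. *)
Lemma is_derive_comp2 (V : normedModType R) (U : set 'rV[R]_2)
    (f : 'rV[R]_2 -> R) (g : V -> 'rV[R]_2) (x v : V) w :
  open U -> U (g x) -> Ck_on 1 U f -> is_derive x v g w ->
  is_derive x v (f \o g) (lin2 ('D_(e_ 0) f (g x)) ('D_(e_ 1) f (g x)) w).
Proof.
move=> oU Ux f1 dg; have [df fE] := C1_diff oU Ux f1.
rewrite -fE; apply/is_derive_line0.
pose G (h : R) := g (x + h *: v).
have dG : is_derive (0 : R) (1 : R) G w by exact: (proj1 (is_derive_line0 g x v w) dg).
have G0 : G 0 = g x by rewrite /G scale0r addr0.
have dGd : differentiable G (0 : R) by apply/derivable1_diffP.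
have dfG : differentiable f (G 0) by rewrite G0.
have dfg : differentiable (f \o G) (0 : R) by exact: differentiable_comp.
split; first exact: diff_derivable.
rewrite -/(f \o G) deriveE // diff_comp //= G0 (deriveE _ df).
by rewrite -(deriveE _ dGd) derive_val.
Qed.

End Plane.

(** * Coordinates, composition and slices of C^k maps *)

Section Composition.
Variable R : realType.

Lemma Ck_coord (V : normedModType R) m n k (U : set V) (f : V -> 'M[R]_(m, n)) i j :
  open U -> Ck_on k U f -> Ck_on k U (fun x => f x i j).
Proof.
move=> oU; elim: k f => [|k IH] f kf; have [cf df] := kf;
  have ci x : U x -> {for x, continuous (fun x => f x i j)}.
- by move=> Ux; apply: (@continuous_comp _ _ _ f (fun M => M i j)); [exact: cf|exact: coord_continuous].
- by split.
- by move=> Ux; apply: (@continuous_comp _ _ _ f (fun M => M i j)); [exact: cf|exact: coord_continuous].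
apply: (@Ck_of_derive _ _ _ _ _ _ (fun v x => 'D_v f x i j)) => //.
- move=> x v Ux; have d := df.1 x v Ux; split; first by move/derivable_mxP: d; exact.
  by rewrite (derive_mx d) mxE.
- by move=> v; apply: IH; exact: df.2.
Qed.

Lemma is_derive_coord (V : normedModType R) m n (f : V -> 'M[R]_(m, n)) x v l i j :
  is_derive x v f l -> is_derive x v (fun x => f x i j) (l i j).
Proof.
move=> [d <-]; split; first by move/derivable_mxP: d; exact.
by rewrite (derive_mx d) mxE.
Qed.

Lemma is_derive_rV2 (V : normedModType R) (f : V -> 'rV[R]_2) x v (l : 'rV[R]_2) :
  (forall j, is_derive x v (fun x => f x 0 j) (l 0 j)) -> is_derive x v f l.
Proof.
move=> d; have df : derivable f x v.
  by apply/derivable_mxP => i j; rewrite (ord1 i); case: (d j).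
split=> //; rewrite (derive_mx df); apply/matrixP => i j; rewrite mxE (ord1 i).
by case: (d j).
Qed.

Lemma continuous_rV2 (T : topologicalType) (f : T -> 'rV[R]_2) x :
  (forall j, {for x, continuous (fun x => f x 0 j)}) -> {for x, continuous f}.
Proof.
move=> cf; apply/cvgrPdist_lt => e e0.
have /cvgrPdist_lt /(_ e e0) c0 := cf 0; have /cvgrPdist_lt /(_ e e0) c1 := cf 1.
near=> y; rewrite norm_rV2_lt !mxE; apply/andP; split; near: y; [exact: c0|exact: c1].
Unshelve. all: by end_near. Qed.

Lemma Ck_rV2 (V : normedModType R) k (U : set V) (f : V -> 'rV[R]_2) : open U ->
  (forall j, Ck_on k U (fun x => f x 0 j)) -> Ck_on k U f.
Proof.
move=> oU; elim: k f => [|k IH] f kf;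
  have cf x : U x -> {for x, continuous f}.
- by move=> Ux; apply: continuous_rV2 => j; exact: (Ck_continuous (kf j)).
- by split.
- by move=> Ux; apply: continuous_rV2 => j; exact: (Ck_continuous (kf j)).
apply: (@Ck_of_derive _ _ _ _ _ _
   (fun v x => \row_j 'D_v (fun x => f x 0 j) x : 'rV[R]_2)) => //.
- move=> x v Ux; apply: is_derive_rV2 => j; rewrite mxE; apply: derivableP.
  by apply: Ck_derivable (kf j) Ux.
- move=> v; apply: IH => j.
  apply: (@eq_Ck_on _ _ _ _ _ ('D_v (fun x => f x 0 j))) => //.
    by move=> x _; rewrite mxE.
  exact: (Ck_derive v (kf j)).
Qed.

Lemma Ck_comp (V : normedModType R) k (U : set V) (W : set 'rV[R]_2)
    (f : 'rV[R]_2 -> R) (g : V -> 'rV[R]_2) : open U -> open W ->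
  (forall x, U x -> W (g x)) -> Ck_on k W f -> Ck_on k U g -> Ck_on k U (f \o g).
Proof.
move=> oU oW UW; elim: k f => [|k IH] f kf kg;
  have cfg x : U x -> {for x, continuous (f \o g)}.
- by move=> Ux; apply: continuous_comp; [exact: (Ck_continuous kg)|
    apply: (Ck_continuous kf); exact: UW].
- by split.
- by move=> Ux; apply: continuous_comp; [exact: (Ck_continuous kg)|
    apply: (Ck_continuous kf); exact: UW].
apply: (@Ck_of_derive _ _ _ _ _ _ (fun v x =>
   lin2 ('D_(e_ R 0) f (g x)) ('D_(e_ R 1) f (g x)) ('D_v g x))) => //.
- move=> x v Ux; apply: (is_derive_comp2 oW) => //; first exact: UW.
    by elim: (k) kf => // j IHj /Ck_pred.
  by apply: derivableP; exact: (Ck_derivable kg).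
- move=> v; have kg' := Ck_pred kg; have kf' := Ck_pred kf.
  have H i j : Ck_on k U (fun x => 'D_v g x 0 i * 'D_(e_ R j) f (g x)).
    apply: Ck_mul => //; first by apply: Ck_coord => //; exact: Ck_derive.
    by apply: (IH ('D_(e_ R j) f)) => //; exact: Ck_derive.
  exact: (Ck_add oU (H 0 0) (H 1 1)).
Qed.

Lemma Ck_comp_rV2 (V : normedModType R) k (U : set V) (W : set 'rV[R]_2)
    (f : 'rV[R]_2 -> 'rV[R]_2) (g : V -> 'rV[R]_2) : open U -> open W ->
  (forall x, U x -> W (g x)) -> Ck_on k W f -> Ck_on k U g -> Ck_on k U (f \o g).
Proof.
move=> oU oW UW kf kg; apply: Ck_rV2 => // j.
exact: (Ck_comp (f := fun y => f y 0 j) oU oW UW (Ck_coord 0 j oW kf) kg).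
Qed.

Lemma is_derive_slice (V W X : normedModType R) (F : (V * W)%type -> X) t (x v : W) l :
  is_derive (t, x) (0, v) F l -> is_derive x v (fun x => F (t, x)) l.
Proof.
have E : (fun h : R => h^-1 *: (((fun x => F (t, x)) \o shift x) (h *: v) - F (t, x))) =
    (fun h : R => h^-1 *: ((F \o shift (t, x)) (h *: ((0, v) : V * W)) - F (t, x))).
  apply/funext => h /=; congr (_ *: (F _ - _)).
  transitivity (h *: (0 : V) + t, h *: v + x); last by [].
  by rewrite scaler0 add0r.
by move=> [d1 d2]; split; [move: d1|move: d2]; rewrite /derivable /derive E.
Qed.

(** Smoothness of a flow is given jointly in time and chart coordinates; this is how the time is
    frozen. *)
Lemma Ck_slice (V W X : normedModType R) k (U : set (V * W)) (F : (V * W)%type -> X) t :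
  open U -> Ck_on k U F -> Ck_on k [set x | U (t, x)] (fun x => F (t, x)).
Proof.
move=> oU.
have ct : continuous (fun x : W => (t, x)) by move=> x; apply: cvg_pair => //; exact: cvg_cst.
have oV : open [set x | U (t, x)] by apply: open_comp => // x _; exact: ct.
elim: k F => [|k IH] F kF; have [cF dF] := kF;
  have cs x : U (t, x) -> {for x, continuous (fun x => F (t, x))}.
- by move=> Ux; apply: (@continuous_comp _ _ _ (fun x => (t, x)) F); [exact: ct|exact: cF].
- by split.
- by move=> Ux; apply: (@continuous_comp _ _ _ (fun x => (t, x)) F); [exact: ct|exact: cF].
apply: (@Ck_of_derive R W X k [set x | U (t, x)] (fun x => F (t, x))
  (fun v x => 'D_((0 : V), v) F (t, x)) oV cs).
- by move=> x v Ux; apply: is_derive_slice; apply: derivableP; exact: dF.1.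
- by move=> v; exact: (IH _ (dF.2 ((0 : V), v))).
Qed.

End Composition.

(** * The inverse function theorem in the plane *)

Section InverseFunction.
Variable R : realType.
Implicit Types (x y : 'rV[R]_2) (F : 'rV[R]_2 -> 'rV[R]_2).

Record diffeo (A B : set 'rV[R]_2) (f g : 'rV[R]_2 -> 'rV[R]_2) : Prop := Diffeo {
  diffeo_openl : open A;
  diffeo_openr : open B;
  diffeo_to : forall x, A x -> B (f x);
  diffeo_from : forall y, B y -> A (g y);
  diffeoK : forall x, A x -> g (f x) = x;
  diffeoVK : forall y, B y -> f (g y) = y;
  diffeo_smooth : smooth_on A f;
  diffeo_smoothV : smooth_on B g }.

Lemma is_derive_approx (V : normedModType R) (f : V -> R) (x v : V) (l : R) :
  (forall e : R, 0 < e -> \forall s \near (0 : R),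
     `|f (s *: v + x) - f x - s * l| <= e * `|s|) ->
  is_derive x v f l.
Proof.
move=> H.
have cl : (fun h : R => h^-1 *: ((f \o shift x) (h *: v) - f x)) @ 0^' --> l.
  apply/cvgrPdist_le => e e0; near=> s.
  have s0 : s != 0 by near: s; exact: nbhs_dnbhs_neq.
  have : `|f (s *: v + x) - f x - s * l| <= e * `|s|.
    by near: s; apply: nbhs_dnbhs; exact: H.
  move=> fl; rewrite /= distrC.
  have -> : s^-1 *: (f (s *: v + x) - f x) - l = s^-1 * (f (s *: v + x) - f x - s * l).
    by rewrite mulrBr mulKf.
  by rewrite normrM normfV ler_pdivrMl ?normr_gt0 // [_ * e]mulrC.
by split; [apply/cvg_ex; exists l|apply: cvg_lim].
Unshelve. all: by end_near. Qed.

(** When the differential at x0 is the identity, F - id has Lipschitz constant 1/2 nearby. This one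
    estimate yields the contraction used for surjectivity, the injectivity of F, and the Lipschitz
    constant 2 of the inverse. *)
Lemma strict_id (U : set 'rV[R]_2) F x0 : open U -> U x0 -> Ck_on 1 U F ->
  (forall i j : 'I_2, 'D_(e_ R i) (fun x => F x 0 j) x0 = (i == j)%:R) ->
  exists d, [/\ 0 < d, forall x, `|x - x0| < d -> U x &
    forall x y, `|x - x0| < d -> `|y - x0| < d ->
      `|F y - F x - (y - x)| <= 2^-1 * `|y - x|].
Proof.
move=> oU Ux0 F1 DF; have h0 : 0 < 2^-1 :> R by rewrite invr_gt0.
have [d0 [d00 dU H0]] := C1_strict oU Ux0 (Ck_coord 0 0 oU F1) h0.
have [d1 [d10 _ H1]] := C1_strict oU Ux0 (Ck_coord 0 1 oU F1) h0.
exists (Num.min d0 d1); split; first by rewrite lt_min d00.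
  by move=> x; rewrite lt_min => /andP[/dU].
move=> x y; rewrite !lt_min => /andP[x0d x1d] /andP[y0d y1d].
have := H0 x y x0d y0d; have := H1 x y x1d y1d; rewrite !DF !eqxx /= !mulr1 !mulr0.
rewrite addr0 add0r => h1 h2; rewrite norm_rV2_le.
by move: h1 h2; rewrite !mxE => -> ->.
Qed.

Lemma fixed_point_closed_ball (T : 'rV[R]_2 -> 'rV[R]_2) x0 (r : R) : 0 < r ->
  (forall x, `|x - x0| <= r -> `|T x - x0| <= r) ->
  (forall x y, `|x - x0| <= r -> `|y - x0| <= r -> `|T y - T x| <= 2^-1 * `|y - x|) ->
  exists2 x, `|x - x0| <= r & T x = x.
Proof.
move=> r0 Tr Tc; pose D : set 'rV[R]_2 := closed_ball x0 r.
have DE x : D x <-> `|x - x0| <= r.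
  by rewrite /D closed_ballE // /closed_ball_ /= distrC.
have TD : {homo T : x / D x >-> D x} by move=> x /DE /Tr ?; exact/DE.
(* Packs completeness and the norm of the plane into the single structure over which the contraction
   theorem is stated. *)
pose X : completeNormedModType R :=
  HB.pack 'rV[R]_2 (Complete.on 'rV[R]_2) (NormedModule.on 'rV[R]_2).
pose f : {fun (D : set X) >-> (D : set X)} := mkfun_fun TD.
have h0 : 0 <= 2^-1 :> R by rewrite invr_ge0.
have cf : is_contraction f.
  exists (NngNum h0); split=> /=; first by rewrite invf_lt1 // ltr1n.
  by move=> [x y] /= [Dx Dy]; apply: Tc; exact/DE.
have [||x Dx xE] := banach_fixed_point cf.
- exact: closed_ball_closed.
- by exists x0; apply/DE; rewrite subrr normr0 ltW.
by exists x; [exact/DE|rewrite [in RHS]xE].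
Qed.

(** Bookkeeping for [inverse_derive]: N bounds the increment of the inverse map and s * v that of
    its argument. The denominator is chosen to absorb |a| + |b|, the Lipschitz constant 2 and v; the
    added 1 keeps it positive. *)
Lemma lincomb_le (a b p q e v s N : R) : 0 < e -> 0 <= v -> N <= 2 * (s * v) ->
  0 <= s ->
  `|p| <= e / ((`|a| + `|b|) * 2 * v + 1) * N ->
  `|q| <= e / ((`|a| + `|b|) * 2 * v + 1) * N -> `|a * p + b * q| <= e * s.
Proof.
move=> e0 v0 Ns s0; set K := _ + 1.
have K0 : 0 < K by rewrite ltr_pwDr // !mulr_ge0 // addr_ge0.
move=> pe qe; apply: le_trans (ler_normD _ _) _; rewrite !normrM.
apply: (@le_trans _ _ ((`|a| + `|b|) * (e / K * (2 * (s * v))))).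
  rewrite mulrDl; apply: lerD; apply: ler_wpM2l => //.
    by apply: le_trans pe _; apply: ler_wpM2l => //; rewrite ltW // divr_gt0.
  by apply: le_trans qe _; apply: ler_wpM2l => //; rewrite ltW // divr_gt0.
have -> : (`|a| + `|b|) * (e / K * (2 * (s * v))) = (e * s) * ((K - 1) / K).
  by rewrite /K; ring.
apply: ler_piMr; first by rewrite mulr_ge0 // ltW.
by rewrite ler_pdivrMr // mul1r gerBl.
Qed.

Lemma lipschitz_continuous_at (V W : normedModType R) (B : set V) (G : V -> W)
    (C : R) (y : V) : 0 < C -> nbhs y B ->
  (forall z, B z -> `|G z - G y| <= C * `|z - y|) -> {for y, continuous G}.
Proof.
move=> C0 nB lipG; apply/cvgrPdist_lt => e e0.
near=> z; rewrite distrC; apply: le_lt_trans (lipG z _) _; first by near: z.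
rewrite mulrC -ltr_pdivlMr // distrC; near: z.
by apply: cvgr_dist_lt; rewrite ?divr_gt0 //; exact: cvg_id.
Unshelve. all: by end_near. Qed.

(** Here x0 and x1 stand for the increments of the coordinates of G, and p and q for the errors of
    the linearization of F at G y. The last hypothesis says that solving the linear system expresses
    the error of the candidate l through p and q with fixed coefficients. Since G is Lipschitz,
    these errors are small compared with s. *)
Lemma inverse_derive (U B : set 'rV[R]_2) F G y (v : 'rV[R]_2) (j : 'I_2) (a b l : R) :
  open U -> U (G y) -> Ck_on 1 U F -> nbhs y B -> (forall z, B z -> F (G z) = z) ->
  (forall z, B z -> `|G z - G y| <= 2 * `|z - y|) ->
  (forall (p q s x0 x1 : R),
     s * v 0 0 = x0 * 'D_(e_ R 0) (fun x => F x 0 0) (G y) +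
                 x1 * 'D_(e_ R 1) (fun x => F x 0 0) (G y) + p ->
     s * v 0 1 = x0 * 'D_(e_ R 0) (fun x => F x 0 1) (G y) +
                 x1 * 'D_(e_ R 1) (fun x => F x 0 1) (G y) + q ->
     (if j == 0 then x0 else x1) - s * l = a * p + b * q) ->
  is_derive y v (fun y => G y 0 j) l.
Proof.
move=> oU Uy F1 nB FG lipG alg; apply: is_derive_approx => e e0.
set K := (`|a| + `|b|) * 2 * `|v| + 1.
have K0 : 0 < K by rewrite ltr_pwDr // !mulr_ge0 // addr_ge0.
have eK : 0 < e / K by rewrite divr_gt0.
have [d0 [d00 _ H0]] := C1_strict oU Uy (Ck_coord 0 0 oU F1) eK.
have [d1 [d10 _ H1]] := C1_strict oU Uy (Ck_coord 0 1 oU F1) eK.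
have [r r0 rB] := nbhs_ballR nB.
pose t := Num.min r (Num.min d0 d1) / (2 * `|v| + 1).
have V0 : 0 < 2 * `|v| + 1 by rewrite ltr_pwDr // mulr_ge0.
have t0 : 0 < t by rewrite divr_gt0 // !lt_min r0 d00.
apply/nbhs_normP; exists t => //= s /=; rewrite sub0r normrN ltr_pdivlMr //.
rewrite !lt_min => /and3P[sr sd0 sd1].
have sv : `|s *: v + y - y| = `|s| * `|v| by rewrite addrK normrZ.
have sv2 : 2 * (`|s| * `|v|) <= `|s| * (2 * `|v| + 1).
  by rewrite mulrDr mulrCA lerDl mulr1.
have sv0 : 0 <= `|s| * `|v| by rewrite mulr_ge0.
have Bs : B (s *: v + y).
  by apply: rB; rewrite sv; apply: le_lt_trans sr; apply: le_trans sv2; lra.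
have Gs := lipG _ Bs; rewrite sv in Gs.
have nd (d : R) : 0 < d -> `|s| * (2 * `|v| + 1) < d -> `|G (s *: v + y) - G y| < d.
  by move=> _ sd; apply: le_lt_trans sd; exact: le_trans sv2.
have := H0 (G y) (G (s *: v + y)); rewrite subrr normr0 => /(_ d00 (nd _ d00 sd0)) h0.
have := H1 (G y) (G (s *: v + y)); rewrite subrr normr0 => /(_ d10 (nd _ d10 sd1)) h1.
move: h0 h1; rewrite (FG _ Bs) (FG _ (nbhs_singleton nB)).
set p := (s *: v + y) 0 0 - y 0 0 - _; set q := (s *: v + y) 0 1 - y 0 1 - _ => h0 h1.
have E := alg p q s ((G (s *: v + y) - G y) 0 0) ((G (s *: v + y) - G y) 0 1).
have -> : G (s *: v + y) 0 j - G y 0 j - s * l = a * p + b * q.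
  rewrite -E; last 2 first.
  - by rewrite /p addrC subrK !mxE addrK.
  - by rewrite /q addrC subrK !mxE addrK.
  case: eqP => [->|]; rewrite !mxE //; move: j {E alg} => [[|[|//]] ltj] jn0.
    by case: jn0; exact: val_inj.
  by rewrite (_ : Ordinal ltj = 1) //; exact: val_inj.
exact: (lincomb_le e0 (normr_ge0 v) Gs (normr_ge0 s) h0 h1).
Qed.

(** U is shrunk to U', inside N, where the Jacobian J does not vanish. Smoothness of the inverse is
    a bootstrap: its derivatives are rational expressions in the derivatives of F taken at G, so
    that G is C^(k+1) as soon as it is C^k. *)
Lemma inverse_function_id (U N : set 'rV[R]_2) F x0 : open U -> U x0 -> smooth_on U F ->
  (forall i j : 'I_2, 'D_(e_ R i) (fun x => F x 0 j) x0 = (i == j)%:R) ->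
  nbhs x0 N -> exists A B G, [/\ diffeo A B F G, A x0, A `<=` U & A `<=` N].
Proof.
move=> oU Ux0 sF DF nN.
pose D (i j : 'I_2) x : R := 'D_(e_ R i) (fun x => F x 0 j) x.
have kD k i j : Ck_on k U (D i j) by apply: Ck_derive; apply: Ck_coord.
pose J x := D 0 0 x * D 1 1 x + - (D 0 1 x * D 1 0 x).
have kJ k : Ck_on k U J.
  by apply: Ck_add => //; [|apply: Ck_opp => //]; apply: Ck_mul.
have J0 : J x0 != 0 by rewrite /J /D !DF /= mulr1 mulr0 oppr0 addr0 oner_neq0.
have nJ : nbhs x0 [set x | J x != 0].
  have cJ : {for x0, continuous J} := Ck_continuous (kJ 0%N) Ux0.
  by apply: (cJ [set y | y != 0]); apply: open_nbhs_nbhs; split=> //; exact: open_neq.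
pose U' := (N `&` (U `&` [set x | J x != 0]))^°.
have oU' : open U' by exact: open_interior.
have U'x0 : U' x0.
  by apply: filterI => //; apply: filterI => //; exact: open_nbhs_nbhs.
have U'U : U' `<=` U by move=> x /interior_subset[_ []].
have U'N : U' `<=` N by move=> x /interior_subset[].
have U'J x : U' x -> J x != 0 by move=> /interior_subset[_ []].
have [d [d0 dU' Fd]] := strict_id oU' U'x0 (Ck_subset U'U (sF 1%N)) DF.
have lip x y : `|x - x0| < d -> `|y - x0| < d -> `|y - x| <= 2 * `|F y - F x|.
  move=> xd yd; have := Fd x y xd yd; have := ler_normB (F y - F x) (F y - F x - (y - x)).
  rewrite subKr; lra.
have F_inj x y : `|x - x0| < d -> `|y - x0| < d -> F x = F y -> x = y.
  move=> xd yd Fxy; have := lip x y xd yd; rewrite Fxy subrr normr0 mulr0 normr_le0.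
  by rewrite subr_eq0 => /eqP.
have onto y : `|y - F x0| < d / 4 -> exists x, `|x - x0| < d /\ F x = y.
  move=> yd; have d20 : 0 < d / 2 by rewrite divr_gt0.
  have half_lt x : `|x - x0| <= d / 2 -> `|x - x0| < d by move=> ?; lra.
  (* A fixed point of x + (y - F x) solves F x = y. The closed ball of radius d / 2 is preserved
     because |y - F x0| < d / 4 and half of |x - x0| is at most d / 4. *)
  have [||x xd Tx] := @fixed_point_closed_ball (fun x => x + (y - F x)) x0 (d / 2) d20.
  - move=> x xd; have := Fd x0 x _ (half_lt _ xd); rewrite subrr normr0 => /(_ d0).
    have -> : x + (y - F x) - x0 = (y - F x0) - (F x - F x0 - (x - x0)).
      by apply/rowP => i; rewrite !mxE; ring.
    have := ler_normB (y - F x0) (F x - F x0 - (x - x0)); lra.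
  - move=> x z xd zd; have := Fd x z (half_lt _ xd) (half_lt _ zd).
    have -> : z + (y - F z) - (x + (y - F x)) = - (F z - F x - (z - x)).
      by apply/rowP => i; rewrite !mxE; ring.
    by rewrite normrN.
  exists x; split; first exact: half_lt.
  apply/esym/eqP; rewrite -subr_eq0; apply/eqP.
  by apply: (@addrI _ x); rewrite addr0.
pose B := [set y | `|y - F x0| < d / 4].
have oB : open B.
  rewrite (_ : B = ball (F x0) (d / 4)); first exact: ball_open.
  by apply/seteqP; split=> y; rewrite -ball_normE /= distrC.
have oball : open [set x | `|x - x0| < d].
  rewrite (_ : mkset _ = ball x0 d); first exact: ball_open.
  by apply/seteqP; split=> y; rewrite -ball_normE /= distrC.
pose A := [set x | `|x - x0| < d] `&` F @^-1` B.
have oA : open A.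
  rewrite openE => x [xd Fx]; apply: filterI; first exact: open_nbhs_nbhs.
  have cF : {for x, continuous F} := Ck_continuous (sF 0%N) (U'U _ (dU' _ xd)).
  by apply: cF; exact: open_nbhs_nbhs.
pose G y := xget x0 [set x | `|x - x0| < d /\ F x = y].
have GP y : B y -> `|G y - x0| < d /\ F (G y) = y.
  by move=> /onto[x xP]; rewrite /G; case: xgetP => [z _ //|/(_ x)].
have AU x : A x -> U' x by move=> [/dU'].
have BA y : B y -> A (G y) by move=> By; have [Gd FG] := GP y By; split=> //=; rewrite /= FG.
have lipG y z : B y -> B z -> `|G z - G y| <= 2 * `|z - y|.
  move=> By Bz; have [Gy Fy] := GP y By; have [Gz Fz] := GP z Bz.
  by have := lip _ _ Gy Gz; rewrite Fy Fz.
have cG y : B y -> {for y, continuous G}.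
  move=> By; apply: (@lipschitz_continuous_at _ _ B G 2 y) => //.
    exact: open_nbhs_nbhs.
  by move=> z; exact: lipG.
have cGk k : Ck_on k B G.
  elim: k => [|k IH]; first by split=> // y; exact: cG.
  have kDG i j : Ck_on k B (fun y => D i j (G y)).
    by apply: (Ck_comp (f := D i j) oB oU) => // y By; exact: (U'U _ (AU _ (BA _ By))).
  have kJG : Ck_on k B (fun y => (J (G y))^-1).
    apply: Ck_inv => //; first by move=> y By; exact: (U'J _ (AU _ (BA _ By))).
    by apply: (Ck_comp (f := J) oB oU) => // y By; exact: (U'U _ (AU _ (BA _ By))).
  have kc (c : R) : Ck_on k B (fun _ => c) by exact: Ck_cst.
  have nB y : B y -> nbhs y B by move=> By; exact: open_nbhs_nbhs.
  have UG y : B y -> U (G y) by move=> By; exact: (U'U _ (AU _ (BA _ By))).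
  have FG z : B z -> F (G z) = z by move=> /GP[].
  (* [dG0] and [dG1] are Cramer's rule for the inverse of the differential of F at G y; [D i j] is
     the i-th partial derivative of the j-th coordinate. The coefficients a and b given to
     [inverse_derive] below come from the same rule applied to the errors. *)
  pose dG0 (v : 'rV[R]_2) y := (D 1 1 (G y) * v 0 0 + - (D 1 0 (G y) * v 0 1)) * (J (G y))^-1.
  pose dG1 (v : 'rV[R]_2) y := (D 0 0 (G y) * v 0 1 + - (D 0 1 (G y) * v 0 0)) * (J (G y))^-1.
  apply: Ck_rV2 => // -[[|[|//]] ltj].
  - rewrite (_ : Ordinal ltj = 0); last exact: val_inj.
    apply: (@Ck_of_derive _ _ _ _ _ _ dG0) => //.
    + by move=> y By; apply: (Ck_continuous (k := 0) (U := B)) => //;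
         apply: Ck_coord => //; split=> // z; exact: cG.
    + move=> y v By; apply: (inverse_derive (a := - D 1 1 (G y) / J (G y))
        (b := D 1 0 (G y) / J (G y)) oU (UG y By) (sF 1%N) (nB y By) FG).
        by move=> z Bz; exact: lipG.
      have := U'J _ (AU _ (BA _ By)).
      move=> J0' p q s X0 X1; rewrite -!/(D _ _ (G y)) => e0 e1 /=.
      rewrite /dG0 mulrA mulrDr mulrN !(mulrCA s) e0 e1.
      by move: J0'; rewrite /J; set A0 := D 0 0 _; set A1 := D 0 1 _;
        set A2 := D 1 0 _; set A3 := D 1 1 _ => J0'; field.
    + move=> v; apply: Ck_mul => //; apply: Ck_add => //; [exact: Ck_mul|].
      by apply: Ck_opp => //; exact: Ck_mul.
  - rewrite (_ : Ordinal ltj = 1); last exact: val_inj.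
    apply: (@Ck_of_derive _ _ _ _ _ _ dG1) => //.
    + by move=> y By; apply: (Ck_continuous (k := 0) (U := B)) => //;
         apply: Ck_coord => //; split=> // z; exact: cG.
    + move=> y v By; apply: (inverse_derive (a := D 0 1 (G y) / J (G y))
        (b := - D 0 0 (G y) / J (G y)) oU (UG y By) (sF 1%N) (nB y By) FG).
        by move=> z Bz; exact: lipG.
      have := U'J _ (AU _ (BA _ By)).
      move=> J0' p q s X0 X1; rewrite -!/(D _ _ (G y)) => e0 e1 /=.
      rewrite /dG1 mulrA mulrDr mulrN !(mulrCA s) e0 e1.
      by move: J0'; rewrite /J; set A0 := D 0 0 _; set A1 := D 0 1 _;
        set A2 := D 1 0 _; set A3 := D 1 1 _ => J0'; field.
    + move=> v; apply: Ck_mul => //; apply: Ck_add => //; [exact: Ck_mul|].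
      by apply: Ck_opp => //; exact: Ck_mul.
exists A, B, G; split => //.
- split=> //.
  + by move=> x [].
  + move=> x Ax; have [Gd FG] := GP (F x) Ax.2; apply: F_inj => //; exact: Ax.1.
  + by move=> y /GP[].
  + move=> k; apply: Ck_subset (sF k) => x /AU; exact: U'U.
- split; first by rewrite /= subrr normr0.
  by rewrite /= /B /= subrr normr0 divr_gt0.
- by move=> x /AU /U'U.
- by move=> x /AU /U'N.
Qed.
End InverseFunction.

(** * Diffeomorphisms of the plane and the general inverse function theorem *)

Section Diffeo.
Variable R : realType.

Lemma Ck_id (V : normedModType R) k (U : set V) : open U -> Ck_on k U (@id V).
Proof.
move=> oU; case: k => [|k]; first by split=> // x _; exact: cvg_id.
apply: (@Ck_of_derive R V V k U id (fun v _ => v) oU _ _ (fun v => Ck_cst k v oU)).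
by move=> x _; exact: cvg_id.
Qed.

Lemma I2_ind (P : 'I_2 -> Prop) : P 0 -> P 1 -> forall j, P j.
Proof.
move=> P0 P1 [[|[|//]] ltj].
- by rewrite (_ : Ordinal ltj = 0) //; exact: val_inj.
- by rewrite (_ : Ordinal ltj = 1) //; exact: val_inj.
Qed.

Lemma Ck_vec2 (V : normedModType R) k (U : set V) (f g : V -> R) : open U ->
  Ck_on k U f -> Ck_on k U g -> Ck_on k U (fun x => vec2 (f x) (g x)).
Proof.
move=> oU kf kg; apply: Ck_rV2 => //; elim/I2_ind.
- by apply: eq_Ck_on kf => // x _; rewrite vec2E.
- by apply: eq_Ck_on kg => // x _; rewrite vec2E.
Qed.

Lemma is_derive_vec2 (V : normedModType R) (f g : V -> R) (x v : V) (a b : R) :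
  is_derive x v f a -> is_derive x v g b ->
  is_derive x v (fun x => vec2 (f x) (g x)) (vec2 a b).
Proof.
move=> df dg; apply: is_derive_rV2; elim/I2_ind; rewrite vec2E.
- by rewrite (_ : (fun x => _) = f) //; apply/funext => y; rewrite vec2E.
- by rewrite (_ : (fun x => _) = g) //; apply/funext => y; rewrite vec2E.
Qed.

Lemma diffeo_sym A B f g : @diffeo R A B f g -> diffeo B A g f.
Proof. by case=> *; split. Qed.

Lemma diffeo_comp A B f g B' C f' g' : @diffeo R A B f g -> diffeo B' C f' g' ->
  diffeo (A `&` f @^-1` B') (C `&` g' @^-1` B) (f' \o f) (g \o g').
Proof.
move=> [oA oB fA gB fK gK sf sg] [oB' oC fA' gB' fK' gK' sf' sg'].
have open_pre (W W' : set 'rV[R]_2) (h : 'rV[R]_2 -> 'rV[R]_2) : open W -> open W' ->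
    smooth_on W h -> open (W `&` h @^-1` W').
  move=> oW oW' sh; rewrite openE => x [Wx Wh]; apply: filterI; first exact: open_nbhs_nbhs.
  have ch : {for x, continuous h} := Ck_continuous (sh 0%N) Wx.
  by apply: ch; exact: open_nbhs_nbhs.
split.
- exact: open_pre.
- exact: open_pre.
- by move=> x [Ax Bx] /=; split=> /=; [exact: fA'|rewrite fK' //; exact: fA].
- by move=> y [Cy By] /=; split=> /=; [exact: gB|rewrite gK //; exact: gB'].
- by move=> x [Ax Bx] /=; rewrite fK' // fK.
- by move=> y [Cy By] /=; rewrite gK // gK'.
- move=> k; apply: (Ck_comp_rV2 (W := B')) => //; first exact: open_pre.
    by move=> x [].
  by apply: Ck_subset (sf k) => x [].
- move=> k; apply: (Ck_comp_rV2 (W := B)) => //; first exact: open_pre.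
    by move=> x [].
  by apply: Ck_subset (sg' k) => x [].
Qed.

Lemma diffeo_restrict A B f g A' : @diffeo R A B f g -> open A' ->
  diffeo (A `&` A') (B `&` g @^-1` A') f g.
Proof.
move=> [oA oB fA gB fK gK sf sg] oA'.
have oB' : open (B `&` g @^-1` A').
  rewrite openE => x [Wx Wh]; apply: filterI; first exact: open_nbhs_nbhs.
  have ch : {for x, continuous g} := Ck_continuous (sg 0%N) Wx.
  by apply: ch; exact: open_nbhs_nbhs.
split => //; first exact: openI.
- by move=> x [Ax A'x]; split; [exact: fA|rewrite /= fK].
- by move=> y [By A'y]; split=> //; exact: gB.
- by move=> x [Ax _]; exact: fK.
- by move=> y [By _]; exact: gK.
- by move=> k; apply: Ck_subset (sf k) => x [].
- by move=> k; apply: Ck_subset (sg k) => x [].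
Qed.

Definition linmap2 (a b c d : R) (x : 'rV[R]_2) := vec2 (a * x 0 0 + b * x 0 1) (c * x 0 0 + d * x 0 1).

Lemma Ck_linmap2 k U a b c d : open U -> Ck_on k U (linmap2 a b c d).
Proof.
move=> oU; have kx j : Ck_on k U (fun x : 'rV[R]_2 => x 0 j) by exact: (Ck_coord 0 j oU (Ck_id k oU)).
by apply: Ck_vec2 => //; apply: Ck_add => //; apply: Ck_mul => //; exact: Ck_cst.
Qed.

Lemma diffeo_linmap2 a b c d : a * d - b * c != 0 ->
  diffeo setT setT (linmap2 a b c d)
    (linmap2 (d / (a * d - b * c)) (- b / (a * d - b * c))
             (- c / (a * d - b * c)) (a / (a * d - b * c))).
Proof.
move=> J0; split => //; try exact: openT.
- by move=> x _; apply: rV2P; rewrite !vec2E; field.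
- by move=> x _; apply: rV2P; rewrite !vec2E; field.
- by move=> k; apply: Ck_linmap2; exact: openT.
- by move=> k; apply: Ck_linmap2; exact: openT.
Qed.

Lemma is_derive_linmap2 (V : normedModType R) a b c d (f : V -> 'rV[R]_2) (x v : V) l :
  is_derive x v f l ->
  is_derive x v (fun x => linmap2 a b c d (f x)) (linmap2 a b c d l).
Proof.
move=> df; have d0 := is_derive_coord 0 0 df; have d1 := is_derive_coord 0 1 df.
have h (p q : R) : is_derive x v (fun x => p * f x 0 0 + q * f x 0 1) (p * l 0 0 + q * l 0 1).
  have e (r : R) j : is_derive x v (fun x => f x 0 j) (l 0 j) ->
    is_derive x v (fun x => r * f x 0 j) (r * l 0 j).
    by move=> dj; exact: (is_deriveZ r).
  by apply: is_deriveD; exact: e.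
exact: is_derive_vec2.
Qed.

(** If the determinant vanished, (d, -c) would lie in the kernel, hence c = d = 0; then so would (b,
    -a), hence a = b = 0; and then (1, 0) would. *)
Lemma det2_neq0 (a b c d : R) :
  (forall v0 v1, a * v0 + b * v1 = 0 -> c * v0 + d * v1 = 0 -> v0 = 0 /\ v1 = 0) ->
  a * d - b * c != 0.
Proof.
move=> h; apply/eqP => J0.
have [||d0 /eqP] := h d (- c); [by rewrite -J0; ring|by ring|].
rewrite oppr_eq0 => /eqP c0.
have [||b0 /eqP] := h b (- a); [by ring|by rewrite c0 d0; ring|].
rewrite oppr_eq0 => /eqP a0.
have [||/eqP] := h 1 0; rewrite ?a0 ?b0 ?c0 ?d0 ?oner_eq0 //; ring.
Qed.

(** Composing with the inverse of the differential at x0 reduces to the case where that differential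
    is the identity. The neighbourhood N lets a caller prescribe how small the domain is. *)
Theorem inverse_function (U N : set 'rV[R]_2) f x0 : open U -> U x0 -> smooth_on U f ->
  (forall v, 'D_v f x0 = 0 -> v = 0) -> nbhs x0 N ->
  exists A B g, [/\ diffeo A B f g, A x0, A `<=` U & A `<=` N].
Proof.
move=> oU Ux0 sf inj nN.
have C1f j := C1_diff oU Ux0 (Ck_coord 0 j oU (sf 1%N)).
pose D (i j : 'I_2) : R := 'D_(e_ R i) (fun x => f x 0 j) x0.
have df v : is_derive x0 v f ('D_v f x0) by apply: derivableP; exact: (Ck_derivable (sf 1%N)).
have Df v j : 'D_v f x0 0 j = lin2 (D 0 j) (D 1 j) v.
  have [_ <-] := C1f j; have [_ <- //] := is_derive_coord 0 j (df v).
have J0 : D 0 0 * D 1 1 - D 1 0 * D 0 1 != 0.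
  apply: det2_neq0 => v0 v1 h0 h1.
  have v0E : vec2 v0 v1 = 0.
    apply: inj; apply: rV2P; rewrite Df /lin2 !vec2E mxE.
      by rewrite -[RHS]h0 mulrC (mulrC v1).
    by rewrite -[RHS]h1 mulrC (mulrC v1).
  by split; [have := vec20 v0 v1|have := vec21 v0 v1]; rewrite v0E mxE.
have dL := diffeo_linmap2 J0; set L := linmap2 _ _ _ _ in dL; set L' := linmap2 _ _ _ _ in dL.
have sL'f : smooth_on U (L' \o f).
  move=> k; apply: (Ck_comp_rV2 (W := setT) oU openT) => //.
  by apply: Ck_linmap2; exact: openT.
have [|A [B [G [dF Ax0 AU AN]]]] := inverse_function_id oU Ux0 sL'f _ nN.
  move=> i j; have := is_derive_coord 0 j (is_derive_linmap2 (D 1 1 / (D 0 0 * D 1 1 - D 1 0 * D 0 1))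
   (- D 1 0 / (D 0 0 * D 1 1 - D 1 0 * D 0 1)) (- D 0 1 / (D 0 0 * D 1 1 - D 1 0 * D 0 1))
   (D 0 0 / (D 0 0 * D 1 1 - D 1 0 * D 0 1)) (df (e_ R i))).
  move=> [_ ->]; rewrite /linmap2 !Df /lin2 /e_ !mxE {dL L L' sL'f}.
  move: i j J0; move: (D 0 0) (D 0 1) (D 1 0) (D 1 1) => a b c d.
  by elim/I2_ind; elim/I2_ind => J0 /=; field.
have := diffeo_comp dF dL; rewrite preimage_setT setIT setTI.
rewrite (_ : L \o (L' \o f) = f); last first.
  by apply/funext => x /=; rewrite (diffeoVK dL).
by move=> dff; exists A, (L' @^-1` B), (G \o L').
Qed.

End Diffeo.

(** * Calculus on the surface *)

Lemma continuous_pair_at (T U V : topologicalType) (f : T -> U) (g : T -> V) (x : T) :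
  {for x, continuous f} -> {for x, continuous g} ->
  {for x, continuous (fun x => (f x, g x))}.
Proof.
exact: (cvg_pair (F := nbhs x) (G := nbhs (f x)) (H := nbhs (g x))).
Qed.

Section Manifold.
Variables (R : realType) (M : manifold2 R).
Implicit Types (c d : chart R M) (p : M).

Lemma cim_cmap c p : cdom c p -> cim c (cmap c p).
Proof. by exists p. Qed.

Lemma cinv_dom c u : cim c u -> cdom c (cinv c u).
Proof. by move=> [p pc <-]; rewrite cmapK. Qed.

Lemma cinvK c u : cim c u -> cmap c (cinv c u) = u.
Proof. by move=> [p pc <-]; rewrite cmapK. Qed.

Lemma open_cim c : open (cim c).
Proof. exact: cim_open. Qed.

Lemma nbhs_cim c p : cdom c p -> nbhs (cmap c p) (cim c).
Proof. by move=> pc; apply: open_nbhs_nbhs; split; [exact: open_cim|exact: cim_cmap]. Qed.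

Lemma open_pullback c (U : set M) : open U -> open (cim c `&` cinv c @^-1` U).
Proof.
move=> oU; rewrite openE => u [cu Uu]; apply: filterI.
  by apply: open_nbhs_nbhs; split=> //; exact: open_cim.
by apply: (cinv_continuous cu); exact: open_nbhs_nbhs.
Qed.

Lemma open_pushforward c (W : set 'rV[R]_2) : open W -> open (cdom c `&` cmap c @^-1` W).
Proof.
move=> oW; rewrite openE => p [cp Wp]; apply: filterI.
  by apply: open_nbhs_nbhs; split=> //; exact: cdom_open.
by apply: (cmap_continuous cp); exact: open_nbhs_nbhs.
Qed.

Lemma overlapE c d : cmap c @` (cdom c `&` cdom d) = cim c `&` cinv c @^-1` cdom d.
Proof.
apply/seteqP; split=> [_ [p [pc pd] <-]|u [cu du]].
  by split; [exact: cim_cmap|rewrite /= cmapK].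
by exists (cinv c u); [split=> //; exact: cinv_dom|exact: cinvK].
Qed.

Lemma open_overlap c d : open (cmap c @` (cdom c `&` cdom d)).
Proof. by rewrite overlapE; apply: open_pullback; exact: cdom_open. Qed.

Definition pd (f : M -> R) c p (v : 'rV[R]_2) : R := 'D_v (f \o cinv c) (cmap c p).

Lemma is_pd (f : M -> R) c p v : smooth_map f -> atlas c -> cdom c p ->
  is_derive (cmap c p) v (f \o cinv c) (pd f c p v).
Proof.
by move=> sf ac cp; apply: derivableP; apply: (Ck_derivable (sf c ac 1%N)); exact: cim_cmap.
Qed.

Lemma is_derive_comp_chart (V : normedModType R) (f : M -> R) (g : V -> M) (s v : V) d w :
  smooth_map f -> atlas d -> cdom d (g s) -> {for s, continuous g} ->
  is_derive s v (cmap d \o g) w -> is_derive s v (f \o g) (pd f d (g s) w).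
Proof.
move=> sf ad dg cg dw.
have f1 := sf d ad 1%N.
have H := is_derive_comp2 (f := f \o cinv d) (g := cmap d \o g) (@open_cim d)
  (cim_cmap dg) f1 dw.
have [_ E] := C1_diff (@open_cim d) (cim_cmap dg) f1.
rewrite /pd E; apply: near_eq_is_derive H.
have nd : \forall y \near s, cdom d (g y).
  by apply: cg; apply: open_nbhs_nbhs; split=> //; exact: cdom_open.
by apply: filterS nd => y dy /=; rewrite cmapK.
Qed.

(** The vector w is the image of v under the differential of the transition map; the reverse
    transition shows that v = 0 if w = 0. This links [chart_at], through which immersions and
    normals are defined, to arbitrary charts of the atlas. *)
Lemma chart_change c d p (v : 'rV[R]_2) : atlas c -> atlas d -> cdom c p -> cdom d p ->
  exists w, (forall f, smooth_map f -> pd f c p v = pd f d p w) /\ (w = 0 -> v = 0).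
Proof.
move=> ac ad cp dp; have ccp := cim_cmap cp.
have op : (cmap c @` (cdom c `&` cdom d)) (cmap c p) by exists p.
have dT : is_derive (cmap c p) v (cmap d \o cinv c) ('D_v (cmap d \o cinv c) (cmap c p)).
  by apply: derivableP; apply: (Ck_derivable (atlas_smooth ac ad 1%N)).
exists ('D_v (cmap d \o cinv c) (cmap c p)); split.
  move=> f sf; have H := is_derive_comp_chart (g := cinv c) sf ad _ _ dT.
  rewrite /pd; have [||_ ->] := H.
  - by rewrite cmapK.
  - exact: cinv_continuous.
  - by rewrite cmapK.
move=> w0; rewrite w0 in dT; have od : (cmap d @` (cdom d `&` cdom c)) (cmap d (cinv c (cmap c p))).
  by rewrite cmapK //; exists p.
apply/rowP => j; rewrite mxE.
have := is_derive_comp2 (f := fun u => (cmap c \o cinv d) u 0 j) (@open_overlap d c) od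
  (Ck_coord 0 j (@open_overlap d c) (atlas_smooth ad ac 1%N)) dT.
rewrite /lin2 !mxE !mul0r addr0 => H.
have H2 : is_derive (cmap c p) v (fun u : 'rV[R]_2 => u 0 j) (v 0 j).
  exact: (is_derive_coord 0 j (is_derive_id _ _)).
have [_ <-] := H2; have [_ <-] := H; apply: near_eq_derive.
have : nbhs (cmap c p) (cmap c @` (cdom c `&` cdom d)).
  by apply: open_nbhs_nbhs; split=> //; exact: open_overlap.
by apply: filterS => _ [q [cq dq] <-] /=; rewrite !cmapK.
Qed.

Variable phi : R -> M -> M.
Hypothesis phiP : one_parameter_group phi.

Lemma flow_continuous t : continuous (phi t).
Proof.
case: phiP => _ _ cphi _ p.
apply: (@continuous_comp _ _ _ (fun p => (t, p)) (fun tp : R * M => phi tp.1 tp.2)).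
  by apply: continuous_pair_at; [exact: cvg_cst|exact: cvg_id].
exact: cphi.
Qed.

Lemma flow_time_continuous p : continuous (phi ^~ p).
Proof.
case: phiP => _ _ cphi _ t.
apply: (@continuous_comp _ _ _ (fun t : R => (t, p)) (fun tp : R * M => phi tp.1 tp.2)).
  by apply: continuous_pair_at; [exact: cvg_id|exact: cvg_cst].
exact: cphi.
Qed.

Lemma open_flow_dom c d :
  open [set tu : (R^o * 'rV[R]_2)%type | cim c tu.2 /\ cdom d (phi tu.1 (cinv c tu.2))].
Proof.
case: phiP => _ _ cphi _; rewrite openE => -[t u] [/= cu du].
have n2 : nbhs (t : R^o, u) (fun tu => cim c tu.2).
  by apply: (@cvg_snd R^o 'rV[R]_2 (nbhs t) (nbhs u)); apply: open_nbhs_nbhs; split=> //; exact: open_cim.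
have ct : {for (t : R^o, u), continuous (fun tu : R^o * 'rV[R]_2 => phi tu.1 (cinv c tu.2))}.
  apply: (@continuous_comp _ _ _ (fun tu : R^o * 'rV[R]_2 => ((tu.1 : R), cinv c tu.2))
     (fun tp : R * M => phi tp.1 tp.2)); last exact: cphi.
  apply: continuous_pair_at; first exact: cvg_fst.
  apply: (@continuous_comp _ _ _ snd (cinv c)); first exact: cvg_snd.
  exact: cinv_continuous.
apply: filterI => //.
by apply: (ct (cdom d)); apply: open_nbhs_nbhs; split=> //; exact: cdom_open.
Qed.

Lemma flow_smooth t c d : atlas c -> atlas d ->
  smooth_on [set u | cim c u /\ cdom d (phi t (cinv c u))] (cmap d \o phi t \o cinv c).
Proof.
case: phiP => _ _ _ sphi ac ad k.
have := Ck_slice (V := R^o) _ (@open_flow_dom c d) (sphi c d ac ad k); exact.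
Qed.

(** The point is the order of the quantifiers: one vector w, the image of v under the differential
    of the flow at time t, serves all functions f at once, so the tangency relation can be applied
    to it. *)
Lemma flow_pd t c p v : atlas c -> cdom c p ->
  exists d w, [/\ atlas d, cdom d (phi t p) & forall f, smooth_map f ->
    is_derive (cmap c p) v (f \o phi t \o cinv c) (pd f d (phi t p) w)].
Proof.
move=> ac cp; have [d ad dp] := atlas_cover (phi t p).
exists d, ('D_v (cmap d \o phi t \o cinv c) (cmap c p)); split=> // f sf.
have := is_derive_comp_chart (g := phi t \o cinv c) (d := d) (s := cmap c p) (v := v) sf ad.
rewrite /= cmapK //; apply=> //.
  apply: continuous_comp; first by apply: cinv_continuous; exact: cim_cmap.
  exact: flow_continuous.
apply: derivableP; apply: (Ck_derivable (flow_smooth t ac ad 1%N)).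
by split; [exact: cim_cmap|rewrite cmapK].
Qed.

(** Same device in the time direction: w is the velocity of the orbit of p, common to all f. *)
Lemma flow_time_derive t p :
  exists d w, [/\ atlas d, cdom d (phi t p) & forall f, smooth_map f ->
    is_derive t 1 (fun s => f (phi s p)) (pd f d (phi t p) w)].
Proof.
have [c ac cp] := atlas_cover p; have [d ad dp] := atlas_cover (phi t p).
case: phiP => _ _ _ /(_ c d ac ad 1%N) sphi.
pose w := 'D_((1 : R^o), (0 : 'rV[R]_2)) (fun tu : R^o * 'rV[R]_2 =>
   cmap d (phi tu.1 (cinv c tu.2))) ((t : R^o), cmap c p).
exists d, w; split=> // f sf.
apply: (is_derive_comp_chart (g := phi ^~ p)) => //; first exact: flow_time_continuous.
have : derivable (fun tu : R^o * 'rV[R]_2 => cmap d (phi tu.1 (cinv c tu.2)))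
   ((t : R^o), cmap c p) ((1 : R^o), (0 : 'rV[R]_2)).
  by apply: (Ck_derivable sphi); split; [exact: cim_cmap|rewrite /= cmapK].
have E : (fun h : R => h^-1 *: (((fun tu : R^o * 'rV[R]_2 => cmap d (phi tu.1 (cinv c tu.2)))
     \o shift ((t : R^o), cmap c p)) (h *: ((1 : R^o), (0 : 'rV[R]_2)))
      - cmap d (phi t (cinv c (cmap c p))))) =
   (fun h : R => h^-1 *: (((cmap d \o phi^~ p) \o shift t) (h *: 1) - (cmap d \o phi^~ p) t)).
  apply/funext => h /=; rewrite cmapK //; congr (_ *: (cmap d _ - _)).
  transitivity (phi (h *: (1 : R^o) + t) (cinv c (h *: (0 : 'rV[R]_2) + cmap c p))) => //.
  by rewrite scaler0 add0r cmapK.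
move=> dd; split; first by move: dd; rewrite /derivable E.
by rewrite /w /derive E.
Qed.

End Manifold.

(** * Orthonormal frames *)

Section Frame.
Variable R : realType.
Implicit Types (u v w a y : 'rV[R]_3).

Lemma I3_ind (P : 'I_3 -> Prop) : P 0 -> P 1 -> P 2%:R -> forall j, P j.
Proof.
move=> P0 P1 P2 [[|[|[|//]]] ltj].
- by rewrite (_ : Ordinal ltj = 0) //; exact: val_inj.
- by rewrite (_ : Ordinal ltj = 1) //; exact: val_inj.
- by rewrite (_ : Ordinal ltj = 2%:R) //; exact: val_inj.
Qed.

Lemma sum_I3 (F : 'I_3 -> R) : \sum_i F i = F 0 + F 1 + F 2%:R.
Proof.
rewrite !big_ord_recl big_ord0 addr0 addrA; congr (F _ + F _ + F _); exact: val_inj.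
Qed.

Lemma sum_I2 (F : 'I_2 -> R) : \sum_i F i = F 0 + F 1.
Proof.
rewrite !big_ord_recl big_ord0 addr0; congr (F _ + F _); exact: val_inj.
Qed.

Lemma dotE u v : dot u v = u 0 0 * v 0 0 + u 0 1 * v 0 1 + u 0 2%:R * v 0 2%:R.
Proof. by rewrite /dot mxE sum_I3 !mxE. Qed.

Lemma crossE u v :
  [/\ cross u v 0 0 = u 0 1 * v 0 2%:R - u 0 2%:R * v 0 1,
      cross u v 0 1 = u 0 2%:R * v 0 0 - u 0 0 * v 0 2%:R
    & cross u v 0 2%:R = u 0 0 * v 0 1 - u 0 1 * v 0 0].
Proof.
by split; rewrite mxE; congr (u 0 _ * v 0 _ - u 0 _ * v 0 _); exact: val_inj.
Qed.

Lemma dotC u v : dot u v = dot v u.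
Proof. by rewrite !dotE; ring. Qed.

Lemma dotDl u v w : dot (u + v) w = dot u w + dot v w.
Proof. by rewrite !dotE !mxE; ring. Qed.

Lemma dotZl (k : R) u w : dot (k *: u) w = k * dot u w.
Proof. by rewrite !dotE !mxE; ring. Qed.

Lemma dotNl u w : dot (- u) w = - dot u w.
Proof. by rewrite !dotE !mxE; ring. Qed.

Lemma dotBl u v w : dot (u - v) w = dot u w - dot v w.
Proof. by rewrite dotDl dotNl. Qed.

Lemma dot_eq0 u : dot u u = 0 -> u = 0.
Proof.
rewrite dotE => e; have := sqr_ge0 (u 0 0); have := sqr_ge0 (u 0 1).
have := sqr_ge0 (u 0 2%:R); rewrite !expr2 => h2 h1 h0.
have z (s : R) : s * s <= 0 -> s = 0.
  by move=> h; apply/eqP; rewrite -(mulf_eq0 s s) orbb || idtac; apply/eqP; nra.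
by apply/rowP; elim/I3_ind; rewrite mxE; apply: z; lra.
Qed.

(** The last two fields fix the orientation: they make (u, v) rotate positively about a, and the
    matrix of the frame has determinant 1. *)
Record frame u v a : Prop := Frame {
  frame_uu : dot u u = 1; frame_vv : dot v v = 1; frame_aa : dot a a = 1;
  frame_uv : dot u v = 0; frame_ua : dot u a = 0; frame_va : dot v a = 0;
  frame_au : cross a u = v; frame_av : cross a v = - u }.

Definition frame_mx u v a : 'M[R]_3 := \matrix_(i < 3, j < 3) [:: u 0 i; v 0 i; a 0 i]`_j.

Lemma mulmx_frame y u v a :
  [/\ (y *m frame_mx u v a) 0 0 = dot y u, (y *m frame_mx u v a) 0 1 = dot y v
    & (y *m frame_mx u v a) 0 2%:R = dot y a].
Proof. by split; rewrite mxE sum_I3 dotE !mxE. Qed.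

Lemma frame_mx_orthogonal u v a : frame u v a -> frame_mx u v a *m (frame_mx u v a)^T = 1%:M.
Proof.
case=> uu vv aa uv ua va _ _; apply: mulmx1C; apply/matrixP => i j.
rewrite !mxE sum_I3 !mxE; move: i j.
by move: uu vv aa uv ua va; rewrite !dotE => uu vv aa uv ua va;
  elim/I3_ind; elim/I3_ind; rewrite /= ?mulr1n ?mulr0n; lra.
Qed.

Lemma frame_dot y w u v a : frame u v a ->
  dot y w = dot y u * dot w u + dot y v * dot w v + dot y a * dot w a.
Proof.
move=> fr; have Q := frame_mx_orthogonal fr.
have [y0 y1 y2] := mulmx_frame y u v a; have [w0 w1 w2] := mulmx_frame w u v a.
rewrite -y0 -y1 -y2 -w0 -w1 -w2 -dotE /dot trmx_mul mulmxA -(mulmxA y) Q mulmx1.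
by [].
Qed.

Lemma det_mx2 (A : 'M[R]_2) : \det A = A 0 0 * A 1 1 - A 0 1 * A 1 0.
Proof.
rewrite (expand_det_row _ 0) sum_I2 /cofactor !det_mx11 !mxE /=.
rewrite addn0 addn1 expr0 expr1 mul1r mulN1r mulrN.
by congr (_ * A _ _ - _ * A _ _); exact: val_inj.
Qed.

Lemma det_mx3 (A : 'M[R]_3) : \det A =
  A 0 0 * (A 1 1 * A 2%:R 2%:R - A 1 2%:R * A 2%:R 1)
  - A 0 1 * (A 1 0 * A 2%:R 2%:R - A 1 2%:R * A 2%:R 0)
  + A 0 2%:R * (A 1 0 * A 2%:R 1 - A 1 1 * A 2%:R 0).
Proof.
rewrite (expand_det_row _ 0) sum_I3 /cofactor !det_mx2 !mxE /=.
rewrite !add0n expr0 expr1 mul1r mulN1r mulrN.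
rewrite (_ : (-1) ^+ (2 %% 3)%N = 1 :> R); last by rewrite /= sqrrN expr1n.
rewrite mul1r.
by congr (_ * (A _ _ * A _ _ - A _ _ * A _ _) - _ * (A _ _ * A _ _ - A _ _ * A _ _)
  + _ * (A _ _ * A _ _ - A _ _ * A _ _)); exact: val_inj.
Qed.

Lemma frame_mx_det u v a : frame u v a -> \det (frame_mx u v a) = 1.
Proof.
move=> fr; rewrite det_mx3 !mxE /=.
have [c0 c1 c2] := crossE a u; rewrite (frame_au fr) in c0 c1 c2.
rewrite -(frame_vv fr) dotE.
transitivity (v 0 0 * (a 0 1 * u 0 2%:R - a 0 2%:R * u 0 1) +
  v 0 1 * (a 0 2%:R * u 0 0 - a 0 0 * u 0 2%:R) +
  v 0 2%:R * (a 0 0 * u 0 1 - a 0 1 * u 0 0)); first by ring.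
by rewrite -c0 -c1 -c2.
Qed.

(** u is the normalized horizontal vector (-a_1, a_0, 0), or the first basis vector when a is
    vertical, and v = a x u. *)
Lemma frame_exists a : dot a a = 1 -> exists u v, frame u v a.
Proof.
move=> aa; have crossP u : dot u u = 1 -> dot u a = 0 -> frame u (cross a u) a.
  move=> uu ua; have [c0 c1 c2] := crossE a u; have [d0 d1 d2] := crossE a (cross a u).
  have vv : dot (cross a u) (cross a u) = dot a a * dot u u - dot u a ^+ 2.
    by rewrite !dotE c0 c1 c2; ring.
  split=> //.
  - by rewrite vv aa uu ua; ring.
  - by rewrite dotE c0 c1 c2; ring.
  - by rewrite dotE c0 c1 c2; ring.
  - have E j : cross a (cross a u) 0 j = dot u a * a 0 j - dot a a * u 0 j.
      by move: j; elim/I3_ind; rewrite ?d0 ?d1 ?d2 ?c0 ?c1 ?c2 !dotE; ring.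
    by apply/rowP => j; rewrite E ua aa mxE; ring.
suff [u [uu ua]] : exists u, dot u u = 1 /\ dot u a = 0.
  by exists u, (cross a u); exact: crossP.
have [a0|a0] := eqVneq (a 0 0 ^+ 2 + a 0 1 ^+ 2) 0.
  exists (vec3 1 0 0); rewrite !dotE !mxE /=; split; first by ring.
  have : a 0 0 ^+ 2 = 0 by have := sqr_ge0 (a 0 0); have := sqr_ge0 (a 0 1); lra.
  by move/eqP; rewrite sqrf_eq0 => /eqP ->; ring.
have s0 : 0 < a 0 0 ^+ 2 + a 0 1 ^+ 2.
  by rewrite lt_neqAle eq_sym a0 addr_ge0 ?sqr_ge0.
pose s := Num.sqrt (a 0 0 ^+ 2 + a 0 1 ^+ 2).
have sN0 : s != 0 by rewrite sqrtr_eq0 -ltNge.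
have ss : s ^+ 2 = a 0 0 ^+ 2 + a 0 1 ^+ 2 by rewrite sqr_sqrtr // ltW.
exists (vec3 (- a 0 1 / s) (a 0 0 / s) 0); rewrite !dotE !mxE /=; split; last by field.
rewrite (_ : _ + _ = (a 0 0 ^+ 2 + a 0 1 ^+ 2) / s ^+ 2); last by field.
by rewrite ss divff.
Qed.

Lemma frame_rotation u v a t y : frame u v a ->
  [/\ dot (rotation a t y) u = cos t * dot y u - sin t * dot y v,
      dot (rotation a t y) v = sin t * dot y u + cos t * dot y v
    & dot (rotation a t y) a = dot y a].
Proof.
move=> fr; rewrite /rotation.
have cr w b : dot (cross a w) b = - dot (cross a b) w.
  have [c0 c1 c2] := crossE a w; have [d0 d1 d2] := crossE a b.
  by rewrite !dotE c0 c1 c2 d0 d1 d2; ring.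
have ca : cross a a = 0.
  by have [c0 c1 c2] := crossE a a; apply/rowP; elim/I3_ind; rewrite ?c0 ?c1 ?c2 mxE; ring.
rewrite !dotDl !dotZl !(cr y) (frame_au fr) (frame_av fr) ca (dotC a u) (dotC a v).
rewrite (frame_ua fr) (frame_va fr) (frame_aa fr) (dotC v y) !dotNl (dotC u y).
have -> : dot 0 y = 0 by rewrite dotE !mxE; ring.
by rewrite (dotC a y); split; ring.
Qed.

Lemma cross_lincomb a u v (k l : R) :
  cross a (k *: u + l *: v) = k *: cross a u + l *: cross a v.
Proof.
have [c0 c1 c2] := crossE a u; have [d0 d1 d2] := crossE a v.
have [b0 b1 b2] := crossE a (k *: u + l *: v).
apply/rowP; elim/I3_ind; rewrite ?b0 ?b1 ?b2 !mxE -/(cross a u) -/(cross a v).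
- by rewrite !mxE /= in c0 d0 *; rewrite c0 d0; ring.
- by rewrite !mxE /= in c1 d1 *; rewrite c1 d1; ring.
- by rewrite !mxE /= in c2 d2 *; rewrite c2 d2; ring.
Qed.

Lemma frame_rotate u v a (t : R) : frame u v a ->
  frame (cos t *: u + sin t *: v) (- sin t *: u + cos t *: v) a.
Proof.
move=> fr; have cs := cos2Dsin2 t; case: (fr) => uu vv aa uv ua va au av.
have vu : dot v u = 0 by rewrite dotC.
have D k l k' l' : dot (k *: u + l *: v) (k' *: u + l' *: v) = k * k' + l * l'.
  by rewrite dotDl !dotZl (dotC u) (dotC v) !dotDl !dotZl uu uv vu vv; ring.
by split; rewrite ?D ?cross_lincomb ?au ?av // ?dotDl ?dotZl ?ua ?va;
  (ring || (rewrite -[RHS]cs; ring) || (apply/rowP => j; rewrite !mxE; ring)).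
Qed.

End Frame.

(** * Scalar data of a surface with semi-rotational Gauss map *)

Section Data.
Variables (R : realType) (M : manifold2 R).
Implicit Types (c d : chart R M) (p : M).

Lemma atlas_chart_at p : atlas (chart_at p).
Proof. by rewrite /chart_at; case: cid2. Qed.

Lemma cdom_chart_at p : cdom (chart_at p) p.
Proof. by rewrite /chart_at; case: cid2. Qed.

Lemma is_derive_sum3 (V : normedModType R) (f0 f1 f2 : V -> R) (x v : V) (a b c : R) :
  is_derive x v f0 a -> is_derive x v f1 b -> is_derive x v f2 c ->
  is_derive x v (fun y => f0 y + f1 y + f2 y) (a + b + c).
Proof. by move=> *; do 2!apply: is_deriveD. Qed.

Lemma is_derive_prod (V : normedModType R) (f g : V -> R) (x v : V) (a b : R) :
  is_derive x v f a -> is_derive x v g b ->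
  is_derive x v (fun y => f y * g y) (f x * b + g x * a).
Proof. by move=> *; apply: is_deriveM. Qed.

Lemma is_derive_dot (V : normedModType R) (f g : V -> 'rV[R]_3) (x v : V) a b :
  is_derive x v f a -> is_derive x v g b ->
  is_derive x v (fun y => dot (f y) (g y)) (dot a (g x) + dot (f x) b).
Proof.
move=> df dg.
have H j := is_derive_prod (is_derive_coord 0 j df) (is_derive_coord 0 j dg).
have := is_derive_sum3 (H 0) (H 1) (H 2%:R).
rewrite (_ : (fun y => _) = (fun y => dot (f y) (g y))); last first.
  by apply/funext => y; rewrite dotE.
by move=> H3; apply: is_derive_eq H3 _; rewrite !dotE; ring.
Qed.

Lemma is_derive_dot_cst (V : normedModType R) (f : V -> 'rV[R]_3) (x v : V) a o u :
  is_derive x v f a -> is_derive x v (fun y => dot (f y - o) u) (dot a u).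
Proof.
move=> df; have dB := is_deriveB df (is_derive_cst o x v).
have := is_derive_dot dB (is_derive_cst u x v) => H; apply: is_derive_eq H _.
by rewrite subr0 [X in _ + X](_ : _ = 0) ?addr0 // dotE !mxE; ring.
Qed.

Lemma Ck_dot_cst (V : normedModType R) k (U : set V) (f : V -> 'rV[R]_3) o u : open U ->
  Ck_on k U f -> Ck_on k U (fun y => dot (f y - o) u).
Proof.
move=> oU kf; rewrite (_ : (fun y => _) = (fun y => (f y 0 0 + - o 0 0) * u 0 0 +
   (f y 0 1 + - o 0 1) * u 0 1 + (f y 0 2%:R + - o 0 2%:R) * u 0 2%:R)); last first.
  by apply/funext => y; rewrite dotE !mxE.
have h j : Ck_on k U (fun y => (f y 0 j + - o 0 j) * u 0 j).
  apply: Ck_mul => //; last exact: Ck_cst.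
  by apply: Ck_add => //; [exact: Ck_coord|exact: Ck_cst].
by apply: Ck_add => //; apply: Ck_add.
Qed.

Lemma smooth_dot_cst (f : M -> 'rV[R]_3) o u : smooth_map f ->
  smooth_map (fun p => dot (f p - o) u).
Proof. by move=> sf c ac k; apply: Ck_dot_cst; [exact: open_cim|exact: sf]. Qed.

Definition vpd (f : M -> 'rV[R]_3) c p (v : 'rV[R]_2) : 'rV[R]_3 :=
  'D_v (f \o cinv c) (cmap c p).

Lemma is_derive_vmap (f : M -> 'rV[R]_3) c p v : smooth_map f -> atlas c -> cdom c p ->
  is_derive (cmap c p) v (f \o cinv c) (vpd f c p v).
Proof.
by move=> sf ac cp; apply: derivableP; apply: (Ck_derivable (sf c ac 1%N)); exact: cim_cmap.
Qed.

Lemma pd_dot_cst (f : M -> 'rV[R]_3) o u c p v : smooth_map f -> atlas c -> cdom c p ->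
  pd (fun p => dot (f p - o) u) c p v = dot (vpd f c p v) u.
Proof.
by move=> sf ac cp; have [_] := is_derive_dot_cst o u (is_derive_vmap v sf ac cp).
Qed.

Lemma pd_lin (f : M -> R) c p v : smooth_map f -> atlas c -> cdom c p ->
  pd f c p v = lin2 (pd f c p (e_ R 0)) (pd f c p (e_ R 1)) v.
Proof.
move=> sf ac cp; have [_ E] := C1_diff (@open_cim _ _ c) (cim_cmap cp) (sf c ac 1%N).
exact: E.
Qed.

Lemma dot_ext (a b : 'rV[R]_3) : (forall u, dot a u = dot b u) -> a = b.
Proof.
move=> h; apply/rowP; elim/I3_ind.
- by have := h (vec3 1 0 0); rewrite !dotE !mxE /=; lra.
- by have := h (vec3 0 1 0); rewrite !dotE !mxE /=; lra.
- by have := h (vec3 0 0 1); rewrite !dotE !mxE /=; lra.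
Qed.

(* The hypothesis on the Gaussian curvature is only used through the last two
   fields: a surface that is vertical on an open set, or has parallel normals on
   it, has vanishing curvature there. *)
Record semirot (phi : R -> M -> M) (k : R) (z1 z2 h n1 n2 n3 : M -> R) : Prop := Semirot {
  sr_z1_smooth : smooth_map z1;
  sr_z2_smooth : smooth_map z2;
  sr_h_smooth : smooth_map h;
  sr_n1_smooth : smooth_map n1;
  sr_n2_smooth : smooth_map n2;
  sr_n3_smooth : smooth_map n3;
  sr_flow : one_parameter_group phi;
  sr_unit : forall p, n1 p ^+ 2 + n2 p ^+ 2 + n3 p ^+ 2 = 1;
  sr_tangent : forall c p v, atlas c -> cdom c p ->
    n1 p * pd z1 c p v + n2 p * pd z2 c p v + n3 p * pd h c p v = 0;
  sr_immersion : forall c p v, atlas c -> cdom c p ->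
    pd z1 c p v = 0 -> pd z2 c p v = 0 -> pd h c p v = 0 -> v = 0;
  sr_z1_flow : forall t p, z1 (phi t p) = cos t * z1 p - sin t * z2 p;
  sr_z2_flow : forall t p, z2 (phi t p) = sin t * z1 p + cos t * z2 p;
  sr_n1_flow : forall t p, n1 (phi t p) = cos (k * t) * n1 p - sin (k * t) * n2 p;
  sr_n2_flow : forall t p, n2 (phi t p) = sin (k * t) * n1 p + cos (k * t) * n2 p;
  sr_n3_flow : forall t p, n3 (phi t p) = n3 p;
  sr_nonvertical : forall U : set M, open U -> U !=set0 -> exists2 p, U p & n3 p != 0;
  sr_nonflat : forall U : set M, open U -> U !=set0 ->
    ~ (forall p c v, U p -> atlas c -> cdom c p -> exists l,
         [/\ pd n1 c p v = l * n1 p, pd n2 c p v = l * n2 p & pd n3 c p v = l * n3 p]) }.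

Variables (x n : M -> 'rV[R]_3).
Local Notation Dx := (vpd x).
Local Notation Dn := (vpd n).
Hypothesis hx : smooth_immersion x.
Hypothesis hn : gauss_map x n.
Hypothesis hK : ~ exists U : set M, [/\ open U, U !=set0
            & forall p, U p -> is_gradient x (gauss_curvature x n) p 0].


Lemma chart_change_vec c p v : atlas c -> cdom c p ->
  exists w, Dx c p v = dmap x p w /\ (w = 0 -> v = 0).
Proof.
move=> ac cp; have [w [wE w0]] := chart_change v ac (atlas_chart_at p) cp (cdom_chart_at p).
exists w; split; last exact: w0.
apply: dot_ext => u; have sx := hx.1.
rewrite -(pd_dot_cst 0) // wE; last exact: smooth_dot_cst.
by rewrite (pd_dot_cst 0) //; [exact: atlas_chart_at|exact: cdom_chart_at].
Qed.

Lemma normal_tangent c p v : atlas c -> cdom c p -> dot (n p) (Dx c p v) = 0.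
Proof. by move=> ac cp; have [w [-> _]] := chart_change_vec v ac cp; case: hn. Qed.

Lemma Dx_inj c p v : atlas c -> cdom c p -> Dx c p v = 0 -> v = 0.
Proof.
move=> ac cp; have [w [-> w0]] := chart_change_vec v ac cp => Dw; apply: w0.
by apply: (hx.2 p); rewrite Dw /dmap derive0.
Qed.

(** Weingarten's relation: the function <n, dx(e_i)> vanishes identically, and differentiating it
    along e_j moves one derivative from x to n. *)
Lemma second_formE p (i j : 'I_2) :
  second_form x n p i j = - dot (Dx (chart_at p) p (e_ R i)) (Dn (chart_at p) p (e_ R j)).
Proof.
set c := chart_at p; have ac : atlas c := atlas_chart_at p.
have cp : cdom c p := cdom_chart_at p.
have dn := is_derive_vmap (e_ R j) (let: And3 sn _ _ := hn in sn) ac cp.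
have dDx : is_derive (cmap c p) (e_ R j) ('D_(e_ R i) (x \o cinv c))
   ('D_(e_ R j) ('D_(e_ R i) (x \o cinv c)) (cmap c p)).
  apply: derivableP; apply: (Ck_derivable (k := 0) (U := cim c)); last exact: cim_cmap.
  by apply: Ck_derive; apply: hx.1.
have := is_derive_dot dn dDx => H.
have E : 'D_(e_ R j) (fun y => dot ((n \o cinv c) y) ('D_(e_ R i) (x \o cinv c) y)) (cmap c p) = 0.
  rewrite -[RHS](derive_cst (0 : R) (cmap c p) (e_ R j)); apply: near_eq_derive.
  apply: filterS (nbhs_cim cp) => u cu /=.
  have := normal_tangent (e_ R i) ac (cinv_dom cu).
  by rewrite /vpd cinvK.
have [_] := H; rewrite E /= cmapK // mxE => /esym/eqP; rewrite addr_eq0 dotC => /eqP ->; rewrite opprK.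
exact: erefl.
Qed.

(** By [second_formE] such a V is a null vector of the second fundamental form, whose determinant
    therefore vanishes. *)
Lemma curvature0 p (V : 'rV[R]_2) : V != 0 ->
  (forall j, dot (Dx (chart_at p) p V) (Dn (chart_at p) p (e_ R j)) = 0) ->
  gauss_curvature x n p = 0.
Proof.
move=> V0 H; rewrite /gauss_curvature.
suff D0 : \det (second_form x n p) = 0 by rewrite D0 mul0r.
have ac := atlas_chart_at p; have cp := cdom_chart_at p.
have lin j : V 0 0 * second_form x n p 0 j + V 0 1 * second_form x n p 1 j = 0.
  have := H j; rewrite -(pd_dot_cst 0) //; last exact: hx.1.
  rewrite pd_lin //; last by apply: smooth_dot_cst; exact: hx.1.
  rewrite /lin2 !(pd_dot_cst 0) //; try exact: hx.1.
  rewrite !second_formE.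
  by move=> h; rewrite 2!mulrN -opprD h oppr0.
rewrite [LHS]det_mx2; have l0 := lin 0; have l1 := lin 1.
move: (second_form x n p 0 0) (second_form x n p 0 1) (second_form x n p 1 0)
   (second_form x n p 1 1) l0 l1 => a b c d l0 l1.
apply/eqP; have [v0|v0] := eqVneq (V 0 0) 0.
  have v1 : V 0 1 != 0.
    by apply: contra_neq V0 => v1; apply: rV2P; rewrite mxE.
  rewrite v0 !mul0r !add0r in l0 l1.
  move/eqP: l0; rewrite mulf_eq0 (negbTE v1) => /eqP ->.
  by move/eqP: l1; rewrite mulf_eq0 (negbTE v1) => /eqP ->; rewrite !mulr0 subrr.
rewrite -(mulrI_eq0 _ (mulfI v0)) mulrBr !mulrA.
have -> : V 0 0 * a = - (V 0 1 * c) by apply/eqP; rewrite -addr_eq0 l0.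
have -> : V 0 0 * b = - (V 0 1 * d) by apply/eqP; rewrite -addr_eq0 l1.
by apply/eqP; ring.
Qed.

Lemma curvature_not_locally0 (U : set M) : open U -> U !=set0 ->
  ~ (forall p, U p -> gauss_curvature x n p = 0).
Proof.
move=> oU U0 K0; apply: hK; exists U; split=> // p Up; split.
  by exists 0; rewrite /dmap derive0.
move=> v; have -> : dot 0 (dmap x p v) = 0 by rewrite dotE !mxE; ring.
rewrite /dmap -[LHS](derive_cst (0 : R) (cmap (chart_at p) p) v).
apply/esym/near_eq_derive.
have : \forall u \near cmap (chart_at p) p, U (cinv (chart_at p) u).
  apply: (cinv_continuous (cim_cmap (cdom_chart_at p))).
  by rewrite cmapK; [apply: open_nbhs_nbhs|exact: cdom_chart_at].
by apply: filterS => u /K0.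
Qed.


(** The covectors (A0, A1) and (B0, B1) are linearly dependent; a trivial common kernel would give
    them a nonzero determinant. *)
Lemma kernel2 (a b A0 A1 B0 B1 : R) : a != 0 \/ b != 0 ->
  a * A0 + b * B0 = 0 -> a * A1 + b * B1 = 0 ->
  exists2 V : 'rV[R]_2, V != 0 & lin2 A0 A1 V = 0 /\ lin2 B0 B1 V = 0.
Proof.
move=> ab e0 e1; apply: contrapT => nV.
have J0 : A0 * B1 - A1 * B0 != 0.
  apply: det2_neq0 => v0 v1 h0 h1; apply: contrapT => v01; apply: nV.
  exists (vec2 v0 v1); last by rewrite /lin2 !vec2E mulrC (mulrC v1) h0 mulrC (mulrC v1) h1.
  apply/eqP => /rowP V0; apply: v01.
  by have := V0 0; have := V0 1; rewrite !vec2E !mxE => -> ->.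
have aJ : a * (A0 * B1 - A1 * B0) = 0.
  have -> : a * (A0 * B1 - A1 * B0) = (a * A0 + b * B0) * B1 - (a * A1 + b * B1) * B0 by ring.
  by rewrite e0 e1; ring.
have bJ : b * (A0 * B1 - A1 * B0) = 0.
  have -> : b * (A0 * B1 - A1 * B0) = (a * A1 + b * B1) * A0 - (a * A0 + b * B0) * A1 by ring.
  by rewrite e0 e1; ring.
by case: ab => /negP; apply; apply/eqP; apply: (mulIf J0); rewrite mul0r.
Qed.

Lemma lincomb3 (A B C a b c l : R) :
  a * A + b * B + c * C = 0 -> A * (l * a) + B * (l * b) + C * (l * c) = 0.
Proof. by move=> e; rewrite -[RHS](mulr0 l) -e; ring. Qed.

Lemma pd_eq0_near (f : M -> R) (U : set M) c p v : open U -> U p -> cdom c p ->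
  (forall q, U q -> f q = 0) -> pd f c p v = 0.
Proof.
move=> oU Up cp f0; rewrite /pd -[RHS](derive_cst (0 : R) (cmap c p) v).
apply/near_eq_derive.
have : \forall u \near cmap c p, U (cinv c u).
  apply: (cinv_continuous (cim_cmap cp)).
  by rewrite cmapK; [apply: open_nbhs_nbhs|].
by apply: filterS => u /f0.
Qed.

(** Coordinates are taken with origin at the intersection of line and plane, and third axis along
    the normal b that orients the plane. The components of n are written with [n p - 0] so that the
    lemmas on affine coordinates of x serve for n too. *)
Lemma semirot_of_gauss_map : semi_rotational_gauss_map x n ->
  exists o u v b phi k, frame u v b /\
   semirot phi k (fun p => dot (x p - o) u) (fun p => dot (x p - o) v)
     (fun p => dot (x p - o) b)
     (fun p => dot (n p - 0) u) (fun p => dot (n p - 0) v) (fun p => dot (n p - 0) b).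
Proof.
case=> q [a [r [b [cen [phi [[ua ub] [perp lp] flow rot [k nk]]]]]]].
have [u [v fr]] := frame_exists ub.
have [sx _] := hx; have [sn un tn] := hn; rename cen into o.
(* The line is orthogonal to the plane, so a = s b with s = 1 or s = -1. Reversing the axis reverses
   the angle of rotation, so the sign is absorbed into k. *)
move es : (dot a b) => s.
have E W : dot (a - s *: b) W = dot W a - s * dot W b by rewrite dotBl dotZl (dotC a) (dotC b).
have ab : a = s *: b.
  have w0 : dot (a - s *: b) b = 0 by rewrite dotBl dotZl ub mulr1 es subrr.
  have : dot (a - s *: b) (a - s *: b) = 0 by rewrite E (perp _ w0) w0 mulr0 subrr.
  by move/dot_eq0/eqP; rewrite subr_eq0 => /eqP.
have ab2 : s ^+ 2 = 1.
  by move: ua; rewrite /unit_vec {1}ab dotZl dotC es expr2.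
have s1 : s = 1 \/ s = -1.
  by move/eqP: ab2; rewrite sqrf_eq1 => /orP[] /eqP; [left|right].
have rotE t y : rotation a t y = rotation b (s * t) y.
  rewrite ab; case: s1 => ->; first by rewrite scale1r mul1r.
  rewrite scaleN1r mulN1r /rotation cosN sinN.
  by rewrite dotNl; apply/rowP => i; rewrite !mxE; ring.
have rob : dot (o - r) b = 0.
  have : [set o] o by [].
  by rewrite -lp => -[].
have proj y : proj_plane r b y - o = (y - o) - dot (y - o) b *: b.
  have e1 : y - r = (y - o) + (o - r) by rewrite addrA subrK.
  have e2 : dot (y - r) b = dot (y - o) b by rewrite e1 dotDl rob addr0.
  by rewrite /proj_plane e2 addrAC.
exists o, u, v, b, phi, (s * k); split=> //.
have pu y : dot (proj_plane r b y - o) u = dot (y - o) u.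
  by rewrite proj; move: (y - o) => Y; rewrite dotBl dotZl (dotC b) (frame_ua fr) mulr0 subr0.
have pv y : dot (proj_plane r b y - o) v = dot (y - o) v.
  by rewrite proj; move: (y - o) => Y; rewrite dotBl dotZl (dotC b) (frame_va fr) mulr0 subr0.
split => //; try exact: smooth_dot_cst.
- by move=> p; rewrite !subr0 !expr2 -(frame_dot _ _ fr); exact: un.
- move=> c p w ac cp; rewrite !(pd_dot_cst _ _ _ sx) // !subr0 -(frame_dot _ _ fr).
  exact: normal_tangent.
- move=> c p w ac cp; rewrite !(pd_dot_cst _ _ _ sx) // => h0 h1 h2.
  by apply: (Dx_inj ac cp); apply: dot_eq0; rewrite (frame_dot _ _ fr) h0 h1 h2; ring.
- move=> t p; rewrite -pu rot /rotation_about addrC addKr.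
  by have [-> _ _] := frame_rotation t (proj_plane r b (x p) - o) fr; rewrite pu pv.
- move=> t p; rewrite -pv rot /rotation_about addrC addKr.
  by have [_ -> _] := frame_rotation t (proj_plane r b (x p) - o) fr; rewrite pu pv.
- by move=> t p; rewrite !subr0 nk rotE mulrA; have [-> _ _] := frame_rotation (s * k * t) (n p) fr.
- by move=> t p; rewrite !subr0 nk rotE mulrA; have [_ -> _] := frame_rotation (s * k * t) (n p) fr.
- by move=> t p; rewrite !subr0 nk rotE mulrA; have [_ _ ->] := frame_rotation (s * k * t) (n p) fr.
(* If n3 = 0 on U, tangency makes the two horizontal components of dx linearly dependent, so dx(V)
   is parallel to b for some V <> 0. Since dn has no component along b on U, this V is a null vector
   of the second fundamental form. *)
- move=> U oU U0; apply: contrapT => nU.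
  have n0 p : U p -> dot (n p - 0) b = 0.
    by move=> Up; apply: contrapT => /eqP nb; apply: nU; exists p.
  apply: (curvature_not_locally0 oU U0) => p Up.
  have ac := atlas_chart_at p; have cp := cdom_chart_at p.
  have tang i := normal_tangent (e_ R i) ac cp.
  have tang2 i : dot (n p) u * dot (Dx (chart_at p) p (e_ R i)) u +
      dot (n p) v * dot (Dx (chart_at p) p (e_ R i)) v = 0.
    have := tang i; rewrite (frame_dot _ _ fr).
    by have := n0 p Up; rewrite subr0 => ->; rewrite mul0r addr0.
  have nuv : dot (n p) u != 0 \/ dot (n p) v != 0.
    have := un p; rewrite /unit_vec (frame_dot _ _ fr).
    have := n0 p Up; rewrite subr0 => ->; rewrite mul0r addr0.
    have [->|] := eqVneq (dot (n p) u) 0; last by left.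
    have [->|] := eqVneq (dot (n p) v) 0; last by right.
    by rewrite !mul0r addr0 => /esym/eqP; rewrite oner_eq0.
  have [V V0 [Vu Vv]] := kernel2 nuv (tang2 0) (tang2 1).
  apply: (curvature0 V0) => j; rewrite (frame_dot _ _ fr).
  have EV w (W : 'rV[R]_2) : dot (Dx (chart_at p) p W) w =
      lin2 (dot (Dx (chart_at p) p (e_ R 0)) w) (dot (Dx (chart_at p) p (e_ R 1)) w) W.
    by have := pd_lin W (smooth_dot_cst 0 w sx) ac cp; rewrite !(pd_dot_cst _ _ _ sx ac cp).
  have nj0 : dot (Dn (chart_at p) p (e_ R j)) b = 0.
    by rewrite -(pd_dot_cst 0 _ _ sn) //; exact: (pd_eq0_near _ oU Up cp n0).
  by rewrite (EV u) Vu (EV v) Vv nj0; ring.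
(* A derivative of n that is a multiple of n is orthogonal to all tangent vectors, so any nonzero
   vector can be used in [curvature0]. *)
- move=> U oU U0 flat; apply: (curvature_not_locally0 oU U0) => p Up.
  have ac := atlas_chart_at p; have cp := cdom_chart_at p.
  apply: (@curvature0 p (vec2 1 0)).
    by apply/eqP => /rowP/(_ 0); rewrite vec2E mxE => /eqP; rewrite oner_eq0.
  move=> j; have [l []] := flat p (chart_at p) (e_ R j) Up ac cp.
  rewrite !(pd_dot_cst _ _ _ sn) // !subr0 => lu lv lb.
  rewrite (frame_dot _ _ fr) lu lv lb.
  have := normal_tangent (vec2 1 0) ac cp; rewrite (frame_dot _ _ fr) => t0.
  exact: lincomb3 t0.
Qed.

End Data.

(** * Consequences of the flow *)

Section Flow.
Variables (R : realType) (M : manifold2 R).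
Variables (phi : R -> M -> M) (k : R) (z1 z2 h n1 n2 n3 : M -> R).
Hypothesis sr : semirot phi k z1 z2 h n1 n2 n3.
Implicit Types (c : chart R M) (p : M).

Let sz1 := sr_z1_smooth sr.
Let sz2 := sr_z2_smooth sr.
Let sh := sr_h_smooth sr.
Let sn1 := sr_n1_smooth sr.
Let sn2 := sr_n2_smooth sr.
Let sn3 := sr_n3_smooth sr.

Lemma smooth_map_continuous (f : M -> R) : smooth_map f -> continuous f.
Proof.
move=> sf p; have [c ac cp] := atlas_cover p.
have nd : nbhs p (cdom c) by apply: open_nbhs_nbhs; split=> //; exact: cdom_open.
apply: (@near_eq_continuous _ _ _ (f \o cinv c \o cmap c)).
  by apply: filterS nd => q cq /=; rewrite cmapK.
apply: continuous_comp; first exact: cmap_continuous.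
exact: (Ck_continuous (sf c ac 0%N) (cim_cmap cp)).
Qed.

Lemma open_neq0 (f : M -> R) : smooth_map f -> open [set p | f p != 0].
Proof.
move=> sf; apply: (open_comp (f := f) (D := [set y | y != 0])); last exact: open_neq.
by move=> p _; exact: smooth_map_continuous.
Qed.

Lemma tangent_flow t c p v : atlas c -> cdom c p ->
  n1 (phi t p) * pd (z1 \o phi t) c p v + n2 (phi t p) * pd (z2 \o phi t) c p v
   + n3 (phi t p) * pd (h \o phi t) c p v = 0.
Proof.
move=> ac cp; have [d [w [ad dp D]]] := flow_pd (sr_flow sr) t v ac cp.
rewrite /pd; have [_ ->] := D _ sz1; have [_ ->] := D _ sz2; have [_ ->] := D _ sh.
exact: (sr_tangent sr w ad dp).
Qed.

Lemma is_derive_lincomb (V : normedModType R) (f g : V -> R) (y v : V) (a b df dg : R) :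
  is_derive y v f df -> is_derive y v g dg ->
  is_derive y v (fun u => a * f u + b * g u) (a * df + b * dg).
Proof. by move=> ? ?; apply: is_deriveD; apply: is_deriveZ. Qed.

Lemma pd_z1_flow t c p v : atlas c -> cdom c p ->
  pd (z1 \o phi t) c p v = cos t * pd z1 c p v - sin t * pd z2 c p v.
Proof.
move=> ac cp; rewrite /pd.
have -> : (z1 \o phi t) \o cinv c =
    (fun u => cos t * (z1 \o cinv c) u + (- sin t) * (z2 \o cinv c) u).
  by apply/funext => u; rewrite /= (sr_z1_flow sr) mulNr.
rewrite -mulNr.
by have [_] := is_derive_lincomb (cos t) (- sin t) (is_pd v sz1 ac cp) (is_pd v sz2 ac cp).
Qed.

Lemma pd_z2_flow t c p v : atlas c -> cdom c p ->
  pd (z2 \o phi t) c p v = sin t * pd z1 c p v + cos t * pd z2 c p v.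
Proof.
move=> ac cp; rewrite /pd.
have -> : (z2 \o phi t) \o cinv c =
    (fun u => sin t * (z1 \o cinv c) u + cos t * (z2 \o cinv c) u).
  by apply/funext => u; rewrite /= (sr_z2_flow sr).
by have [_] := is_derive_lincomb (sin t) (cos t) (is_pd v sz1 ac cp) (is_pd v sz2 ac cp).
Qed.

(* [w_re + i w_im] is conj(nu) z. *)
Definition w_re p := z1 p * n1 p + z2 p * n2 p.
Definition w_im p := z2 p * n1 p - z1 p * n2 p.

Lemma is_derive_trig (a : R) (t : R) :
  is_derive t 1 (fun s : R => cos (a * s)) (- sin (a * t) * a) /\
  is_derive t 1 (fun s : R => sin (a * s)) (cos (a * t) * a).
Proof.
have d : is_derive t 1 (fun s : R => a * s) a.
  rewrite (_ : (fun s => a * s) = a *: id) //.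
  by apply: is_derive_eq; rewrite [_ *: 1]mulr1.
by split; [apply: (is_derive_comp1 d); exact: is_derive_cos
          |apply: (is_derive_comp1 d); exact: is_derive_sin].
Qed.

Lemma h_flow_derive (t : R) p : exists2 H : R, is_derive t (1 : R) (fun s => h (phi s p)) H &
  n3 p * H = w_re p * sin ((1 - k) * t) + w_im p * cos ((1 - k) * t).
Proof.
have [d [w [ad dp D]]] := flow_time_derive (sr_flow sr) t p.
exists (pd h d (phi t p) w); first exact: D.
have := sr_tangent sr w ad dp; rewrite (sr_n1_flow sr) (sr_n2_flow sr) (sr_n3_flow sr).
have [c1 s1] := is_derive_trig 1 t.
have E f : (fun s : R => f (1 * s)) = f :> (R -> R) by apply/funext => s; rewrite mul1r.
rewrite !E mul1r !mulr1 in c1 s1.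
have -> : pd z1 d (phi t p) w = - sin t * z1 p - cos t * z2 p.
  have [_ <-] := D _ sz1.
  have -> : (fun s => z1 (phi s p)) = (fun s : R => z1 p * cos s + (- z2 p) * sin s).
    by apply/funext => s; rewrite (sr_z1_flow sr); ring.
  by have [_ ->] := is_derive_lincomb (z1 p) (- z2 p) c1 s1; ring.
have -> : pd z2 d (phi t p) w = cos t * z1 p - sin t * z2 p.
  have [_ <-] := D _ sz2.
  have -> : (fun s => z2 (phi s p)) = (fun s : R => z2 p * cos s + z1 p * sin s).
    by apply/funext => s; rewrite (sr_z2_flow sr); ring.
  by have [_ ->] := is_derive_lincomb (z2 p) (z1 p) c1 s1; ring.
move: (pd h d _ w) => H e.
rewrite mulrBl mul1r sinB cosB /w_re /w_im; move/eqP: e; rewrite addrC addr_eq0 => /eqP ->.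
ring.
Qed.

(** The integrated height equation, multiplied by (1 - k) n3 to keep it free of divisions: at a
    point with n3 = 0 it still constrains w. For k = 1 it is void, hence the separate [h_flow1]. *)
Lemma h_flow t p : (1 - k) * n3 p * h (phi t p) = (1 - k) * n3 p * h p +
  w_re p * (1 - cos ((1 - k) * t)) + w_im p * sin ((1 - k) * t).
Proof.
set m := 1 - k.
pose g (t : R) := m * n3 p * h (phi t p) + (w_re p * cos (m * t) + (- w_im p) * sin (m * t)).
have dg (s : R) : is_derive s (1 : R) g 0.
  have [H dH eH] := h_flow_derive s p; have [dc ds] := is_derive_trig m s.
  have := is_deriveD (is_deriveZ (m * n3 p) dH) (is_derive_lincomb (w_re p) (- w_im p) dc ds).
  move=> dd; apply: is_derive_eq dd _.
  rewrite (_ : (m * n3 p) *: H = m * (n3 p * H)); last by rewrite mulrA.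
  rewrite eH.
  by rewrite -/m; ring.
have := is_derive_0_is_cst t 0 dg; rewrite /g mulr0 cos0 sin0.
have [f0 _ _ _] := sr_flow sr; rewrite f0 => e.
by move: e; lra.
Qed.

Lemma h_flow1 t p : k = 1 -> n3 p * h (phi t p) = n3 p * h p + t * w_im p.
Proof.
move=> k1; pose g (t : R) := n3 p * h (phi t p) + (- w_im p) * t.
have dg (s : R) : is_derive s (1 : R) g 0.
  have [H dH eH] := h_flow_derive s p.
  have := is_derive_lincomb (n3 p) (- w_im p) dH (is_derive_id s (1 : R)).
  move=> dd; apply: is_derive_eq dd _; rewrite eH k1 subrr mul0r sin0 cos0; ring.
have := is_derive_0_is_cst t 0 dg; rewrite /g.
have [f0 _ _ _] := sr_flow sr; rewrite f0 => e.
by move: e; lra.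
Qed.

(** If z vanished on U, so would dz there. The single covector dh has a nonzero kernel vector
    ([kernel2] with a zero second covector), and on it dz and dh all vanish, against the immersion
    property. *)
Lemma dense_z_neq0 (U : set M) : open U -> U !=set0 ->
  exists2 p, U p & z1 p ^+ 2 + z2 p ^+ 2 != 0.
Proof.
move=> oU [p Up]; apply: contrapT => nz.
have z0 q : U q -> z1 q = 0 /\ z2 q = 0.
  move=> Uq; have e : z1 q ^+ 2 + z2 q ^+ 2 = 0.
    by apply: contrapT => /eqP e; apply: nz; exists q.
  have := sqr_ge0 (z1 q); have := sqr_ge0 (z2 q) => h2 h1.
  by split; apply/eqP; rewrite -sqrf_eq0; apply/eqP; lra.
have [c ac cp] := atlas_cover p.
have Z1 v : pd z1 c p v = 0 by apply: (pd_eq0_near _ oU Up cp) => q /z0[].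
have Z2 v : pd z2 c p v = 0 by apply: (pd_eq0_near _ oU Up cp) => q /z0[].
have [V V0 [Vh _]] := @kernel2 R 0 1 (pd h c p (e_ R 0)) (pd h c p (e_ R 1)) 0 0
  (or_intror (oner_neq0 _)) (ltac:(by ring)) (ltac:(by ring)).
move/eqP: V0; apply; apply: (sr_immersion sr ac cp) => //.
by rewrite pd_lin.
Qed.

End Flow.

(** * Local arguments: quotients by n3, locally constant functions, composition with the flow *)

Lemma Ck_local (R : realType) (V W : normedModType R) j (U : set V) (f : V -> W) :
  (forall x, U x -> exists U', [/\ U' x, open U' & Ck_on j U' f]) -> Ck_on j U f.
Proof.
elim: j f => [|j IH] f loc.
  split=> // x /loc[U' [U'x oU' kf]]; exact: (Ck_continuous kf).
split; first by move=> x /loc[U' [U'x oU' kf]]; exact: (Ck_continuous kf).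
split; first by move=> x v /loc[U' [U'x oU' kf]]; exact: (Ck_derivable kf).
by move=> v; apply: IH => x /loc[U' [U'x oU' kf]]; exists U'; split=> //; exact: Ck_derive.
Qed.

Section Cases.
Variables (R : realType) (M : manifold2 R).
Variables (phi : R -> M -> M) (k : R) (z1 z2 h n1 n2 n3 : M -> R).
Hypothesis sr : semirot phi k z1 z2 h n1 n2 n3.
Implicit Types (c : chart R M) (p : M).

Let sz1 := sr_z1_smooth sr.
Let sz2 := sr_z2_smooth sr.
Let sh := sr_h_smooth sr.
Let sn1 := sr_n1_smooth sr.
Let sn2 := sr_n2_smooth sr.
Let sn3 := sr_n3_smooth sr.
Local Notation Sn := (w_re z1 z2 n1 n2).
Local Notation Tn := (w_im z1 z2 n1 n2).

Lemma is_derive_quot (V : normedModType R) (f g : V -> R) (y v : V) (df dg : R) :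
  g y != 0 -> is_derive y v f df -> is_derive y v g dg ->
  is_derive y v (fun u => f u / g u) ((df * g y - f y * dg) / g y ^+ 2).
Proof.
move=> g0 Df Dg.
have Dv : is_derive y v (fun u => (g u)^-1) (- (g y) ^- 2 * dg).
  case: Dg => dg1 <-; split; first exact: derivableV.
  by rewrite deriveV.
by apply: is_derive_eq (is_derive_prod Df Dv) _; rewrite -exprVn; field.
Qed.

(** Only the existence of these derivatives matters; their values come later from comparing two
    formulas for the height along the flow. *)
Lemma is_pd_ST c p v : atlas c -> cdom c p -> n3 p != 0 ->
  (exists dS, is_derive (cmap c p) v (fun u => Sn (cinv c u) / n3 (cinv c u)) dS) /\
  (exists dT, is_derive (cmap c p) v (fun u => Tn (cinv c u) / n3 (cinv c u)) dT).
Proof.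
move=> ac cp n30.
have D f (sf : smooth_map f) := is_pd v sf ac cp.
have n30' : (n3 \o cinv c) (cmap c p) != 0 by rewrite /= cmapK.
split; eexists; apply: (is_derive_quot n30' _ (D _ sn3)).
- exact: (is_deriveD (is_derive_prod (D _ sz1) (D _ sn1)) (is_derive_prod (D _ sz2) (D _ sn2))).
- exact: (is_deriveB (is_derive_prod (D _ sz2) (D _ sn1)) (is_derive_prod (D _ sz1) (D _ sn2))).
Qed.

Lemma near_chart c p (P : M -> Prop) : cdom c p -> nbhs p P ->
  \forall u \near cmap c p, P (cinv c u).
Proof.
by move=> cp nP; apply: (cinv_continuous (cim_cmap cp)); rewrite cmapK.
Qed.

Lemma locally_constant_const (f : M -> R) : connected [set: M] -> smooth_map f ->
  (forall c p v, atlas c -> cdom c p -> pd f c p v = 0) -> forall p q, f p = f q.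
Proof.
move=> cM sf f0 p q.
have loc r : nbhs r [set s | f s = f r].
  have [c ac cr] := atlas_cover r.
  have [d d0 dP] := nbhs_ballR (nbhs_cim cr).
  have H u : `|u - cmap c r| < d -> f (cinv c u) = f r.
    move=> ud; set u0 := cmap c r; set w := u - u0.
    have uE : u = u0 + 1 *: w by rewrite scale1r addrC subrK.
    have din t : 0 <= t <= 1 -> cim c (u0 + (t * 1) *: w).
      move=> t01; apply: dP; rewrite mulr1; apply: ball_segment => //.
        by rewrite subrr normr0.
      by rewrite [u0 + w]addrC subrK.
    have [|t t01] := @MVT_line R _ (f \o cinv c) u0 w 1.
      by move=> t /din; apply: (Ck_derivable (sf c ac 1%N)).
    rewrite -uE; have := f0 c (cinv c (u0 + (t * 1) *: w)) w ac (cinv_dom (din t t01)).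
    rewrite /pd cinvK; last exact: din.
    by move=> ->; rewrite mulr0 /= cmapK // => /eqP; rewrite subr_eq0 => /eqP.
  have nc : nbhs r (cdom c) by apply: open_nbhs_nbhs; split=> //; exact: cdom_open.
  have nb : nbhs r (cmap c @^-1` [set u | `|u - cmap c r| < d]).
    apply: (cmap_continuous cr); have : nbhs (cmap c r) (ball (cmap c r) d).
      exact: nbhsx_ballx.
    by apply: filterS => u; rewrite -ball_normE /= distrC.
  by apply: filterS (filterI nc nb) => s [cs /H]; rewrite cmapK.
have oP (P : R -> Prop) : open [set r | P (f r)].
  rewrite openE => r Pr; apply: filterS (loc r) => s /= ->; exact: Pr.
have := cM [set r | f r = f q]; move=> /(_ _ _ _)/seteqP[] //.
- by exists q.
- by exists [set r | f r = f q]; [exact: (oP (fun y => y = f q))|rewrite setTI].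
- exists [set r | f r = f q]; last by rewrite setTI.
  have -> : [set r | f r = f q] = ~` [set r | f r <> f q].
    by apply/seteqP; split=> r /=; [move=> -> //|move=> /contrapT].
  by apply: open_closedC; exact: (oP (fun y => y <> f q)).
- by move=> _ /(_ p I).
Qed.

Lemma smooth_flow (f : M -> R) t : smooth_map f -> forall c p v, atlas c -> cdom c p ->
  derivable ((f \o phi t) \o cinv c) (cmap c p) v.
Proof.
move=> sf c p v ac cp; have [d [w [ad dp D]]] := flow_pd (sr_flow sr) t v ac cp.
by have [] := D _ sf.
Qed.

Lemma smooth_comp_flow (f : M -> R) t : smooth_map f -> smooth_map (f \o phi t).
Proof.
move=> sf c ac j; set g := (f \o phi t) \o cinv c.
have oU d : open [set u | cim c u /\ cdom d (phi t (cinv c u))].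
  have := @open_pullback _ _ c (phi t @^-1` cdom d); apply.
  by apply: open_comp; [move=> ? _; exact: (flow_continuous (sr_flow sr))|exact: cdom_open].
have loc d : atlas d -> Ck_on j [set u | cim c u /\ cdom d (phi t (cinv c u))] g.
  move=> ad; apply: (@eq_Ck_on _ _ _ _ _ ((f \o cinv d) \o (cmap d \o phi t \o cinv c))) => //.
    by move=> u [cu du] /=; rewrite cmapK.
  apply: (Ck_comp (W := cim d)) => //; first exact: open_cim.
  - by move=> u [cu du]; exact: cim_cmap.
  - exact: sf.
  - exact: (flow_smooth (sr_flow sr)).
apply: Ck_local => u cu; have [d ad du] := atlas_cover (phi t (cinv c u)).
exists [set u | cim c u /\ cdom d (phi t (cinv c u))]; split=> //; exact: loc.
Qed.

End Cases.

(** * The screw motion for k = 1 and the differential equations for k <> 1 *)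

Section Cases2.
Variables (R : realType) (M : manifold2 R).
Variables (phi : R -> M -> M) (k : R) (z1 z2 h n1 n2 n3 : M -> R).
Hypothesis sr : semirot phi k z1 z2 h n1 n2 n3.
Implicit Types (c : chart R M) (p : M).

Let sz1 := sr_z1_smooth sr.
Let sz2 := sr_z2_smooth sr.
Let sh := sr_h_smooth sr.
Let sn1 := sr_n1_smooth sr.
Let sn2 := sr_n2_smooth sr.
Let sn3 := sr_n3_smooth sr.
Local Notation Sn := (w_re z1 z2 n1 n2).
Local Notation Tn := (w_im z1 z2 n1 n2).

Lemma near_nonvertical p : n3 p != 0 -> \forall q \near p, n3 q != 0.
Proof. by move=> np; apply: open_nbhs_nbhs; split=> //; exact: open_neq0. Qed.

(* The rate of growth of the height is a C^1 function whose differential vanishes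
   where n3 <> 0, hence everywhere by density. *)
Lemma height_translation (c0 : k = 1) : connected [set: M] ->
  exists a, forall t p, h (phi t p) = h p + a * t.
Proof.
move=> cM.
(* The height gained in unit time. Where n3 <> 0 it is the rate of growth [Tn p / n3 p], but unlike
   that quotient it is smooth on all of M. *)
pose G p := (h \o phi 1) p + (-1) * h p.
have sG : smooth_map G.
  move=> c ac j; apply: (Ck_add (@open_cim _ _ c) (f := (h \o phi 1) \o cinv c)
    (g := fun u => (-1) * (h \o cinv c) u)); first exact: (smooth_comp_flow sr 1 sh).
  by apply: Ck_mul; [exact: open_cim|apply: Ck_cst; exact: open_cim|exact: sh].
have GT p : n3 p != 0 -> G p = Tn p / n3 p.
  by move=> np; have := h_flow1 sr 1 p c0; rewrite /G /= => e; apply: (mulfI np);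
    rewrite mulrCA divff // mulr1 mulrDr e; ring.
have pdG c p v : atlas c -> cdom c p -> n3 p != 0 -> pd G c p v = 0.
  move=> ac cp np; have [_ [dT DT]] := is_pd_ST sr v ac cp np.
  have [_ EG] : is_derive (cmap c p) v (G \o cinv c) dT.
    apply: near_eq_is_derive DT.
    by apply: filterS (near_chart cp (near_nonvertical np)) => u nu; rewrite /= GT.
  have D1 := tangent_flow sr 1 v ac cp; have D0 := tangent_flow sr 0 v ac cp.
  rewrite (pd_z1_flow sr) // (pd_z2_flow sr) // (sr_n1_flow sr) (sr_n2_flow sr) (sr_n3_flow sr) in D1 D0.
  have := sr_tangent sr v ac cp.
  have -> : pd G c p v = pd (h \o phi 1) c p v - pd h c p v.
    rewrite /pd; have dh1 := derivableP (smooth_flow (t := 1) (v := v) sr sh ac cp).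
    have := is_derive_lincomb 1 (-1) dh1 (is_pd v sh ac cp).
    have -> : (fun u => 1 * ((h \o phi 1) \o cinv c) u + -1 * (h \o cinv c) u) = G \o cinv c.
      by apply/funext => u; rewrite /G /= mul1r.
    by move=> [_ ->]; rewrite mul1r mulN1r.
  move: (pd (h \o phi 1) c p v) (pd h c p v) (pd z1 c p v) (pd z2 c p v) D1 => H1 H Z1 Z2.
  rewrite c0 !mul1r => D1 D2; apply: (mulfI np); rewrite mulr0.
  (* Since k = 1, the horizontal parts of the normal and of the tangent vector turn by the same
     angle and their product is unchanged. The tangency relations at p and at [phi 1 p] then differ
     only in their height terms. *)
  have e : (cos 1 * n1 p - sin 1 * n2 p) * (cos 1 * Z1 - sin 1 * Z2) +
      (sin 1 * n1 p + cos 1 * n2 p) * (sin 1 * Z1 + cos 1 * Z2) = n1 p * Z1 + n2 p * Z2.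
    transitivity ((cos 1 ^+ 2 + sin 1 ^+ 2) * (n1 p * Z1 + n2 p * Z2)); first by ring.
    by rewrite cos2Dsin2 mul1r.
  by move: D1; rewrite e; move: D2; lra.
have pdG0 c p v : atlas c -> cdom c p -> pd G c p v = 0.
  move=> ac cp; apply: contrapT => /eqP nG.
  have kD := Ck_derive v (sG c ac 1%N).
  have cD := Ck_continuous kD (cim_cmap cp).
  have nU : \forall u \near cmap c p, 'D_v (G \o cinv c) u != 0.
    apply: (cD [set y | y != 0]); apply: open_nbhs_nbhs; split=> //; exact: open_neq.
  have [U UO [Up U0]] : exists2 U, open U & U (cmap c p) /\ forall u, U u -> 'D_v (G \o cinv c) u != 0.
    exists [set u | 'D_v (G \o cinv c) u != 0]^°; first exact: open_interior.
    by split=> // u /interior_subset.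
  have oV := open_pushforward c UO.
  have [|q [cq Uq] nq] := sr_nonvertical sr oV; first by exists p.
  by have := U0 _ Uq; rewrite -/(pd G c q v) pdG // eqxx.
have [neM|eM] := pselect ([set: M] !=set0); last first.
  by exists 0 => t p; case: eM; exists p.
have [p0 _ np0] := sr_nonvertical sr openT neM.
exists (G p0) => t p.
have GE q : G q = G p0 := locally_constant_const cM sG pdG0 q p0.
have E q : n3 q != 0 -> h (phi t q) = h q + G p0 * t.
  move=> nq; rewrite -(GE q) GT //; have := h_flow1 sr t q c0 => e.
  by apply: (mulfI nq); rewrite e /w_im; field.
apply: contrapT => /eqP nE.
(* The formula [E] extends to points with n3 = 0 by density: if F were nonzero at p, it would be so
   on an open set, which contains a point with n3 <> 0. *)
pose F q := (h \o phi t) q + (-1) * h q + - (G p0 * t).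
have sF : smooth_map F.
  move=> c ac j; have oc := @open_cim _ _ c.
  apply: (Ck_add oc (f := fun u => ((h \o phi t) \o cinv c) u + (-1) * (h \o cinv c) u)
    (g := fun u => - (G p0 * t))); last exact: Ck_cst.
  apply: (Ck_add oc (f := (h \o phi t) \o cinv c)
    (g := fun u => (-1) * (h \o cinv c) u)); first exact: (smooth_comp_flow sr t sh).
  by apply: Ck_mul; [|apply: Ck_cst|exact: sh].
have Fp : F p != 0 by rewrite /F /= mulN1r -addrA -opprD subr_eq0.
have [|q Fq nq] := sr_nonvertical sr (open_neq0 sF); first by exists p.
by move/eqP: Fq; apply; rewrite /F /= E //; ring.
Qed.

Local Notation m := (1 - k).

(** The differential of h composed with the flow is computed twice: by differentiating [h_flow],
    with unknown derivatives dS and dT, and from the tangency relation at the moved point. Both are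
    combinations of 1, cos (m t) and sin (m t), and equating coefficients gives dS, dT and dh. *)
Lemma semirot_ode c p v : m != 0 -> atlas c -> cdom c p -> n3 p != 0 ->
  [/\ is_derive (cmap c p) v (fun u => Sn (cinv c u) / n3 (cinv c u))
        (m * ((n1 p * pd z1 c p v + n2 p * pd z2 c p v) / n3 p)),
      is_derive (cmap c p) v (fun u => Tn (cinv c u) / n3 (cinv c u))
        (m * ((n1 p * pd z2 c p v - n2 p * pd z1 c p v) / n3 p))
    & pd h c p v = - ((n1 p * pd z1 c p v + n2 p * pd z2 c p v) / n3 p)].
Proof.
move=> m0 ac cp np; have [[dS DS] [dT DT]] := is_pd_ST sr v ac cp np.
have D0 := sr_tangent sr v ac cp.
have D t : n3 p * (m * pd (h \o phi t) c p v) = n3 p * (m * pd h c p v +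
   (1 - cos (m * t)) * dS + sin (m * t) * dT).
  congr (_ * _).
  have := is_derive_lincomb (1 - cos (m * t)) (sin (m * t)) DS DT => DST.
  have Dh := is_deriveZ m (is_pd v sh ac cp).
  have DD := is_deriveD Dh DST.
  have := derivableP (smooth_flow (t := t) (v := v) sr sh ac cp) => /(is_deriveZ m) [_ E1].
  have [_ E2] := DD.
  rewrite -addrA -[RHS]E2 -[LHS]E1; apply: near_eq_derive.
  apply: filterS (near_chart cp (near_nonvertical np)) => u nu.
  have := h_flow sr t (cinv c u) => e.
  apply: (mulfI nu); transitivity (m * n3 (cinv c u) * h (phi t (cinv c u))).
    by rewrite mulrCA mulrA.
  rewrite e; transitivity (n3 (cinv c u) * (m * h (cinv c u) +
      ((1 - cos (m * t)) * (Sn (cinv c u) / n3 (cinv c u)) +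
       sin (m * t) * (Tn (cinv c u) / n3 (cinv c u))))); last by [].
  by field.
(* The tangent vector turns by t and the normal by k t, so conj(nu) dz is multiplied by e^{i m t};
   its real part enters here. *)
have A t : cos (m * t) * (n1 p * pd z1 c p v + n2 p * pd z2 c p v)
    - sin (m * t) * (n1 p * pd z2 c p v - n2 p * pd z1 c p v)
    + n3 p * pd (h \o phi t) c p v = 0.
  have := tangent_flow sr t v ac cp.
  rewrite (pd_z1_flow sr) // (pd_z2_flow sr) // (sr_n1_flow sr) (sr_n2_flow sr) (sr_n3_flow sr).
  move=> <-; rewrite mulrBl mul1r cosB sinB; ring.
have mpi : m * (pi / m) = pi by field.
have mpi2 : m * (pi / 2 / m) = pi / 2 by field.
(* Together with t = 0, the times at which m t is pi or pi / 2 separate the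
   coefficients of 1, cos (m t) and sin (m t). *)
have A1 := A (pi / m); have A2 := A (pi / 2 / m).
have E1 := D (pi / m); have E2 := D (pi / 2 / m).
rewrite mpi cospi sinpi in A1 E1; rewrite mpi2 cos_pihalf sin_pihalf in A2 E2.
move: DS DT D0 A1 A2 E1 E2 {A D mpi mpi2}.
move: (pd (h \o phi _) c p v) (pd (h \o phi _) c p v) (pd h c p v) => H2 H1 H.
move: (pd z1 c p v) (pd z2 c p v) => Z1 Z2 DS DT D0 A1 A2 E1 E2.
have eH : H = - ((n1 p * Z1 + n2 p * Z2) / n3 p).
  by apply: (mulfI np); rewrite mulrN mulrCA divff // mulr1; lra.
have eS : dS = m * ((n1 p * Z1 + n2 p * Z2) / n3 p).
  apply: (mulfI np); rewrite mulrCA [n3 p * (_ / _)]mulrCA divff // mulr1.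
  have : m * (n3 p * H1) = m * (n1 p * Z1 + n2 p * Z2) by congr (_ * _); lra.
  have : m * (n3 p * H) = - (m * (n1 p * Z1 + n2 p * Z2)).
    by rewrite -mulrN; congr (_ * _); lra.
  by move: E1; lra.
have eT : dT = m * ((n1 p * Z2 - n2 p * Z1) / n3 p).
  apply: (mulfI np); rewrite mulrCA [n3 p * (_ / _)]mulrCA divff // mulr1.
  have : m * (n3 p * H2) = m * (n1 p * Z2 - n2 p * Z1) by congr (_ * _); lra.
  have : m * (n3 p * H) = - (m * (n1 p * Z1 + n2 p * Z2)).
    by rewrite -mulrN; congr (_ * _); lra.
  have : n3 p * dS = m * (n1 p * Z1 + n2 p * Z2).
    by rewrite eS mulrCA [n3 p * (_ / _)]mulrCA divff // mulr1.
  by move: E2; lra.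
by rewrite -eS -eT.
Qed.

End Cases2.

(** * Excluding k = 0 and points with n3 = 0 *)

Section Cases3.
Variables (R : realType) (M : manifold2 R).
Variables (phi : R -> M -> M) (k : R) (z1 z2 h n1 n2 n3 : M -> R).
Hypothesis sr : semirot phi k z1 z2 h n1 n2 n3.
Implicit Types (c : chart R M) (p : M).

Let sz1 := sr_z1_smooth sr.
Let sz2 := sr_z2_smooth sr.
Let sh := sr_h_smooth sr.
Let sn1 := sr_n1_smooth sr.
Let sn2 := sr_n2_smooth sr.
Let sn3 := sr_n3_smooth sr.
Local Notation Sn := (w_re z1 z2 n1 n2).
Local Notation Tn := (w_im z1 z2 n1 n2).
Local Notation m := (1 - k).

Lemma is_derive_unique (V : normedModType R) (f : V -> R) (y v : V) (a b : R) :
  is_derive y v f a -> is_derive y v f b -> a = b.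
Proof. by move=> [_ <-] [_ <-]. Qed.

(* For k = 0 the equation d(zeta z) = zeta dz makes zeta locally constant. *)
Lemma rotation_rate_neq0 : [set: M] !=set0 -> k != 0.
Proof.
move=> neM; apply/eqP => k0; have m0 : m != 0 by rewrite k0 subr0 oner_neq0.
pose U := [set p | n3 p != 0] `&` [set p | z1 p ^+ 2 + z2 p ^+ 2 != 0].
have oU : open U.
  apply: openI; first exact: open_neq0.
  apply: (open_neq0 (f := fun p => z1 p ^+ 2 + z2 p ^+ 2)) => c ac j.
  have oc := @open_cim _ _ c.
  by apply: (Ck_add oc (f := fun u => z1 (cinv c u) ^+ 2) (g := fun u => z2 (cinv c u) ^+ 2));
    apply: Ck_mul => //; [exact: sz1|exact: sz1|exact: sz2|exact: sz2].
have neU : U !=set0.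
  have [p _ np] := sr_nonvertical sr openT neM.
  have [|q nq zq] := dense_z_neq0 sr (open_neq0 sn3); first by exists p.
  by exists q.
apply: (sr_nonflat sr oU neU) => p c v [np zp] ac cp.
have [DS DT _] := semirot_ode sr v m0 ac cp np.
have np' : (n3 \o cinv c) (cmap c p) != 0 by rewrite /= cmapK.
have D f (sf : smooth_map f) := is_pd v sf ac cp.
have Q1 := is_derive_quot np' (D _ sn1) (D _ sn3).
have Q2 := is_derive_quot np' (D _ sn2) (D _ sn3).
have e1 := is_derive_unique DS.
have e2 := is_derive_unique DT.
move: (is_deriveD (is_derive_prod (D _ sz1) Q1) (is_derive_prod (D _ sz2) Q2)) => H1.
move: (is_deriveB (is_derive_prod (D _ sz2) Q1) (is_derive_prod (D _ sz1) Q2)) => H2.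
have {}e1 := e1 _ (near_eq_is_derive _ H1).
have {}e2 := e2 _ (near_eq_is_derive _ H2).
move: e1 e2; rewrite /= cmapK // k0 subr0 !mul1r.
move: (pd z1 c p v) (pd z2 c p v) (pd n1 c p v) (pd n2 c p v) (pd n3 c p v).
move=> Z1 Z2 a1 a2 a3 e1 e2.
have {}e1 := e1 _; have {}e2 := e2 _.
(* [b1 - i b2] is the derivative of zeta. Comparing Leibniz' rule for zeta z with the equation for m
   = 1 leaves z dzeta = 0, whose real and imaginary parts are [f1] and [f2]; multiplication by
   conj(z) gives b1 = b2 = 0. *)
set b1 := (a1 * n3 p - n1 p * a3) / n3 p ^+ 2 in e1 e2.
set b2 := (a2 * n3 p - n2 p * a3) / n3 p ^+ 2 in e1 e2.
have f1 : z1 p * b1 + z2 p * b2 = 0.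
  have := e1; rewrite mulrDl => {}e1.
  have : (n1 p * Z1 / n3 p + n2 p * Z2 / n3 p) =
      z1 p * b1 + n1 p / n3 p * Z1 + (z2 p * b2 + n2 p / n3 p * Z2).
    by apply: e1; near=> u; rewrite !fctE /= /w_re; ring.
  by rewrite ![_ / _ * _]mulrAC; lra.
have f2 : z2 p * b1 - z1 p * b2 = 0.
  have : (n1 p * Z2 / n3 p - n2 p * Z1 / n3 p) =
      z2 p * b1 + n1 p / n3 p * Z2 - (z1 p * b2 + n2 p / n3 p * Z1).
    by rewrite -mulrBl; apply: e2; near=> u; rewrite !fctE /= /w_im; ring.
  by rewrite ![_ / _ * _]mulrAC; lra.
have g1 : b1 = 0.
  apply: (mulfI zp); rewrite mulr0.
  rewrite (_ : _ * b1 = z1 p * (z1 p * b1 + z2 p * b2) + z2 p * (z2 p * b1 - z1 p * b2)); last by ring.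
  by rewrite f1 f2; ring.
have g2 : b2 = 0.
  apply: (mulfI zp); rewrite mulr0.
  rewrite (_ : _ * b2 = z2 p * (z1 p * b1 + z2 p * b2) - z1 p * (z2 p * b1 - z1 p * b2)); last by ring.
  by rewrite f1 f2; ring.
(* With the derivatives of n1 / n3 and n2 / n3 zero, the derivative of n is the multiple (a3 / n3)
   of n: the situation excluded by [sr_nonflat]. *)
have solve a nn : (a * n3 p - nn * a3) / n3 p ^+ 2 = 0 -> a = a3 / n3 p * nn.
  move=> /eqP; rewrite mulf_eq0 invr_eq0 sqrf_eq0 (negbTE np) orbF subr_eq0 => /eqP e.
  by apply: (mulIf np); rewrite e; field.
exists (a3 / n3 p); split; [exact: solve|exact: solve|by field].
Unshelve. all: by end_near. Qed.

(* At a point with n3 = 0 the height equation forces w = 0, hence z = 0 on the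
   orbit. The height is periodic along the orbit, so by Rolle's theorem it has a
   stationary point; there the flow has zero velocity, although it rotates the
   horizontal normal at the rate k <> 0. *)
Lemma normal_nonvertical : k != 1 -> forall p, n3 p != 0.
Proof.
move=> k1 p0; apply/eqP => np0.
have m0 : m != 0 by rewrite subr_eq0 eq_sym.
have k0 : k != 0 by apply: rotation_rate_neq0; exists p0.
have mpi : m * (pi / m) = pi by field.
have mpi2 : m * (pi / 2 / m) = pi / 2 by field.
(* With n3 = 0 only the w terms of [h_flow] remain: m t = pi gives 2 w_re = 0, and m t = pi / 2
   gives w_re + w_im = 0. *)
have := h_flow sr (pi / m) p0; have := h_flow sr (pi / 2 / m) p0.
rewrite np0 mpi mpi2 cospi sinpi cos_pihalf sin_pihalf => e2 e1.
have S0 : Sn p0 = 0 by lra.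
have T0 : Tn p0 = 0 by lra.
have := sr_unit sr p0; rewrite np0 => nn.
have zz : z1 p0 ^+ 2 + z2 p0 ^+ 2 = 0.
  have : Sn p0 ^+ 2 + Tn p0 ^+ 2 = (z1 p0 ^+ 2 + z2 p0 ^+ 2) * (n1 p0 ^+ 2 + n2 p0 ^+ 2).
    by rewrite /w_re /w_im; ring.
  rewrite S0 T0 (_ : n1 p0 ^+ 2 + _ = 1); last by lra.
  by lra.
have z10 : z1 p0 = 0.
  by apply/eqP; rewrite -sqrf_eq0; apply/eqP; have := sqr_ge0 (z1 p0); have := sqr_ge0 (z2 p0); lra.
have z20 : z2 p0 = 0.
  by apply/eqP; rewrite -sqrf_eq0; apply/eqP; have := sqr_ge0 (z1 p0); have := sqr_ge0 (z2 p0); lra.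
have mt0 : 0 < `|m| by rewrite normr_gt0.
pose tau := (pi *+ 2) / `|m|.
have tau0 : 0 < tau by rewrite divr_gt0 // mulrn_wgt0 // pi_gt0.
have per p : n3 p != 0 -> h (phi tau p) = h p.
  move=> np; have := h_flow sr tau p.
  have [-> ->] : cos (m * tau) = 1 /\ sin (m * tau) = 0.
    have [mpos|mneg] := ltP 0 m.
      have -> : m * tau = pi *+ 2 by rewrite /tau gtr0_norm //; field.
      by rewrite cos2pi sin2pi.
    have -> : m * tau = - (pi *+ 2).
      by rewrite /tau ler0_norm //; field.
    by rewrite cosN sinN cos2pi sin2pi oppr0.
  by rewrite subrr !mulr0 !addr0 => /(mulfI (mulf_neq0 m0 np)).
(* At p0 itself [h_flow] does not determine the height, as n3 = 0; periodicity with period [tau] is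
   inherited by density from the points with n3 <> 0. *)
have per0 : h (phi tau p0) = h p0.
  apply: contrapT => /eqP ne.
  pose F q := (h \o phi tau) q + (-1) * h q.
  have sF : smooth_map F.
    move=> c ac j; have oc := @open_cim _ _ c.
    apply: (Ck_add oc (f := (h \o phi tau) \o cinv c)
      (g := fun u => (-1) * (h \o cinv c) u)); first exact: (smooth_comp_flow sr tau sh).
    by apply: Ck_mul; [|apply: Ck_cst|exact: sh].
  have Fp : F p0 != 0 by rewrite /F /= mulN1r subr_eq0.
  have [|q Fq nq] := sr_nonvertical sr (open_neq0 sF); first by exists p0.
  by move/eqP: Fq; apply; rewrite /F /= per //; ring.
have dh t : derivable (fun s => h (phi s p0)) t 1.
  by have [H [dH _] _] := h_flow_derive sr t p0.
have [|||t _ [_ Dt]] := @Rolle R (fun s => h (phi s p0)) 0 tau tau0.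
- by move=> t _; exact: dh.
- by apply: derivable_within_continuous => t _; exact: dh.
- by have [-> _ _ _] := sr_flow sr; rewrite per0.
have [d [w [ad dp D]]] := flow_time_derive (sr_flow sr) t p0.
have w0 : w = 0.
  apply: (sr_immersion sr ad dp).
  - have [_ <-] := D _ sz1; rewrite (_ : (fun s => _) = cst 0) ?derive_cst //.
    by apply/funext => s; rewrite (sr_z1_flow sr) z10 z20 /=; ring.
  - have [_ <-] := D _ sz2; rewrite (_ : (fun s => _) = cst 0) ?derive_cst //.
    by apply/funext => s; rewrite (sr_z2_flow sr) z10 z20 /=; ring.
  - by have [_ <-] := D _ sh.
rewrite w0 in D; have [dc ds] := is_derive_trig k t.
have E1 : k * (cos (k * t) * n2 p0 + sin (k * t) * n1 p0) = 0.
  have H := is_derive_lincomb (n1 p0) (- n2 p0) dc ds.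
  have := D _ sn1; rewrite /pd derive0.
  rewrite (_ : (fun s => n1 _) = fun s => n1 p0 * cos (k * s) + - n2 p0 * sin (k * s)).
    by move=> /(is_derive_unique H); lra.
  by apply/funext => s; rewrite (sr_n1_flow sr); ring.
have E2 : k * (cos (k * t) * n1 p0 - sin (k * t) * n2 p0) = 0.
  have H := is_derive_lincomb (n2 p0) (n1 p0) dc ds.
  have := D _ sn2; rewrite /pd derive0.
  rewrite (_ : (fun s => n2 _) = fun s => n2 p0 * cos (k * s) + n1 p0 * sin (k * s)).
    by move=> /(is_derive_unique H); lra.
  by apply/funext => s; rewrite (sr_n2_flow sr); ring.
move/eqP: E1; rewrite mulf_eq0 (negbTE k0) => /eqP E1.
move/eqP: E2; rewrite mulf_eq0 (negbTE k0) => /eqP E2.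
have := cos2Dsin2 (k * t); move: (cos (k * t)) (sin (k * t)) E1 E2 => C s E1 E2 cs.
have : (C ^+ 2 + s ^+ 2) * (n1 p0 ^+ 2 + n2 p0 ^+ 2) = 1 by rewrite cs; lra.
have -> : (C ^+ 2 + s ^+ 2) * (n1 p0 ^+ 2 + n2 p0 ^+ 2) =
  (C * n2 p0 + s * n1 p0) ^+ 2 + (C * n1 p0 - s * n2 p0) ^+ 2 by ring.
by rewrite E1 E2 expr0n addr0 => /esym/eqP; rewrite oner_eq0.
Qed.

End Cases3.

(** * The planar system in polar coordinates *)

Section PlanarSystem.
Variable R : realType.

Definition polar (u : 'rV[R]_2) : 'rV[R]_2 := vec2 (u 0 0 * cos (u 0 1)) (u 0 0 * sin (u 0 1)).

(* In the coordinate z on the surface, [p - i q] is zeta and [s + i tau] is zeta z;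
   the equations say d(zeta z) = m zeta dz and dh = - Re(zeta dz). *)
Record planar (m : R) (B : set 'rV[R]_2) (p q s tau hh : 'rV[R]_2 -> R) : Prop := Planar {
  pl_open : open B;
  pl_s_C1 : Ck_on 1 B s;
  pl_tau_C1 : Ck_on 1 B tau;
  pl_h_C1 : Ck_on 1 B hh;
  pl_ds : forall y v, B y -> 'D_v s y = m * (p y * v 0 0 + q y * v 0 1);
  pl_dtau : forall y v, B y -> 'D_v tau y = m * (p y * v 0 1 - q y * v 0 0);
  pl_dh : forall y v, B y -> 'D_v hh y = - (p y * v 0 0 + q y * v 0 1);
  pl_s : forall y, B y -> s y = y 0 0 * p y + y 0 1 * q y;
  pl_tau : forall y, B y -> tau y = y 0 1 * p y - y 0 0 * q y }.

Lemma is_derive_comp_plane (B : set 'rV[R]_2) (f : 'rV[R]_2 -> R) (g : R -> 'rV[R]_2) t w :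
  open B -> Ck_on 1 B f -> B (g t) -> is_derive t (1 : R) g w ->
  is_derive t (1 : R) (fun x => f (g x)) ('D_w f (g t)).
Proof.
move=> oB f1 Bt dg; have [_ ->] := C1_diff oB Bt f1.
exact: (is_derive_comp2 oB Bt f1 dg).
Qed.

Lemma is_derive_mull (V : normedModType R) (f : V -> R) (x v : V) (r df : R) :
  is_derive x v f df -> is_derive x v (fun y => r * f y) (r * df).
Proof. by move=> df'; exact: (is_deriveZ r df'). Qed.

Lemma constant_on_interval (I : set R) (f : R -> R) : is_interval I ->
  (forall x, I x -> is_derive x (1 : R) f 0) -> forall x y, I x -> I y -> f x = f y.
Proof.
move=> iI df.
have H x y : x <= y -> I x -> I y -> f x = f y.
  move=> xy Ix Iy; have Iz z : x <= z <= y -> I z by apply: iI.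
  have [||z _ e] := @MVT_segment R f (fun _ => 0) x y xy.
  - by move=> z; rewrite in_itv /= => /andP[xz zy]; apply: df; apply: Iz; rewrite !ltW.
  - apply: derivable_within_continuous => z; rewrite in_itv /= => /Iz Izz.
    by have [] := df z Izz.
  by move: e; rewrite mul0r => /eqP; rewrite subr_eq0 => /eqP.
by move=> x y Ix Iy; have [xy|/ltW yx] := leP x y; [exact: H|apply/esym; exact: H].
Qed.

Variables (m : R) (B : set 'rV[R]_2) (p q s tau hh : 'rV[R]_2 -> R).
Hypothesis m0 : m != 0.
Hypothesis pl : planar m B p q s tau hh.
Variables (I J : set R).
Hypotheses (iI : is_interval I) (iJ : is_interval J).
Hypothesis I0 : forall r, I r -> 0 < r.
Hypothesis IJB : forall r t, I r -> J t -> B (polar (vec2 r t)).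
Local Notation P r t := (polar (vec2 r t)).

Let dPr (r t : R) : is_derive r (1 : R) (fun r => P r t) (vec2 (cos t) (sin t)).
Proof.
have -> : (fun r => P r t) = (fun r => vec2 (cos t * r) (sin t * r)).
  by apply/funext => x; rewrite /polar !vec2E mulrC [sin t * x]mulrC.
have d (a : R) : is_derive r (1 : R) (fun x : R => a * x) a.
  rewrite (_ : (fun s => a * s) = a *: id) //.
  by apply: is_derive_eq; rewrite [_ *: 1]mulr1.
exact: is_derive_vec2.
Qed.

Let dPt (r t : R) : is_derive t (1 : R) (fun t => P r t) (vec2 (- (r * sin t)) (r * cos t)).
Proof.
have -> : (fun t => P r t) = (fun t => vec2 (r * cos t) (r * sin t)).
  by apply/funext => x; rewrite /polar !vec2E.
apply: is_derive_vec2.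
  by apply: is_derive_eq (is_derive_mull r (is_derive_cos t)) _; rewrite mulrN.
Qed.

(** In polar coordinates W = s + i tau satisfies r dW/dr = m W and dW/dt = i m W, so r^(-m) e^{-i m
    t} W is constant on the rectangle I x J, with real part C1 and imaginary part C2; m hh + s is
    constant as well. Only I x J has to be a rectangle, not its image: J may be the whole line, so
    that the angle winds around the origin. *)
Lemma polar_solution : exists C1 C2 h0, forall r t, I r -> J t ->
  [/\ s (P r t) = r `^ m * (C1 * cos (m * t) - C2 * sin (m * t)),
      tau (P r t) = r `^ m * (C1 * sin (m * t) + C2 * cos (m * t))
    & hh (P r t) = h0 - s (P r t) / m].
Proof.
have oB := pl_open pl.
have sr r t : I r -> J t -> is_derive r (1 : R) (fun r => s (P r t)) (m * s (P r t) / r).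
  move=> Ir Jt; have Bp := IJB Ir Jt; have r0 := I0 Ir.
  apply: is_derive_eq (is_derive_comp_plane (g := fun r => P r t) oB (pl_s_C1 pl) Bp (dPr r t)) _.
  rewrite (pl_ds pl) // (pl_s pl) // !vec2E; move: (p _) (q _) => p' q'.
  by field; rewrite gt_eqF.
have st r t : I r -> J t -> is_derive t (1 : R) (fun t => s (P r t)) (- (m * tau (P r t))).
  move=> Ir Jt; have Bp := IJB Ir Jt.
  apply: is_derive_eq (is_derive_comp_plane (g := fun t => P r t) oB (pl_s_C1 pl) Bp (dPt r t)) _.
  rewrite (pl_ds pl) // (pl_tau pl) // !vec2E; ring.
have tr r t : I r -> J t -> is_derive r (1 : R) (fun r => tau (P r t)) (m * tau (P r t) / r).
  move=> Ir Jt; have Bp := IJB Ir Jt; have r0 := I0 Ir.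
  apply: is_derive_eq (is_derive_comp_plane (g := fun r => P r t) oB (pl_tau_C1 pl) Bp (dPr r t)) _.
  rewrite (pl_dtau pl) // (pl_tau pl) // !vec2E; move: (p _) (q _) => p' q'.
  by field; rewrite gt_eqF.
have tt r t : I r -> J t -> is_derive t (1 : R) (fun t => tau (P r t)) (m * s (P r t)).
  move=> Ir Jt; have Bp := IJB Ir Jt.
  apply: is_derive_eq (is_derive_comp_plane (g := fun t => P r t) oB (pl_tau_C1 pl) Bp (dPt r t)) _.
  rewrite (pl_dtau pl) // (pl_s pl) // !vec2E; ring.
have hr r t : I r -> J t -> is_derive r (1 : R) (fun r => m * hh (P r t)) (- (m * s (P r t) / r)).
  move=> Ir Jt; have Bp := IJB Ir Jt; have r0 := I0 Ir.
  apply: is_derive_eq (is_derive_mull m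
    (is_derive_comp_plane (g := fun r => P r t) oB (pl_h_C1 pl) Bp (dPr r t))) _.
  rewrite (pl_dh pl) // (pl_s pl) // !vec2E; move: (p _) (q _) => p' q'.
  by field; rewrite gt_eqF.
have ht r t : I r -> J t -> is_derive t (1 : R) (fun t => m * hh (P r t)) (m * tau (P r t)).
  move=> Ir Jt; have Bp := IJB Ir Jt.
  apply: is_derive_eq (is_derive_mull m
    (is_derive_comp_plane (g := fun t => P r t) oB (pl_h_C1 pl) Bp (dPt r t))) _.
  rewrite (pl_dh pl) // (pl_tau pl) // !vec2E; move: (p _) (q _) => p' q'.
  by ring.
have const (f : R -> R -> R) :
    (forall r t, I r -> J t -> is_derive r (1 : R) (fun r => f r t) 0) ->
    (forall r t, I r -> J t -> is_derive t (1 : R) (fun t => f r t) 0) ->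
    exists C, forall r t, I r -> J t -> f r t = C.
  move=> fr ft; have [[r0 [t0 [Ir0 Jt0]]]|ne] := pselect (exists r0 t0, I r0 /\ J t0).
    exists (f r0 t0) => r t Ir Jt.
    rewrite (@constant_on_interval _ (f^~ t) iI (fun r Ir => fr r t Ir Jt) r r0) //.
    exact: (@constant_on_interval _ (f r0) iJ (fun t Jt => ft r0 t Ir0 Jt) t t0).
  by exists 0 => r t Ir Jt; case: ne; exists r, t.
have powE r : I r -> (- m) * r `^ (- m - 1) = - m * r `^ (- m) / r.
  move=> Ir; have r0 := I0 Ir; rewrite powRB ?powRr1 ?ltW //; first by ring.
  by rewrite (gt_eqF r0) implybT.
have dpow r : I r -> is_derive r (1 : R) (fun r => r `^ (- m)) (- m * r `^ (- m) / r).
  by move=> Ir; rewrite -powE //; exact: is_derive1_powR (I0 Ir).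
have [C1 C1E] : exists C, forall r t, I r -> J t ->
    r `^ (- m) * (cos (m * t) * s (P r t) + sin (m * t) * tau (P r t)) = C.
  apply: const => r t Ir Jt; have r0 := I0 Ir.
    apply: is_derive_eq (is_derive_prod (dpow r Ir)
      (is_derive_lincomb (cos (m * t)) (sin (m * t)) (sr r t Ir Jt) (tr r t Ir Jt))) _.
    by move: (_ `^ _) (s _) (tau _) => X s' t'; field; rewrite gt_eqF.
  have [dc ds] := is_derive_trig m t.
  have D := is_deriveD (is_derive_prod dc (st r t Ir Jt)) (is_derive_prod ds (tt r t Ir Jt)).
  apply: is_derive_eq (is_derive_mull (r `^ (- m)) D) _.
  by move: (_ `^ _) (s _) (tau _) => X s' t'; ring.
have [C2 C2E] : exists C, forall r t, I r -> J t ->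
    r `^ (- m) * (cos (m * t) * tau (P r t) + (- sin (m * t)) * s (P r t)) = C.
  apply: const => r t Ir Jt; have r0 := I0 Ir.
    apply: is_derive_eq (is_derive_prod (dpow r Ir)
      (is_derive_lincomb (cos (m * t)) (- sin (m * t)) (tr r t Ir Jt) (sr r t Ir Jt))) _.
    by move: (_ `^ _) (s _) (tau _) => X s' t'; field; rewrite gt_eqF.
  have [dc ds] := is_derive_trig m t.
  have D := is_deriveD (is_derive_prod dc (tt r t Ir Jt))
     (is_derive_prod (is_deriveN ds) (st r t Ir Jt)).
  apply: is_derive_eq (is_derive_mull (r `^ (- m)) D) _.
  by rewrite fctE; move: (_ `^ _) (s _) (tau _) => X s' t'; ring.
have [C3 C3E] : exists C, forall r t, I r -> J t -> m * hh (P r t) + s (P r t) = C.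
  apply: const => r t Ir Jt; have r0 := I0 Ir.
    by apply: is_derive_eq (is_deriveD (hr r t Ir Jt) (sr r t Ir Jt)) _; rewrite addNr.
  by apply: is_derive_eq (is_deriveD (ht r t Ir Jt) (st r t Ir Jt)) _; rewrite subrr.
exists C1, C2, (C3 / m) => r t Ir Jt; have r0 := I0 Ir.
have rm0 : r `^ m != 0 by rewrite gt_eqF // powR_gt0.
have cs := cos2Dsin2 (m * t).
rewrite -(C1E _ _ Ir Jt) -(C2E _ _ Ir Jt) -(C3E _ _ Ir Jt) powRN.
move: (s _) (tau _) (hh _) (cos (m * t)) (sin (m * t)) cs => s' t' h' C S cs; split.
- rewrite -[LHS]mul1r -cs; by field.
- rewrite -[LHS]mul1r -cs; by field.
- by field.
Qed.

End PlanarSystem.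

(** * Local normal forms *)

Section ChartOfDiffeo.
Variables (R : realType) (M : manifold2 R).

(** Adapted coordinates become a member of the maximal atlas, because the transitions of e are those
    of c0 composed with f or g. *)
Lemma chart_of_diffeo (c0 : chart R M) A B f g : atlas c0 -> diffeo A B f g ->
  A `<=` cim c0 -> exists e : chart R M, [/\ smooth_chart e,
    cdom e = cdom c0 `&` cmap c0 @^-1` A, cmap e = f \o cmap c0 & cim e = B].
Proof.
move=> ac D AU.
have gA y : B y -> cim c0 (g y) by move=> /(diffeo_from D)/AU.
have imE : (f \o cmap c0) @` (cdom c0 `&` cmap c0 @^-1` A) = B.
  apply/seteqP; split=> [_ [p [cp Ap] <-]|y By]; first exact: (diffeo_to D).
  exists (cinv c0 (g y)); first split=> /=.
  - by apply: cinv_dom; exact: gA.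
  - by rewrite cinvK; [exact: (diffeo_from D)|exact: gA].
  - by rewrite /= cinvK ?(diffeoVK D) //; exact: gA.
have odom : open (cdom c0 `&` cmap c0 @^-1` A).
  by apply: open_pushforward; exact: (diffeo_openl D).
have oim : open ((f \o cmap c0) @` (cdom c0 `&` cmap c0 @^-1` A)).
  by rewrite imE; exact: (diffeo_openr D).
have eK p : (cdom c0 `&` cmap c0 @^-1` A) p -> (cinv c0 \o g) ((f \o cmap c0) p) = p.
  by move=> [cp Ap] /=; rewrite (diffeoK D) // cmapK.
have cmc p : (cdom c0 `&` cmap c0 @^-1` A) p -> {for p, continuous (f \o cmap c0)}.
  move=> [cp Ap]; apply: continuous_comp; first exact: cmap_continuous.
  exact: (Ck_continuous (diffeo_smooth D 0%N)).
have cic u : ((f \o cmap c0) @` (cdom c0 `&` cmap c0 @^-1` A)) u ->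
    {for u, continuous (cinv c0 \o g)}.
  rewrite imE => Bu; apply: continuous_comp.
    exact: (Ck_continuous (diffeo_smoothV D 0%N)).
  by apply: cinv_continuous; exact: gA.
pose e := Chart odom oim eK cmc cic.
exists e; split => // c a; split=> j.
- apply: (Ck_comp_rV2 (f := cmap c \o cinv c0) (g := g)
    (W := cmap c0 @` (cdom c0 `&` cdom c))).
  + exact: (@open_overlap _ _ e c).
  + exact: open_overlap.
  + move=> _ [p [[cp Ap] dp] <-] /=; rewrite (diffeoK D) //; by exists p.
  + exact: (atlas_smooth ac a).
  + apply: Ck_subset (diffeo_smoothV D j) => _ [p [[cp Ap] dp] <-] /=.
    exact: (diffeo_to D).
- apply: (Ck_comp_rV2 (f := f) (g := cmap c0 \o cinv c) (W := A)).
  + exact: (@open_overlap _ _ c e).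
  + exact: (diffeo_openl D).
  + by move=> _ [p [dp [cp Ap]] <-] /=; rewrite cmapK.
  + exact: (diffeo_smooth D).
  + by apply: Ck_subset (atlas_smooth a ac j) => _ [p [dp [cp Ap]] <-]; exists p.
Qed.

End ChartOfDiffeo.

(** * The horizontal projection z as a local coordinate *)

Section LocalForm.
Variables (R : realType) (M : manifold2 R).
Variables (phi : R -> M -> M) (k : R) (z1 z2 h n1 n2 n3 : M -> R).
Hypothesis sr : semirot phi k z1 z2 h n1 n2 n3.
Hypothesis k1 : k != 1.
Implicit Types (c : chart R M) (p : M).

Let sz1 := sr_z1_smooth sr.
Let sz2 := sr_z2_smooth sr.
Let sh := sr_h_smooth sr.
Let sn1 := sr_n1_smooth sr.
Let sn2 := sr_n2_smooth sr.
Let sn3 := sr_n3_smooth sr.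
Local Notation m := (1 - k).
Let np p : n3 p != 0 := normal_nonvertical sr k1 p.

Let m0 : m != 0.
Proof. by rewrite subr_eq0 eq_sym. Qed.

(* [S_ + i T_] is zeta z. *)
Definition S_ p := w_re z1 z2 n1 n2 p / n3 p.
Definition T_ p := w_im z1 z2 n1 n2 p / n3 p.

Lemma smooth_quot (f g : M -> R) : smooth_map f -> smooth_map g -> (forall p, g p != 0) ->
  smooth_map (fun p => f p / g p).
Proof.
move=> sf sg g0 c ac j; have oc := @open_cim _ _ c.
apply: (Ck_mul oc (f := f \o cinv c) (g := fun u => (g (cinv c u))^-1)); first exact: sf.
by apply: Ck_inv => //; exact: sg.
Qed.

Lemma S_smooth : smooth_map S_.
Proof.
apply: smooth_quot => // c ac j; have oc := @open_cim _ _ c.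
by apply: (Ck_add oc (f := fun u => z1 (cinv c u) * n1 (cinv c u))
  (g := fun u => z2 (cinv c u) * n2 (cinv c u))); apply: Ck_mul => //;
  [exact: sz1|exact: sn1|exact: sz2|exact: sn2].
Qed.

Lemma T_smooth : smooth_map T_.
Proof.
apply: smooth_quot => // c ac j; have oc := @open_cim _ _ c.
apply: (Ck_add oc (f := fun u => z2 (cinv c u) * n1 (cinv c u))
  (g := fun u => - (z1 (cinv c u) * n2 (cinv c u)))).
  by apply: Ck_mul => //; [exact: sz2|exact: sn1].
by apply: Ck_opp => //; apply: Ck_mul => //; [exact: sz1|exact: sn2].
Qed.

(** As n3 <> 0, tangency gives dh = 0 wherever dz = 0, and the immersion property applies. This
    makes z a local coordinate. *)
Lemma dz_injective c p (v : 'rV[R]_2) : atlas c -> cdom c p ->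
  pd z1 c p v = 0 -> pd z2 c p v = 0 -> v = 0.
Proof.
move=> ac cp e1 e2; apply: (sr_immersion sr ac cp) => //.
have := sr_tangent sr v ac cp; rewrite e1 e2 !mulr0 !add0r => /eqP.
by rewrite mulf_eq0 (negbTE (np p)) => /eqP.
Qed.

(** If zeta z vanished on U, so would its differential m zeta dz, hence zeta, since dz is injective.
    Then nu = 0 on U and the derivative of n is a multiple of n. This is what makes C nonzero
    later. *)
Lemma ST_not_locally0 (U : set M) : open U -> U !=set0 ->
  ~ (forall p, U p -> S_ p = 0 /\ T_ p = 0).
Proof.
move=> oU neU ST0; apply: (sr_nonflat sr oU neU).
have n0 p : U p -> n1 p = 0 /\ n2 p = 0.
  move=> Up; have [c ac cp] := atlas_cover p.
  have [v v0] : exists v : 'rV[R]_2, v != 0.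
    by exists (vec2 1 0); apply/eqP => /rowP/(_ 0); rewrite vec2E mxE => /eqP; rewrite oner_eq0.
  have [[_ DS] [_ DT] _] := semirot_ode sr v m0 ac cp (np p).
  have DS0 := pd_eq0_near v oU Up cp (fun q Uq => (ST0 q Uq).1).
  have DT0 := pd_eq0_near v oU Up cp (fun q Uq => (ST0 q Uq).2).
  have e1 : n1 p * pd z1 c p v + n2 p * pd z2 c p v = 0.
    have : m * ((n1 p * pd z1 c p v + n2 p * pd z2 c p v) / n3 p) = 0 by rewrite -DS -[RHS]DS0.
    by move/eqP; rewrite !mulf_eq0 invr_eq0 (negbTE m0) (negbTE (np p)) orbF => /eqP.
  have e2 : n1 p * pd z2 c p v - n2 p * pd z1 c p v = 0.
    have : m * ((n1 p * pd z2 c p v - n2 p * pd z1 c p v) / n3 p) = 0 by rewrite -DT -[RHS]DT0.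
    by move/eqP; rewrite !mulf_eq0 invr_eq0 (negbTE m0) (negbTE (np p)) orbF => /eqP.
  have zz : pd z1 c p v ^+ 2 + pd z2 c p v ^+ 2 != 0.
    apply/eqP => zz; move/eqP: v0; apply; apply: (dz_injective ac cp).
      by apply/eqP; rewrite -sqrf_eq0; apply/eqP; have := sqr_ge0 (pd z1 c p v);
        have := sqr_ge0 (pd z2 c p v); lra.
    by apply/eqP; rewrite -sqrf_eq0; apply/eqP; have := sqr_ge0 (pd z1 c p v);
      have := sqr_ge0 (pd z2 c p v); lra.
  move: (pd z1 c p v) (pd z2 c p v) e1 e2 zz => Z1 Z2 e1 e2 zz.
  split; apply: (mulfI zz); rewrite mulr0.
  - transitivity (Z1 * (n1 p * Z1 + n2 p * Z2) + Z2 * (n1 p * Z2 - n2 p * Z1)); first by ring.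
    by rewrite e1 e2; ring.
  - transitivity (Z2 * (n1 p * Z1 + n2 p * Z2) - Z1 * (n1 p * Z2 - n2 p * Z1)); first by ring.
    by rewrite e1 e2; ring.
move=> p c v Up ac cp; exists (pd n3 c p v / n3 p).
have [-> ->] := n0 p Up.
rewrite (pd_eq0_near v oU Up cp (fun q Uq => (n0 q Uq).1)).
rewrite (pd_eq0_near v oU Up cp (fun q Uq => (n0 q Uq).2)) mulr0.
by split=> //; rewrite divfK.
Qed.

(** f is z read in the chart c0, locally invertible by [dz_injective], and g is its inverse. In the
    coordinate z, [semirot_ode] becomes the planar system. *)
Lemma planar_at p0 : exists c0 A B f g,
  [/\ atlas c0 /\ cdom c0 p0, diffeo A B f g, A (cmap c0 p0) /\ A `<=` cim c0,
   forall u, f u = vec2 (z1 (cinv c0 u)) (z2 (cinv c0 u))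
   & planar m B (fun y => n1 (cinv c0 (g y)) / n3 (cinv c0 (g y)))
       (fun y => n2 (cinv c0 (g y)) / n3 (cinv c0 (g y)))
       (fun y => S_ (cinv c0 (g y))) (fun y => T_ (cinv c0 (g y)))
       (fun y => h (cinv c0 (g y)))].
Proof.
have [c0 ac cp] := atlas_cover p0; have oc := @open_cim _ _ c0.
pose f u := vec2 (z1 (cinv c0 u)) (z2 (cinv c0 u)).
have sf : smooth_on (cim c0) f.
  by move=> j; apply: Ck_vec2 => //; [exact: sz1|exact: sz2].
have [|A [B [g [D Ap AU _]]]] := inverse_function oc (cim_cmap cp) sf _ (@filterT _ (nbhs (cmap c0 p0)) _).
  move=> v; have [_ ->] := is_derive_vec2 (is_pd v sz1 ac cp) (is_pd v sz2 ac cp).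
  move=> e; apply: (dz_injective ac cp).
    by rewrite -(vec20 (pd z1 c0 p0 v) (pd z2 c0 p0 v)) e mxE.
  by rewrite -(vec21 (pd z1 c0 p0 v) (pd z2 c0 p0 v)) e mxE.
exists c0, A, B, f, g; split=> //.
have oB := diffeo_openr D.
have Bc y : B y -> cim c0 (g y) by move=> /(diffeo_from D)/AU.
have k1B (F : M -> R) : smooth_map F -> Ck_on 1 B (fun y => F (cinv c0 (g y))).
  by move=> sF; exact: (Ck_comp (f := F \o cinv c0) oB oc Bc (sF c0 ac 1%N) (diffeo_smoothV D 1%N)).
have fg y : B y -> z1 (cinv c0 (g y)) = y 0 0 /\ z2 (cinv c0 (g y)) = y 0 1.
  by move=> By; have e := diffeoVK D By; split; rewrite -[in RHS]e /f vec2E.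
have nB y : B y -> nbhs y B by move=> By; exact: open_nbhs_nbhs.
(* The vector w is the image of v under the differential of g; since f inverts g, the components of
   dz on w are those of v. *)
have der (y v : 'rV[R]_2) : B y -> exists w, [/\ pd z1 c0 (cinv c0 (g y)) w = v 0 0,
    pd z2 c0 (cinv c0 (g y)) w = v 0 1 &
    forall F, smooth_map F -> 'D_v (fun y => F (cinv c0 (g y))) y = pd F c0 (cinv c0 (g y)) w].
  move=> By; exists ('D_v g y).
  have dF F : smooth_map F -> is_derive y v (F \o (cinv c0 \o g)) (pd F c0 (cinv c0 (g y)) ('D_v g y)).
    move=> sF; apply: (is_derive_comp_chart (g := cinv c0 \o g)) => //.
    - by apply: cinv_dom; exact: Bc.
    - apply: continuous_comp; first exact: (Ck_continuous (diffeo_smoothV D 0%N)).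
      by apply: cinv_continuous; exact: Bc.
    - have dg : is_derive y v g ('D_v g y).
        by apply: derivableP; exact: (Ck_derivable (diffeo_smoothV D 1%N)).
      apply: near_eq_is_derive dg.
      by apply: filterS (nB y By) => y' By' /=; rewrite cinvK //; exact: Bc.
  have dc j : is_derive y v (fun y : 'rV[R]_2 => y 0 j) (v 0 j).
    exact: (is_derive_coord 0 j (is_derive_id y v)).
  split.
  - apply: (is_derive_unique (dF _ sz1)); apply: near_eq_is_derive (dc 0).
    by apply: filterS (nB y By) => y' /fg[].
  - apply: (is_derive_unique (dF _ sz2)); apply: near_eq_is_derive (dc 1).
    by apply: filterS (nB y By) => y' /fg[].
  - by move=> F sF; have [_ <-] := dF F sF.
split=> //.
- exact: k1B S_smooth.
- exact: k1B T_smooth.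
- exact: k1B sh.
- move=> y v By; have [w [w1 w2 ->]] := der y v By; last exact: S_smooth.
  have [[_ DS] _ _] := semirot_ode sr w m0 ac (cinv_dom (Bc y By)) (np _).
  by rewrite /pd [LHS]DS w1 w2; field.
- move=> y v By; have [w [w1 w2 ->]] := der y v By; last exact: T_smooth.
  have [_ [_ DT] _] := semirot_ode sr w m0 ac (cinv_dom (Bc y By)) (np _).
  by rewrite /pd [LHS]DT w1 w2; field.
- move=> y v By; have [w [w1 w2 ->]] := der y v By; last exact: sh.
  have [_ _ ->] := semirot_ode sr w m0 ac (cinv_dom (Bc y By)) (np _).
  by rewrite w1 w2; field.
- by move=> y By; have [e1 e2] := fg y By; rewrite /S_ /w_re e1 e2; field.
- by move=> y By; have [e1 e2] := fg y By; rewrite /T_ /w_im e1 e2; field.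
Qed.

End LocalForm.

(** * Angles and powers *)

Section Trigonometry.
Variable R : realType.

Lemma exists_angle (a b : R) : a ^+ 2 + b ^+ 2 = 1 -> exists t, cos t = a /\ sin t = b.
Proof.
move=> ab; have a1 : -1 <= a <= 1.
  by have := sqr_ge0 b => b2; apply/andP; split; nra.
have ca : cos (acos a) = a by rewrite acosK // in_itv.
have sa : sin (acos a) = `|b|.
  rewrite sin_acos // (_ : 1 - a ^+ 2 = b ^+ 2) ?sqrtr_sqr //; lra.
have [b0|b0] := leP 0 b.
  by exists (acos a); rewrite ca sa ger0_norm.
by exists (- acos a); rewrite cosN sinN ca sa ltr0_norm // opprK.
Qed.

Lemma exists_polar (a b : R) : exists r t, [/\ 0 <= r, r ^+ 2 = a ^+ 2 + b ^+ 2,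
  a = r * cos t & b = r * sin t].
Proof.
pose r := Num.sqrt (a ^+ 2 + b ^+ 2).
have r2 : r ^+ 2 = a ^+ 2 + b ^+ 2 by rewrite sqr_sqrtr // addr_ge0 // sqr_ge0.
have [r0|r0] := eqVneq r 0.
  exists 0, 0; move: r2; rewrite r0 expr0n /= => /esym e.
  have [a0 b0] : a = 0 /\ b = 0.
    by split; apply/eqP; rewrite -sqrf_eq0; apply/eqP; have := sqr_ge0 a;
      have := sqr_ge0 b; lra.
  by rewrite a0 b0 !mul0r expr0n /= addr0; split.
have [t [ct st]] : exists t, cos t = a / r /\ sin t = b / r.
  apply: exists_angle; rewrite !exprMn exprVn -mulrDl -r2 divff //.
  by rewrite sqrf_eq0.
exists r, t; split=> //; first exact: sqrtr_ge0.
- by rewrite ct; field.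
- by rewrite st; field.
Qed.

Lemma cos_sin_2pin (n : nat) : cos (pi *+ 2 * n%:R) = 1 :> R /\ sin (pi *+ 2 * n%:R) = 0 :> R.
Proof.
elim: n => [|n [IHc IHs]]; first by rewrite mulr0 cos0 sin0.
rewrite -natr1 mulrDr mulr1 (cosD (_ * _)) (sinD (_ * _)) IHc IHs cos2pi sin2pi; split; ring.
Qed.

(** The fractional part f of x also satisfies cos(2 pi f) = 1, so sin(pi f) = 0 by the double angle
    formula, whereas sin is positive on the open interval from 0 to pi. *)
Lemma cos_2pi_eq1 (x : R) : 0 < x -> cos (pi *+ 2 * x) = 1 -> exists n : nat, x = n%:R.
Proof.
move=> x0 cx; have /andP[nx xn] := truncn_itv (ltW x0).
exists (Num.truncn x); set n := Num.truncn x in nx xn *.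
have [cn sn] := cos_sin_2pin n.
pose f := x - n%:R.
have cf : cos (pi *+ 2 * f) = 1.
  by rewrite /f mulrBr cosB cn sn cx; ring.
have sf : sin (pi * f) = 0.
  have : cos (pi * f *+ 2) = 1 by rewrite -mulrnAl.
  rewrite cos_mulr2n cos2sin2 => e.
  by apply/eqP; rewrite -sqrf_eq0; apply/eqP; lra.
apply: contrapT => /eqP xN.
have f0 : 0 < f by rewrite /f subr_gt0 lt_neqAle eq_sym xN.
have f1 : f < 1 by move: xn; rewrite -natr1 /f; lra.
have := @sin_gt0_pi R (pi * f); rewrite sf ltxx => /(_ _)/negP; apply.
  by apply/andP; split; [rewrite mulr_gt0 // pi_gt0|rewrite gtr_pMr // pi_gt0].
by [].
Qed.

Lemma de_moivre (r t : R) (n : nat) :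
  ((r * cos t +i* (r * sin t)) ^+ n = (r ^+ n * cos (n%:R * t)) +i* (r ^+ n * sin (n%:R * t)))%C.
Proof.
elim: n => [|n IH]; first by rewrite !expr0 !mul0r cos0 sin0 mulr0 mulr1.
rewrite exprS IH -natr1 mulrDl mul1r cosD sinD exprS.
apply/eqP; rewrite eq_complex /=; apply/andP; split; apply/eqP; ring.
Qed.

End Trigonometry.

(** * Polar coordinates adapted to the phase of C *)

Section PolarCoordinates.
Variable R : realType.

(** The angular coordinate is the polar angle plus [al]: this hides the phase of C, as the angle of
    x_{m,c} carries no phase. *)
Definition polar_shift (al : R) (u : 'rV[R]_2) : 'rV[R]_2 := polar (vec2 (u 0 0) (u 0 1 - al)).

Lemma polar_shift_smooth al (U : set 'rV[R]_2) : open U -> smooth_on U (polar_shift al).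
Proof.
move=> oU k.
have kx j : Ck_on k U (fun u : 'rV[R]_2 => u 0 j) := Ck_coord 0 j oU (Ck_id k oU).
have [kc ks] := Ck_cos_sin oU (Ck_add oU (kx 1) (Ck_cst k (- al) oU)).
have := Ck_vec2 oU (Ck_mul oU (kx 0) kc) (Ck_mul oU (kx 0) ks).
by apply: eq_Ck_on => // u _; rewrite /polar_shift /polar !vec2E.
Qed.

Lemma polar_shift_derive_inj al (u v : 'rV[R]_2) : 0 < u 0 0 ->
  'D_v (polar_shift al) u = 0 -> v = 0.
Proof.
move=> u0.
have dx j : is_derive u v (fun u : 'rV[R]_2 => u 0 j) (v 0 j).
  exact: (is_derive_coord 0 j (is_derive_id u v)).
have da : is_derive u v (fun u : 'rV[R]_2 => u 0 1 - al) (v 0 1).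
  by apply: is_derive_eq (is_deriveB (dx 1) (is_derive_cst al u v)) _; rewrite subr0.
have dc := is_derive_comp1 da (is_derive_cos (u 0 1 - al)).
have ds := is_derive_comp1 da (is_derive_sin (u 0 1 - al)).
have D := is_derive_vec2 (is_derive_prod (dx 0) dc) (is_derive_prod (dx 0) ds).
have -> : polar_shift al = fun u => vec2 (u 0 0 * cos (u 0 1 - al)) (u 0 0 * sin (u 0 1 - al)).
  by apply/funext => w; rewrite /polar_shift /polar !vec2E.
case: D => _ -> e.
have := cos2Dsin2 (u 0 1 - al).
have := congr1 (fun M : 'rV[R]_2 => M 0 0) e; have := congr1 (fun M : 'rV[R]_2 => M 0 1) e.
rewrite !vec2E !mxE; move: (cos _) (sin _) => C S e1 e0 cs.
apply: rV2P; rewrite mxE.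
  transitivity ((C ^+ 2 + S ^+ 2) * v 0 0); first by rewrite cs mul1r.
  transitivity (C * (u 0 0 * (- S * v 0 1) + C * v 0 0) + S * (u 0 0 * (C * v 0 1) + S * v 0 0)).
    by ring.
  by rewrite e1 e0; ring.
apply: (mulfI (lt0r_neq0 u0)); rewrite mulr0.
transitivity ((C ^+ 2 + S ^+ 2) * (u 0 0 * v 0 1)); first by rewrite cs mul1r.
transitivity (C * (u 0 0 * (C * v 0 1) + S * v 0 0) - S * (u 0 0 * (- S * v 0 1) + C * v 0 0)).
  by ring.
by rewrite e1 e0; ring.
Qed.

(** C1 + i C2 is written as ka e^{i m al}; as m <> 0, its argument can be turned into a shift of the
    angle. *)
Lemma polar_amplitude (m : R) (B : set 'rV[R]_2) (p q s tau hh : 'rV[R]_2 -> R) (I J : set R) :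
  m != 0 -> planar m B p q s tau hh -> is_interval I -> is_interval J ->
  (forall r, I r -> 0 < r) -> (forall r t, I r -> J t -> B (polar (vec2 r t))) ->
  exists ka al h0, 0 <= ka /\ forall r t, I r -> J t ->
  [/\ s (polar (vec2 r t)) = ka * r `^ m * cos (m * (t + al)),
      tau (polar (vec2 r t)) = ka * r `^ m * sin (m * (t + al))
    & hh (polar (vec2 r t)) = h0 - ka / m * (r `^ m * cos (m * (t + al)))].
Proof.
move=> m0 pl iI iJ I0 IJB.
have [C1 [C2 [h0 sol]]] := polar_solution m0 pl iI iJ I0 IJB.
have [ka [ga [ka0 _ C1E C2E]]] := exists_polar C1 C2.
exists ka, (ga / m), h0; split=> // r t Ir Jt; have [e1 e2 e3] := sol r t Ir Jt.
have -> : m * (t + ga / m) = m * t + ga by field.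
rewrite e3 e1 e2 C1E C2E cosD sinD; split; first by ring.
  by ring.
by field.
Qed.

End PolarCoordinates.

(** * Normal forms off and on the axis *)

Section LocalNormalForm.
Variables (R : realType) (M : manifold2 R).
Variables (phi : R -> M -> M) (k : R) (z1 z2 h n1 n2 n3 : M -> R).
Hypothesis sr : semirot phi k z1 z2 h n1 n2 n3.
Hypothesis k1 : k != 1.
Implicit Types (c : chart R M) (p : M).
Local Notation m := (1 - k).
Local Notation S_ := (S_ z1 z2 n1 n2 n3).
Local Notation T_ := (T_ z1 z2 n1 n2 n3).

Let m0 : m != 0.
Proof. by rewrite subr_eq0 eq_sym. Qed.

(* The modulus [ka] of the constant C in zeta z = C z^m. *)
Definition modulus_at (ka : R) p := exists U : set M, [/\ open U, U p &
  forall q, U q -> z1 q ^+ 2 + z2 q ^+ 2 != 0 ->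
    S_ q ^+ 2 + T_ q ^+ 2 = ka ^+ 2 * (z1 q ^+ 2 + z2 q ^+ 2) `^ m].

(** The chart is (r, theta) with z e^{i al} = r e^{i theta}. Up to the rotation by [al] about l and
    the translation by [h0] along it, this is x_{m,c} with c = -ka / m. *)
Definition polar_form_at (ka : R) p := exists (e : chart R M) (al h0 : R),
  [/\ smooth_chart e /\ cdom e p, forall u, cim e u -> 0 < u 0 0 &
   forall q, cdom e q -> let u := cmap e q in
     [/\ cos al * z1 q - sin al * z2 q = u 0 0 * cos (u 0 1),
         sin al * z1 q + cos al * z2 q = u 0 0 * sin (u 0 1)
       & h q = h0 - ka / m * (u 0 0 `^ m * cos (m * u 0 1))]].

(** The Cartesian counterpart of [polar_form_at], for points on the axis, where polar coordinates
    break down. *)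
Definition graph_form_at (ka : R) p := exists (e : chart R M) (al h0 : R) (n : nat),
  [/\ smooth_chart e /\ cdom e p, (0 < n)%N, m = n%:R &
   forall q, cdom e q -> let u := cmap e q in
     [/\ cos al * z1 q - sin al * z2 q = u 0 0,
         sin al * z1 q + cos al * z2 q = u 0 1
       & h q = h0 - ka / m * complex.Re ((u 0 0 +i* u 0 1)%C ^+ n)]].

Lemma amplitude_modulus (ka r x : R) : 0 <= r ->
  (ka * r `^ m * cos x) ^+ 2 + (ka * r `^ m * sin x) ^+ 2 = ka ^+ 2 * (r ^+ 2) `^ m.
Proof.
move=> r0; rewrite expr2 powRM // -[RHS]mulr1 -(cos2Dsin2 x); ring.
Qed.

Lemma local_form_off_axis p0 : z1 p0 ^+ 2 + z2 p0 ^+ 2 != 0 ->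
  exists2 ka, 0 < ka & modulus_at ka p0 /\ polar_form_at ka p0.
Proof.
move=> zp; have [c0 [A [B [f [g [[ac cp] D [Ap AU] fE pl]]]]]] := planar_at sr k1 p0.
have oB := diffeo_openr D.
have [r0 [t0 [r0p r02 z1E z2E]]] := exists_polar (z1 p0) (z2 p0).
have r0_gt0 : 0 < r0.
  by rewrite lt_neqAle r0p andbT eq_sym; apply: contra_neq zp => r00; rewrite -r02 r00 expr0n.
have fp0 : f (cmap c0 p0) = polar (vec2 r0 t0).
  by rewrite fE cmapK // /polar !vec2E -z1E -z2E.
pose u0 : 'rV[R]_2 := vec2 r0 t0.
have cpol : {for u0, continuous (@polar R)}.
  have := @Ck_continuous R _ _ 0 setT (polar_shift 0) u0 (polar_shift_smooth 0 openT 0) I.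
  rewrite (_ : polar_shift 0 = @polar R) //.
  by apply/funext => u; rewrite /polar_shift subr0 vec2_eta.
have nB : nbhs u0 (@polar R @^-1` B).
  apply: cpol; apply: open_nbhs_nbhs; split=> //.
  by rewrite -fp0; exact: (diffeo_to D).
have [d1 d10 d1B] := nbhs_ballR nB.
(* d <= d1 keeps the rectangle I x J inside the domain of the planar system, and d <= r0 keeps its
   radii positive. *)
pose d := Num.min d1 r0.
have d0 : 0 < d by rewrite lt_min d10.
pose I := [set r : R | `|r - r0| < d]; pose J := [set t : R | `|t - t0| < d].
have itv (a : R) : is_interval [set r : R | `|r - a| < d].
  by move=> x y /=; rewrite !ltr_norml => /andP[x1 x2] /andP[y1 y2] z /andP[xz zy];
    rewrite ltr_norml; apply/andP; split; lra.
have I0 r : I r -> 0 < r.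
  rewrite /I /= ltr_norml => /andP[+ _]; have : d <= r0 by rewrite ge_min lexx orbT.
  by lra.
have IJB r t : I r -> J t -> B (polar (vec2 r t)).
  move=> Ir Jt; apply: d1B; apply: (@lt_le_trans _ _ d); last by rewrite ge_min lexx.
  by rewrite norm_rV2_lt !mxE /=; apply/andP.
have [ka [al [h0 [ka0 sol]]]] := polar_amplitude m0 pl (itv r0) (itv t0) I0 IJB.
pose us : 'rV[R]_2 := vec2 r0 (t0 + al).
(* Prescribing the ball around [us] as a neighbourhood keeps the shifted polar chart over I x J,
   where the solution is known. *)
have [|A' [B' [g' [D' Aus _ AN]]]] := inverse_function openT (Logic.I : setT us)
   (polar_shift_smooth al openT) _ (nbhsx_ballx us d d0).
  by move=> v; apply: polar_shift_derive_inj; rewrite vec2E.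
have ANE u : A' u -> I (u 0 0) /\ J (u 0 1 - al).
  move=> /AN; rewrite -ball_normE /= distrC norm_rV2_lt !mxE /= => /andP[? +].
  by rewrite opprD addrA -[_ - t0 - al]addrAC => ?.
have D2 := diffeo_comp D (diffeo_sym D').
have [|e [se de me ie]] := chart_of_diffeo ac D2.
  by move=> u [/AU].
have key q : cdom e q -> exists r t, [/\ cmap e q = vec2 r (t + al), I r, J t,
    z1 q = r * cos t & z2 q = r * sin t] /\
    [/\ S_ q = ka * r `^ m * cos (m * (t + al)), T_ q = ka * r `^ m * sin (m * (t + al))
      & h q = h0 - ka / m * (r `^ m * cos (m * (t + al)))].
  rewrite de => -[cq [Aq Bq]]; rewrite me /=.
  set y := f (cmap c0 q) in Bq *; set u := g' y.
  have A'u : A' u by exact: (diffeo_from D').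
  have [Iu Ju] := ANE u A'u.
  have yE : y = polar (vec2 (u 0 0) (u 0 1 - al)) by rewrite -[LHS](diffeoVK D' Bq).
  have By : B y by exact: (diffeo_to D).
  have qE : cinv c0 (g y) = q by rewrite (diffeoK D) // cmapK.
  have [] := sol _ _ Iu Ju; rewrite -yE qE => e1 e2 e3.
  exists (u 0 0), (u 0 1 - al); split; split => //.
  - by rewrite subrK vec2_eta.
  - have := congr1 (fun M : 'rV[R]_2 => M 0 0) yE.
    by rewrite /y fE cmapK // /polar !vec2E.
  - have := congr1 (fun M : 'rV[R]_2 => M 0 1) yE.
    by rewrite /y fE cmapK // /polar !vec2E.
have ep : cdom e p0.
  rewrite de; split=> //; split=> //=; rewrite fp0.
  rewrite (_ : polar _ = polar_shift al us); first exact: (diffeo_to D').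
  by rewrite /polar_shift /us !vec2E addrK.
have kap : 0 < ka.
  rewrite lt_neqAle ka0 andbT; apply/eqP => k0.
  apply: (ST_not_locally0 sr k1 (cdom_open e)); first by exists p0.
  by move=> q /key[r [t [_ [-> -> _]]]]; rewrite -k0 !mul0r.
exists ka => //; split.
  exists (cdom e); split=> //; first exact: cdom_open.
  move=> q /key[r [t [[_ Ir Jt -> ->] [-> -> _]]]] _; rewrite amplitude_modulus; last exact/ltW/I0.
  congr (_ * _ `^ _); rewrite -[LHS]mulr1 -(cos2Dsin2 t); ring.
exists e, al, h0; split=> //.
- by move=> _ [q /key[r [t [[-> Ir _ _ _] _]]] <-]; rewrite vec2E; exact: I0.
- move=> q /key[r [t [[-> Ir Jt -> ->] [_ _ ->]]]] /=; rewrite !vec2E cosD sinD.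
  by split; ring.
Qed.

(** The planar solution is taken over a punctured disc with the angle ranging over all of R, so
    angles 0 and 2 pi give the same point. The values at the centre come from continuity. *)
Lemma local_form_on_axis p0 : z1 p0 ^+ 2 + z2 p0 ^+ 2 = 0 ->
  exists2 ka, 0 < ka & modulus_at ka p0 /\ graph_form_at ka p0.
Proof.
move=> zp; have [c0 [A [B [f [g [[ac cp] D [Ap AU] fE pl]]]]]] := planar_at sr k1 p0.
have oB := diffeo_openr D.
have [z10 z20] : z1 p0 = 0 /\ z2 p0 = 0.
  by split; apply/eqP; rewrite -sqrf_eq0; apply/eqP; have := sqr_ge0 (z1 p0);
    have := sqr_ge0 (z2 p0); lra.
have fp0 : f (cmap c0 p0) = 0.
  by rewrite fE cmapK // z10 z20; apply: rV2P; rewrite !vec2E mxE.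
have B0 : B 0 by rewrite -fp0; exact: (diffeo_to D).
have nB : nbhs (0 : 'rV[R]_2) B by exact: open_nbhs_nbhs.
have [d d0 dB] := nbhs_ballR nB.
pose I := [set r : R | 0 < r < d].
have iI : is_interval I.
  by rewrite /I => x y /= /andP[x1 x2] /andP[y1 y2] z /andP[xz zy]; apply/andP; split; lra.
have iJ : is_interval (setT : set R) by [].
have I0 r : I r -> 0 < r by move=> /andP[].
have small r t : 0 < r -> forall e, r < e -> `|polar (vec2 r t)| < e.
  move=> r0 e re; rewrite norm_rV2_lt /polar !vec2E !normrM gtr0_norm //.
  have h1 : r * `|cos t| <= r by exact: ler_piMr (ltW r0) (cos_max t).
  have h2 : r * `|sin t| <= r by exact: ler_piMr (ltW r0) (sin_max t).
  by apply/andP; split; lra.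
have IJB r t : I r -> setT t -> B (polar (vec2 r t)).
  by move=> /andP[r0 rd] _; apply: dB; rewrite subr0; exact: small.
have [ka [al [h0 [ka0 sol]]]] := polar_amplitude m0 pl iI iJ I0 IJB.
pose s y := S_ (cinv c0 (g y)); pose tau y := T_ (cinv c0 (g y)).
pose hh y := h (cinv c0 (g y)).
have cs : {for (0 : 'rV[R]_2), continuous s} := Ck_continuous (pl_s_C1 pl) B0.
have ct : {for (0 : 'rV[R]_2), continuous tau} := Ck_continuous (pl_tau_C1 pl) B0.
have ch : {for (0 : 'rV[R]_2), continuous hh} := Ck_continuous (pl_h_C1 pl) B0.
have s0 : s 0 = 0 by have := pl_s pl B0; rewrite -/(s 0) !mxE !mul0r addr0.
have tau0 : tau 0 = 0 by have := pl_tau pl B0; rewrite -/(tau 0) !mxE !mul0r subr0.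
have near_r (P : 'rV[R]_2 -> Prop) : nbhs (0 : 'rV[R]_2) P ->
    exists2 e, 0 < e & forall r t, 0 < r -> r < e -> P (polar (vec2 r t)).
  move=> /nbhs_ballR[e e0 eP]; exists e => // r t r0 re; apply: eP.
  by rewrite subr0; exact: small.
have hh0 : hh 0 = h0.
  (* hh + s / m equals h0 on the punctured disc, so by continuity it has this value at 0 too, where
     s = 0. *)
  have cF : {for (0 : 'rV[R]_2), continuous (fun y => hh y + s y / m)}.
    by apply: continuousD => //; apply: continuousM => //; exact: cst_continuous.
  have F0 : hh 0 + s 0 / m = hh 0 by rewrite s0 mul0r addr0.
  apply: contrapT => /eqP ne; rewrite -F0 in ne.
  have [e e0 eP] : exists2 e, 0 < e & forall r t, 0 < r -> r < e ->
      hh (polar (vec2 r t)) + s (polar (vec2 r t)) / m != h0.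
    apply: (near_r (fun y => hh y + s y / m != h0)); apply: (cF [set y | y != h0]); apply: open_nbhs_nbhs.
    by split; [exact: open_neq|exact: ne].
  pose r := Num.min e d / 2.
  have mn : 0 < Num.min e d by rewrite lt_min e0.
  have r0 : 0 < r by rewrite divr_gt0.
  have re : r < e by apply: (@lt_le_trans _ _ (Num.min e d)); [rewrite /r; lra|rewrite ge_min lexx].
  have rd : r < d by apply: (@lt_le_trans _ _ (Num.min e d)); [rewrite /r; lra|rewrite ge_min lexx orbT].
  have Ir : I r by rewrite /I /= r0.
  have [e1 _ e3] := sol r 0 Ir Logic.I.
  have /eqP := eP r 0 r0 re; apply; rewrite /s /hh e1 e3; field.
  exact: m0.
(* The ball is one of the sup norm; radius d / 2 ensures that its points have Euclidean norm below
   d, as [sol] requires. *)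
pose W := ball (0 : 'rV[R]_2) (d / 2).
have WE y : W y -> y 0 0 ^+ 2 + y 0 1 ^+ 2 < d ^+ 2.
  rewrite /W -ball_normE /= sub0r normrN norm_rV2_lt => /andP[].
  rewrite -!(ltr_sqr (normr_ge0 _)) ?nnegrE ?divr_ge0 ?ltW // !real_normK ?num_real // => h1 h2.
  by have := exprn_gt0 2 d0; move: h1 h2; rewrite expr_div_n; lra.
have DW := diffeo_sym (diffeo_restrict (diffeo_sym D) (ball_open (0 : 'rV[R]_2) (d / 2))).
have csal : cos al * cos al - (- sin al) * sin al != 0.
  by rewrite mulNr opprK -!expr2 cos2Dsin2 oner_neq0.
(* The rotation by [al] absorbs the phase: the new coordinate is r e^{i(t + al)}, whose n-th power
   has real part r^n cos(n (t + al)). *)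
have D2 := diffeo_comp DW (diffeo_linmap2 csal).
have [|e [se de me ie]] := chart_of_diffeo ac D2; first by move=> u [[/AU]].
rewrite preimage_setT setIT in de.
have key q : cdom e q -> exists r t, [/\ 0 <= r, r < d, z1 q = r * cos t & z2 q = r * sin t] /\
    [/\ S_ q = ka * r `^ m * cos (m * (t + al)), T_ q = ka * r `^ m * sin (m * (t + al))
      & h q = h0 - ka / m * (r `^ m * cos (m * (t + al)))] .
  rewrite de => -[cq [Aq Wq]].
  have qE : cinv c0 (g (f (cmap c0 q))) = q by rewrite (diffeoK D) // cmapK.
  have [r [t [r0 r2 z1E z2E]]] := exists_polar (z1 q) (z2 q).
  have fq : f (cmap c0 q) = polar (vec2 r t) by rewrite fE cmapK // /polar !vec2E z1E z2E.
  have rd : r < d.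
    have := WE _ Wq; rewrite fE cmapK // !vec2E -r2.
    by rewrite ltr_sqr ?nnegrE // ltW.
  exists r, t; split=> //; have [r00|rn0] := eqVneq r 0.
    have f0 : f (cmap c0 q) = 0.
      by rewrite fq r00 /polar; apply: rV2P; rewrite !vec2E mul0r mxE.
    rewrite r00 powR0 // !(mulr0, mul0r) subr0.
    by move: s0 tau0 hh0; rewrite /s /tau /hh -f0 qE.
  have Ir : I r by rewrite /I /= lt_neqAle eq_sym rn0 r0.
  by have [] := sol r t Ir Logic.I; rewrite -fq qE.
have ep : cdom e p0.
  rewrite de; split=> //; split=> //=; rewrite fp0.
  by apply: ballxx; rewrite divr_gt0.
have kap : 0 < ka.
  rewrite lt_neqAle ka0 andbT; apply/eqP => k0.
  apply: (ST_not_locally0 sr k1 (cdom_open e)); first by exists p0.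
  by move=> q /key[r [t [_ [-> -> _]]]]; rewrite -k0 !mul0r.
(* F = |zeta z|^2 is continuous and vanishes at 0, but equals ka^2 r^(2 m) nearby, which for m < 0
   and r <= 1 is at least ka^2 > 0; hence the 1 in the choice of r. *)
have m_gt0 : 0 < m.
  rewrite ltNge; apply/negP => m_le0; have m_lt0 : m < 0 by rewrite lt_neqAle m0.
  pose F y := s y * s y + tau y * tau y.
  have cF : {for (0 : 'rV[R]_2), continuous F}.
    by apply: continuousD; apply: continuousM.
  have [e1 e10 eP] : exists2 e, 0 < e & forall r t, 0 < r -> r < e -> F (polar (vec2 r t)) < ka ^+ 2.
    apply: (near_r (fun y => F y < ka ^+ 2)); apply: (cF [set y | y < ka ^+ 2]); apply: open_nbhs_nbhs; split.
      exact: open_lt.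
    by rewrite /= /F s0 tau0 mulr0 addr0 exprn_gt0.
  pose r := Num.min e1 (Num.min d 1) / 2.
  have mn : 0 < Num.min e1 (Num.min d 1) by rewrite !lt_min e10 d0 /=.
  have r0 : 0 < r by rewrite divr_gt0.
  have : r < Num.min e1 (Num.min d 1) by rewrite /r; lra.
  rewrite !lt_min => /and3P[re rd r1].
  have Ir : I r by rewrite /I /= r0.
  have := eP r 0 r0 re; have [E1 E2 _] := sol r 0 Ir Logic.I.
  rewrite /F /s /tau E1 E2 -!expr2 amplitude_modulus ?ltW //.
  rewrite gtr_pMr ?exprn_gt0 // ltNge => /negP; apply.
  have r21 : 0 < r ^+ 2 <= 1 by rewrite exprn_gt0 //= expr_le1 // ltW.
  by have := ger_powR r21 (ltW m_lt0); rewrite powRr0.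
(* Comparing the solution at the angles 0 and 2 pi gives e^{2 pi i m} = 1, because ka r^m <> 0. *)
have [n mn] : exists n : nat, m = n%:R.
  apply: cos_2pi_eq1 => //.
  pose r := d / 2; have Ir : I r by rewrite /I /= /r; apply/andP; split; lra.
  have [E1 E2 _] := sol r 0 Ir Logic.I; have [E3 E4 _] := sol r (pi *+ 2) Ir Logic.I.
  have pE : polar (vec2 r (pi *+ 2)) = polar (vec2 r 0) :> 'rV[R]_2.
    by rewrite /polar !vec2E cos2pi sin2pi cos0 sin0.
  rewrite pE in E3 E4.
  have kr : ka * r `^ m != 0.
    by rewrite mulf_neq0 ?gt_eqF // powR_gt0 // I0.
  have ec : cos (m * (0 + al)) = cos (m * (pi *+ 2 + al)) by apply: (mulfI kr); rewrite -E1 -E3.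
  have es : sin (m * (0 + al)) = sin (m * (pi *+ 2 + al)) by apply: (mulfI kr); rewrite -E2 -E4.
  have -> : pi *+ 2 * m = m * (pi *+ 2 + al) - m * (0 + al) by ring.
  by rewrite cosB -ec -es -!expr2 cos2Dsin2.
exists ka => //; split.
  exists (cdom e); split=> //; first exact: cdom_open.
  move=> q /key[r [t [[r0 _ -> ->] [-> -> _]]]] _; rewrite amplitude_modulus //.
  congr (_ * _ `^ _); rewrite -[LHS]mulr1 -(cos2Dsin2 t); ring.
exists e, al, h0, n; split=> //; first by move: m_gt0; rewrite mn ltr0n.
move=> q eq; have [r [t [[r0 rd z1E z2E] [_ _ ->]]]] := key q eq.
have uE : cmap e q = vec2 (cos al * z1 q - sin al * z2 q) (sin al * z1 q + cos al * z2 q).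
  move: eq; rewrite de => -[cq _]; rewrite me /= fE cmapK // /linmap2 !vec2E.
  by apply: rV2P; rewrite !vec2E //; ring.
rewrite /= uE !vec2E; split=> //.
have -> : cos al * z1 q - sin al * z2 q = r * cos (t + al) by rewrite z1E z2E cosD; ring.
have -> : sin al * z1 q + cos al * z2 q = r * sin (t + al) by rewrite z1E z2E sinD; ring.
by rewrite de_moivre /= mn powR_mulrn.
Qed.

End LocalNormalForm.

(** * Globalization *)

Section Globalization.
Variables (R : realType) (M : manifold2 R).
Variables (phi : R -> M -> M) (k : R) (z1 z2 h n1 n2 n3 : M -> R).
Hypothesis sr : semirot phi k z1 z2 h n1 n2 n3.
Local Notation modulus_at := (modulus_at k z1 z2 n1 n2 n3).

(** A point with z <> 0 exists in the common neighbourhood by [dense_z_neq0], and there |zeta z|^2 /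
    |z|^(2 m) is the square of both constants. *)
Lemma modulus_unique (ka ka' : R) p (U : set M) : 0 < ka -> 0 < ka' ->
  modulus_at ka p -> open U -> U p ->
  (forall q, U q -> z1 q ^+ 2 + z2 q ^+ 2 != 0 ->
    S_ z1 z2 n1 n2 n3 q ^+ 2 + T_ z1 z2 n1 n2 n3 q ^+ 2
      = ka' ^+ 2 * (z1 q ^+ 2 + z2 q ^+ 2) `^ (1 - k)) -> ka = ka'.
Proof.
move=> ka0 ka0' [U' [oU' U'p E']] oU Up E.
have [|r [Ur U'r] zr] := dense_z_neq0 sr (openI oU oU'); first by exists p.
have := E _ Ur zr; rewrite (E' _ U'r zr) => /mulIf e.
have pz : (z1 r ^+ 2 + z2 r ^+ 2) `^ (1 - k) != 0.
  by rewrite gt_eqF // powR_gt0 // lt_neqAle eq_sym zr addr_ge0 // sqr_ge0.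
by apply/eqP; rewrite -(eqrXn2 (n := 2)) ?ltW //; apply/eqP; exact: e.
Qed.

(** [modulus_at] is an open condition by its form. Its complement is open too: every point has some
    modulus, valid on a neighbourhood, and by [modulus_unique] no other value occurs there. *)
Lemma modulus_constant : connected [set: M] ->
  (forall p, exists2 ka, 0 < ka & modulus_at ka p) ->
  forall ka p, 0 < ka -> modulus_at ka p -> forall q, modulus_at ka q.
Proof.
move=> cM loc ka p ka0 mp q.
have oA : open [set r | modulus_at ka r].
  rewrite openE => r [U [oU Ur E]].
  by apply: filterS (open_nbhs_nbhs (conj oU Ur)) => s Us; exists U.
have := cM [set r | modulus_at ka r]; move=> /(_ _ _ _)/seteqP[] //.
- by exists p.
- by exists [set r | modulus_at ka r] => //; rewrite setTI.
- exists [set r | modulus_at ka r]; last by rewrite setTI.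
  rewrite -[X in closed X]setCK; apply: open_closedC.
  rewrite openE => r nr; have [kb kb0 mr] := loc r; case: (mr) => U [oU Ur E].
  apply: filterS (open_nbhs_nbhs (conj oU Ur)) => s Us ms; apply: nr.
  by rewrite /= (modulus_unique ka0 kb0 ms oU Us E).
- by move=> _ /(_ q Logic.I).
Qed.

End Globalization.

(** * Rigid motions onto the model surfaces *)

Section Congruence.
Variables (R : realType) (M : manifold2 R) (x : M -> 'rV[R]_3) (o u v b : 'rV[R]_3).
Hypothesis fr : frame u v b.

Lemma frame_ext (y w : 'rV[R]_3) : dot y u = dot w u -> dot y v = dot w v ->
  dot y b = dot w b -> y = w.
Proof.
move=> eu ev eb; apply/eqP; rewrite -subr_eq0; apply/eqP/dot_eq0.
rewrite (frame_dot _ _ fr) !(dotBl y w) eu ev eb !subrr; ring.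
Qed.

(** Row vectors are multiplied from the left, so the columns are the axes of the new frame. Turning
    the frame by [- al] multiplies the coordinate z by e^{i al}. *)
Definition congruence_mx (al : R) : 'M[R]_3 :=
  frame_mx (cos (- al) *: u + sin (- al) *: v) (- sin (- al) *: u + cos (- al) *: v) b.

Lemma congruence_mxE al (h0 : R) p j :
  (x p *m congruence_mx al + (- (o *m congruence_mx al) - vec3 0 0 h0)) 0 j =
  vec3 (cos al * dot (x p - o) u - sin al * dot (x p - o) v)
       (sin al * dot (x p - o) u + cos al * dot (x p - o) v)
       (dot (x p - o) b - h0) 0 j.
Proof.
have -> : x p *m congruence_mx al + (- (o *m congruence_mx al) - vec3 0 0 h0) =
    (x p - o) *m congruence_mx al - vec3 0 0 h0 by rewrite mulmxBl addrA.
move: (x p - o) => y; rewrite [LHS]mxE /congruence_mx cosN sinN opprK.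
have [e0 e1 e2] := mulmx_frame y (cos al *: u + - sin al *: v) (sin al *: u + cos al *: v) b.
move: j; elim/I3_ind.
- by rewrite e0 dotC dotDl !dotZl (dotC u) (dotC v) !mxE /=; ring.
- by rewrite e1 dotC dotDl !dotZl (dotC u) (dotC v) !mxE /=; ring.
- by rewrite e2 !mxE /=.
Qed.

Lemma congruence_mxP al : congruence_mx al *m (congruence_mx al)^T = 1%:M /\
  \det (congruence_mx al) = 1.
Proof.
have fr' := frame_rotate (- al) fr.
by split; [exact: frame_mx_orthogonal|exact: frame_mx_det].
Qed.

Lemma polar_form_congruent k ka p :
  polar_form_at k (fun p => dot (x p - o) u) (fun p => dot (x p - o) v)
    (fun p => dot (x p - o) b) ka p ->
  locally_congruent_at x p (@xmc_dom R) (xmc (1 - k) (- (ka / (1 - k)))).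
Proof.
case=> e [al [h0 [[se ep] e0 eE]]].
exists e, (congruence_mx al), (- (o *m congruence_mx al) - vec3 0 0 h0).
split => //; first exact: congruence_mxP.
move=> q eq; apply/rowP => j; rewrite congruence_mxE.
have [E0 E1 E2] := eE q eq; rewrite /xmc E0 E1 E2.
by congr (vec3 _ _ _ 0 j); ring.
Qed.

Lemma graph_form_congruent k ka p :
  graph_form_at k (fun p => dot (x p - o) u) (fun p => dot (x p - o) v)
    (fun p => dot (x p - o) b) ka p ->
  exists n : nat, [/\ (0 < n)%N, 1 - k = n%:R
    & locally_congruent_at x p setT (xmc_graph n (- (ka / (1 - k))))].
Proof.
case=> e [al [h0 [n [[se ep] n0 mn eE]]]]; exists n; split=> //.
exists e, (congruence_mx al), (- (o *m congruence_mx al) - vec3 0 0 h0).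
split => //; first exact: congruence_mxP.
move=> q eq; apply/rowP => j; rewrite congruence_mxE.
have [E0 E1 E2] := eE q eq; rewrite /xmc_graph E0 E1 E2.
by congr (vec3 _ _ _ 0 j); ring.
Qed.

End Congruence.

Theorem theorem2p5 (R : realType) (M : manifold2 R) (x n : M -> 'rV[R]_3)
    (hM : connected [set: M])
    (hx : smooth_immersion x)
    (hn : gauss_map x n)
    (hK : ~ exists U : set M, [/\ open U, U !=set0
            & forall p, U p -> is_gradient x (gauss_curvature x n) p 0])
    (hsr : semi_rotational_gauss_map x n) :
  helicoidal x \/
  exists m c : R, [/\ m != 0, m != 1, c != 0 & locally_congruent_xmc x m c].
Proof.
have [cen [u [v [b [phi [k [fr sr]]]]]]] := semirot_of_gauss_map hx hn hK hsr.
rename cen into o.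
have [k1|k1] := eqVneq k 1.
  left; have [a aE] := height_translation sr k1 hM.
  exists o, b, a, phi; split; [exact: frame_aa fr|exact: sr_flow sr|].
  move=> t p; have [r0 r1 r2] := frame_rotation t (x p - o) fr.
  have E : x (phi t p) - o = rotation b t (x p - o) + (a * t) *: b.
    apply: (frame_ext fr); rewrite [RHS]dotDl dotZl ?r0 ?r1 ?r2.
    - by rewrite (sr_z1_flow sr) (dotC b) (frame_ua fr) mulr0 addr0.
    - by rewrite (sr_z2_flow sr) (dotC b) (frame_va fr) mulr0 addr0.
    - by rewrite aE (frame_aa fr) mulr1.
  by rewrite /screw /rotation_about -addrA -E addrC subrK.
right; have m0 : 1 - k != 0 by rewrite subr_eq0 eq_sym.
have [[p0 _]|eM] := pselect ([set: M] !=set0); last first.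
  (* On the empty surface the congruence is vacuous, and any admissible pair m, c will do. *)
  exists 2, 1; split; rewrite ?oner_neq0 ?pnatr_eq0 //.
    by rewrite -subr_eq0 (_ : 2 - 1 = 1) ?oner_neq0 //; ring.
  by move=> p; case: eM; exists p.
have k0 : k != 0 by apply: (rotation_rate_neq0 sr); exists p0.
have loc p : exists2 ka, 0 < ka & modulus_at k (fun p => dot (x p - o) u)
     (fun p => dot (x p - o) v) (fun p => dot (n p - 0) u)
     (fun p => dot (n p - 0) v) (fun p => dot (n p - 0) b) ka p /\
   (polar_form_at k (fun p => dot (x p - o) u) (fun p => dot (x p - o) v)
      (fun p => dot (x p - o) b) ka p \/
    graph_form_at k (fun p => dot (x p - o) u) (fun p => dot (x p - o) v)
      (fun p => dot (x p - o) b) ka p).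
  have [z0|z0] := eqVneq (dot (x p - o) u ^+ 2 + dot (x p - o) v ^+ 2) 0.
    by have [ka ka0 [mo gf]] := local_form_on_axis sr k1 z0; exists ka => //; split=> //; right.
  by have [ka ka0 [mo pf]] := local_form_off_axis sr k1 z0; exists ka => //; split=> //; left.
have [ka ka0 [mo _]] := loc p0.
have mod_all := modulus_constant sr hM
  (fun p => let: ex_intro2 kb kb0 (conj mb _) := loc p in ex_intro2 _ _ kb kb0 mb) ka0 mo.
(* The coefficient of r^m cos(m theta) in the normal form of the height; m <> 1 because k <> 0. *)
exists (1 - k), (- (ka / (1 - k))); split=> //.
- by rewrite -subr_eq0 addrAC subrr sub0r oppr_eq0.
- by rewrite oppr_eq0 mulf_neq0 ?invr_eq0 // gt_eqF.
move=> p; have [kb kb0 [[U [oU Up E]] fm]] := loc p.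
(* The modulus found at p is the one fixed at p0, so a single c serves all points. *)
have ekb : ka = kb := modulus_unique sr ka0 kb0 (mod_all p) oU Up E.
rewrite ekb; case: fm => [pf|gf]; [left|right].
- exact: polar_form_congruent pf.
- exact: graph_form_congruent gf.
Qed.
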